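(* Let the setting be as in the context (noiseless data). Assume that $V^*=(v_0^*,\dots,v_k^* )^T\in B(R)$ satisfies $L_i(V^* )=0$ in $\Omega$ for $i=0,\dots,k$, and let $a^*=a[V^*]$. Let $\lambda_1=\lambda_1(R,\alpha,h,k)$ be the number described in the context. For any $\lambda\ge\lambda_1$ let $V_{\min,\lambda}\in\overline{B(R)}$ be the unique minimizer of the functional $J_{\lambda,\alpha}$ on $\overline{B(R)}$ and let $a_{\mathrm{comp,min},\lambda}=a[V_{\min,\lambda}]$. Then there is a number $C_1=C_1(R,\alpha,h,k)>0$, depending only on the listed parameters, such that for all $\lambda\ge\lambda_1$ $$\|V_{\min,\lambda}-V^*\|_{H^2_{k+1}(\Omega)}\le C_1\sqrt{\lambda\alpha}\,e^{-\lambda(A^2-c)},$$ $$\|a_{\mathrm{comp,min},\lambda}-a^*\|_{L_2(\Omega)}\le C_1\sqrt{\lambda\alpha}\,e^{-\lambda(A^2-c)}.$$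
   Context: All functions are real valued. Let $n\ge1$, $0<A<B$, $D>0$, and $\Omega=\{\mathbf{x}\in\mathbb{R}^n: x_1\in(A,B),\ |x_j|<D,\ j=2,\dots,n\}$, $\Gamma_0=\{x_1=B,\ |x_j|<D,\ j=2,\dots,n\}\subset\partial\Omega$. Fix $\varepsilon>0$, an integer $k\ge3$, a step $h\ge h_0>0$ ($h_0\in(0,1)$ fixed), and $t_i=\varepsilon+ih$, $i=0,\dots,k$, $T=t_k$. The data $\Omega$ and $\varepsilon$ are considered as fixed. Put $$w(\mathbf{x},\varepsilon)=-\frac{|\mathbf{x}|^2}{4\varepsilon}-\ln\left((2\sqrt{\pi\varepsilon})^n\right).$$ Operators. For a vector function $V=(v_0,\dots,v_k)^T$ on $\Omega$ define $$L_0=\Delta v_0+2\nabla v_0\cdot\nabla w(\mathbf{x},\varepsilon)+(v_0-v_1)/h,$$ $$L_i=\Delta v_i+2\nabla v_i\cdot\nabla w(\mathbf{x},\varepsilon)+2h\nabla v_i\cdot\sum_{j=0}^i\nabla v_j+(v_i-v_{i+1})/h,\quad i=1,\dots,k-1,$$ $$L_k=\Delta v_k+2\nabla v_k\cdot\nabla w(\mathbf{x},\varepsilon)+2h\nabla v_k\cdot\sum_{j=0}^k\nabla v_j+(v_{k-1}+v_{k-2}+v_{k-3}-3v_k)/(6h).$$ Boundary conditions. For given functions $g_0(\mathbf{x},t_i)$ on $\partial\Omega$ and $g_1(\mathbf{x},t_i)$ on $\Gamma_0$, $i=0,\dots,k$ (noiseless data), the boundary conditions (BC) for $V$ are: $v_i=\frac{g_0(\cdot,t_{i+1})-g_0(\cdot,t_i)}{h}$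 on $\partial\Omega$ and $\partial_{x_1}v_i=\frac{g_1(\cdot,t_{i+1})-g_1(\cdot,t_i)}{h}$ on $\Gamma_0$ for $i=0,\dots,k-1$; and $v_k=\frac{3g_0(\cdot,t_k)-g_0(\cdot,t_{k-1})-g_0(\cdot,t_{k-2})-g_0(\cdot,t_{k-3})}{6h}$ on $\partial\Omega$, $\partial_{x_1}v_k=\frac{3g_1(\cdot,t_k)-g_1(\cdot,t_{k-1})-g_1(\cdot,t_{k-2})-g_1(\cdot,t_{k-3})}{6h}$ on $\Gamma_0$. Spaces and sets. $m_n=[n/2]+2$ ($[\cdot]$ is the integer part). For a Hilbert space $H$, $H_{k+1}$ is the space of $(k+1)$-tuples of elements of $H$ with $\|Q\|_{H_{k+1}}^2=\sum_i\|q_i\|_H^2$. $[\cdot,\cdot]$ is the scalar product in $H^{m_n}_{k+1}(\Omega)$. $H^{m_n}_0(\Omega)=\{q\in H^{m_n}(\Omega): q|_{\partial\Omega}=0,\ q_{x_1}|_{\Gamma_0}=0\}$, and $H^{m_n}_{0,k+1}(\Omega)$ is the corresponding space of $(k+1)$-tuples. For $R>0$, $B(R)=\{V\in H^{m_n}_{k+1}(\Omega):\|v_i\|_{H^{m_n}(\Omega)}<R,\ i=0,\dots,k,\ V\text{ satisfies (BC)}\}$, and $\overline{B(R)}$ is its closure in $H^{m_n}_{k+1}(\Omega)$. Functional. $\varphi_\lambda(x_1)=e^{2\lambda x_1^2}$, $\alpha\in(0,1)$, $c>0$, and $$J_{\lambda,\alpha}(V)=e^{-2\lambda c}\sum_{i=0}^{k}\int_\Omega\left[L_i(V)\right]^2\varphi_\lambda(x_1)\,d\mathbf{x}+\alpha\|V\|^2_{H^{m_n}_{k+1}(\Omega)},\quad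 V\in\overline{B(R)}.$$ The number $\lambda_1$. $\lambda_1=\lambda_1(R,\alpha,h,k)\ge1$ is a threshold, depending only on the listed parameters, for which the global strong convexity theorem holds for $J_{\lambda,\alpha}$ on $\overline{B(R)}$: for all $\lambda\ge\lambda_1$ the functional has a Fréchet derivative $J'_{\lambda,\alpha}(V)\in H^{m_n}_{0,k+1}(\Omega)$ at every $V\in\overline{B(R)}$; with some $C_1=C_1(R,\alpha,h,k)>0$, for all $V_1,V_2\in\overline{B(R)}$, $$J_{\lambda,\alpha}(V_2)-J_{\lambda,\alpha}(V_1)-[J'_{\lambda,\alpha}(V_1),V_2-V_1]\ge C_1\frac{e^{2\lambda(A^2-c)}}{\lambda}\sum_{i,j=1}^n\|\partial^2_{x_ix_j}(V_2-V_1)\|^2_{L_{2,k+1}(\Omega)}+C_1e^{2\lambda(A^2-c)}\|V_2-V_1\|^2_{H^1_{k+1}(\Omega)}+\alpha\|V_2-V_1\|^2_{H^{m_n}_{k+1}(\Omega)};$$ and $J_{\lambda,\alpha}$ has a unique minimizer $V_{\min,\lambda}$ on $\overline{B(R)}$, which satisfies $[J'_{\lambda,\alpha}(V_{\min,\lambda}),V_{\min,\lambda}-V]\le0$ for all $V\in\overline{B(R)}$. Reconstruction formula. For $V=(v_0,\dots,v_k)^T$ put $w_V(\mathbf{x},t_i)=h\sum_{j=0}^iv_j(\mathbf{x})+w(\mathbf{x},\varepsilon)$ and $$a[V](\mathbf{x})=\frac{1}{T-\varepsilon}\left(w_V(\mathbf{x},t_k)-w(\mathbf{x},\varepsilon)\right)-\frac1{T-\varepsilon}\sum_{i=0}^k\left(\Delta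 w_V(\mathbf{x},t_i)+|\nabla w_V(\mathbf{x},t_i)|^2\right).$$ *)

(* Defs.v *)
From HB Require Import structures.
From mathcomp Require Import all_boot all_order all_algebra.
From mathcomp Require Import all_classical all_reals all_analysis.
Set Implicit Arguments. Unset Strict Implicit. Unset Printing Implicit Defensive.
Import Order.TTheory GRing.Theory Num.Theory numFieldNormedType.Exports.
Local Open Scope classical_set_scope.
Local Open Scope ring_scope.
Definition rv_display : measure_display. Proof. exact: default_measure_display. Qed.
(* 'rV[R]_n carries the sigma-algebra generated by the coordinates, that is,
   the Borel one. *)
Section rv_measurable.
Context {R : realType} {n : nat}.
Definition rv_coord (i : 'I_n) (x : 'rV[R]_n) : measurableTypeR R := x ord0 i.
Let s0 : g_sigma_preimage rv_coord set0.
Proof. exact: sigma_algebra0. Qed.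
Let sC A : g_sigma_preimage rv_coord A -> g_sigma_preimage rv_coord (~` A).
Proof. exact: sigma_algebraC. Qed.
Let sU (F : _^nat) : (forall i, g_sigma_preimage rv_coord (F i)) ->
  g_sigma_preimage rv_coord (\bigcup_i F i).
Proof. exact: sigma_algebra_bigcup. Qed.
HB.instance Definition _ := @isMeasurable.Build rv_display 'rV[R]_n
  (g_sigma_preimage rv_coord) s0 sC sU.

Lemma measurable_rv_coord (i : 'I_n) : measurable_fun [set: 'rV[R]_n] (rv_coord i).
Proof.
move=> _ Y mY; rewrite setTI; apply: sub_sigma_algebra => /=.
rewrite -bigcup_seq/=; exists i => /=; first by rewrite mem_index_enum.
by exists Y => //; rewrite setTI.
Qed.

Lemma measurable_to_rv d (T : measurableType d) (f : T -> 'rV[R]_n) :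
  (forall i, measurable_fun [set: T] (rv_coord i \o f)) ->
  measurable_fun [set: T] f.
Proof.
move=> mf _ A mA; rewrite setTI.
pose G := [set B : set 'rV[R]_n | measurable (f @^-1` B)].
suff : g_sigma_preimage rv_coord `<=` G by apply.
apply: smallest_sub; [split|].
- by rewrite /G/= preimage_set0.
- by move=> B mB; rewrite /G/= setTD preimage_setC; exact: measurableC.
- by move=> F mF; rewrite /G/= preimage_bigcup; apply: bigcup_measurable => k _; exact: mF.
rewrite -bigcup_seq => B [i /= _ [C mC <-]]; rewrite /G/= setTI.
by have := mf i measurableT C mC; rewrite setTI.
Qed.
End rv_measurable.

Section rv_cons.
Context {R : realType}.
Definition rv_cons n (p : measurableTypeR R * 'rV[R]_n) : 'rV[R]_n.+1 :=
  row_mx (p.1)%:M p.2.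

Lemma measurable_rv_cons n : measurable_fun setT (@rv_cons n).
Proof.
apply: measurable_to_rv => i; have [j ->|j ->] := @split_ordP 1 n i.
  rewrite (_ : _ \o _ = fst); first exact: measurable_fst.
  by apply/funext => p; rewrite /rv_coord /rv_cons /= (@row_mxEl R 1 1 n) (ord1 j) mxE eqxx mulr1n.
rewrite (_ : _ \o _ = rv_coord j \o snd).
  exact: measurableT_comp (measurable_rv_coord _) measurable_snd.
by apply/funext => p; rewrite /rv_coord /rv_cons /= (@row_mxEr R 1 1 n).
Qed.
End rv_cons.
Section lebesgue_step.
Context {R : realType} {n : nat} (mu : {sigma_finite_measure set 'rV[R]_n -> \bar R}).
Definition lebesgue_step : set 'rV[R]_n.+1 -> \bar R :=
  pushforward (lebesgue_measure \x mu)%E (@rv_cons R n).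

Let step0 : lebesgue_step set0 = 0%E.
Proof. by rewrite /lebesgue_step /pushforward preimage_set0 measure0. Qed.

Let mcons (A : set 'rV[R]_n.+1) : measurable A ->
  measurable (@rv_cons R n @^-1` A).
Proof.
by move=> mA; rewrite -[X in measurable X]setTI; exact: measurable_rv_cons.
Qed.

Let step_ge0 A : (0 <= lebesgue_step A)%E.
Proof. exact: integral_ge0. Qed.

Let step_sigma_additive : semi_sigma_additive lebesgue_step.
Proof.
move=> F mF tF mUF; rewrite /lebesgue_step /pushforward preimage_bigcup.
apply: measure_semi_sigma_additive.
- by move=> i; exact: mcons.
- apply/trivIsetP => /= i j _ _ ij; rewrite -preimage_setI.
  by move/trivIsetP : tF => /(_ _ _ _ _ ij) ->//; rewrite preimage_set0.
- by rewrite -preimage_bigcup; exact: mcons.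
Qed.

HB.instance Definition _ := isMeasure.Build _ _ _ lebesgue_step
  step0 step_ge0 step_sigma_additive.

Let step_sigma_finite : sigma_finite setT lebesgue_step.
Proof.
have /sigma_finiteP[F [FT ndF mF]] := sigma_finiteT (@lebesgue_measure R).
have /sigma_finiteP[G [GT ndG mG]] := sigma_finiteT mu.
pose hd (y : 'rV[R]_n.+1) : measurableTypeR R := rv_coord ord0 y.
pose tl (y : 'rV[R]_n.+1) : 'rV[R]_n := @rsubmx R 1 1 n y.
have mhd : measurable_fun setT hd by exact: measurable_rv_coord.
have mtl : measurable_fun setT tl.
  apply: measurable_to_rv => i.
  rewrite (_ : _ \o _ = rv_coord (rshift 1 i)); first exact: measurable_rv_coord.
  by apply/funext => y; rewrite /rv_coord /tl /= mxE.
have hdE p : hd (rv_cons p) = p.1.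
  rewrite /hd /rv_coord /rv_cons (_ : ord0 = @lshift 1 n ord0); last exact/val_inj.
  by rewrite (@row_mxEl R 1 1 n) mxE eqxx mulr1n.
have tlE p : tl (rv_cons p) = p.2 by rewrite /tl /rv_cons (@row_mxKr R 1 1 n).
exists (fun i => hd @^-1` F i `&` tl @^-1` G i).
  apply/seteqP; split => // y _.
  have : (\bigcup_i F i) (hd y) by rewrite -FT.
  have : (\bigcup_i G i) (tl y) by rewrite -GT.
  move=> [i _ Gi] [j _ Fj]; exists (maxn i j) => //; split => /=.
    by have /subsetPset := ndF _ _ (leq_maxr i j); apply.
  by have /subsetPset := ndG _ _ (leq_maxl i j); apply.
move=> i; split.
  apply: measurableI; rewrite -[X in measurable X]setTI.
    by apply: mhd => //; exact: (mF i).1.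
  by apply: mtl => //; exact: (mG i).1.
rewrite /lebesgue_step /pushforward.
rewrite (_ : _ @^-1` _ = F i `*` G i); last first.
  by apply/seteqP; split => p /=; rewrite hdE tlE.
rewrite product_measure1E//; [|exact: (mF i).1|exact: (mG i).1].
by apply: lte_mul_pinfty; rewrite ?measure_ge0 ?ge0_fin_numE ?(mF i).2 ?(mG i).2.
Qed.

HB.instance Definition _ := Measure_isSigmaFinite.Build _ _ _ lebesgue_step
  step_sigma_finite.
End lebesgue_step.

(* Lebesgue measure on R^n: the n-fold product of the Lebesgue measure on R,
   transported along R * R^m -> R^(m+1), and a Dirac mass on R^0. *)
Fixpoint lebesgue_rv (R : realType) n :
    {sigma_finite_measure set 'rV[R]_n -> \bar R} :=
  match n with
  | 0 => [the {sigma_finite_measure set 'rV[R]_0 -> \bar R} of \d_ (0 : 'rV[R]_0)]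
  | m.+1 => [the {sigma_finite_measure set 'rV[R]_m.+1 -> \bar R} of
             lebesgue_step (lebesgue_rv R m)]
  end.

Section sobolev.
Context {R : realType} {d : nat}.
Implicit Types (Om : set 'rV[R]_d) (u v g : 'rV[R]_d -> R).

Definition partial (i : 'I_d) (f : 'rV[R]_d -> R) : 'rV[R]_d -> R :=
  fun x => 'D_(delta_mx 0 i) f x.

Definition mpartial (b : 'I_d -> nat) (f : 'rV[R]_d -> R) : 'rV[R]_d -> R :=
  foldr (fun i g => iter (b i) (partial i) g) f (enum 'I_d).

Definition smooth (f : 'rV[R]_d -> R) : Prop :=
  forall (s : seq 'I_d) x, differentiable (foldr partial f s) x.

Definition test_function Om (phi : 'rV[R]_d -> R) : Prop :=
  smooth phi /\
  exists K, [/\ compact K, K `<=` Om & forall x, ~ K x -> phi x = 0].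

Definition L2 Om u : Prop :=
  measurable_fun Om u /\
  (\int[lebesgue_rv R d]_(x in Om) ((u x) ^+ 2)%:E < +oo)%E.

Definition L2norm Om u : R :=
  Num.sqrt (\int[lebesgue_rv R d]_(x in Om) (u x) ^+ 2).

Definition is_wderiv Om (b : 'I_d -> nat) u g : Prop :=
  forall phi, test_function Om phi ->
    \int[lebesgue_rv R d]_(x in Om) (u x * mpartial b phi x) =
    (-1) ^+ (\sum_i b i) * \int[lebesgue_rv R d]_(x in Om) (g x * phi x).

(* A representative of the square integrable weak derivative of multi-order b,
   determined almost everywhere in Om; the junk value is the zero function. *)
Definition wderiv Om (b : 'I_d -> nat) u : 'rV[R]_d -> R :=
  xget (fun=> 0) [set g | L2 Om g /\ is_wderiv Om b u g].

Definition wpartial Om (i : 'I_d) u := wderiv Om (fun l => (l == i) : nat) u.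

Definition wpartial2 Om (i j : 'I_d) u :=
  wderiv Om (fun l => ((l == i) + (l == j))%N) u.

Definition wlaplacian Om u x : R := \sum_i wpartial2 Om i i u x.

Definition Hm Om (m : nat) u : Prop :=
  L2 Om u /\
  forall b : 'I_d -> nat, (\sum_i b i <= m)%N ->
    exists g, L2 Om g /\ is_wderiv Om b u g.

Definition Hdot Om (m : nat) u v : R :=
  \sum_(b : {ffun 'I_d -> 'I_m.+1} | (\sum_i b i <= m)%N)
    \int[lebesgue_rv R d]_(x in Om)
      (wderiv Om (fun i => b i) u x * wderiv Om (fun i => b i) v x).

Definition Hnorm Om (m : nat) u : R := Num.sqrt (Hdot Om m u u).

(* u = q on the set S of points of the closure of Om, for the representative
   of u that is continuous up to the boundary. For u in H^m with
   m = [d/2] + 2 on a box, u and its first derivatives have one, by the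
   Sobolev embedding of H^m into C^1 of the closure. *)
Definition trace_eq Om (S : set 'rV[R]_d) u (q : 'rV[R]_d -> R) : Prop :=
  exists uc : 'rV[R]_d -> R,
    [/\ {within closure Om, continuous uc},
        {ae lebesgue_rv R d, forall x, Om x -> uc x = u x} &
        forall x, S x -> uc x = q x].

Variable k : nat.
Implicit Types V W : 'I_k.+1 -> 'rV[R]_d -> R.

Definition tsub V W : 'I_k.+1 -> 'rV[R]_d -> R := fun i x => V i x - W i x.

Definition THm Om m V : Prop := forall i, Hm Om m (V i).

Definition THdot Om m V W : R := \sum_i Hdot Om m (V i) (W i).

Definition THnorm Om m V : R := Num.sqrt (\sum_i Hnorm Om m (V i) ^+ 2).

End sobolev.

Section problem.
Context {R : realType} {n : nat}.
(* The space dimension is n.+1, and the coordinate x_1 is x 0 ord0. *)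
Local Notation pt := 'rV[R]_n.+1.
Variables (A B D eps : R) (k : nat) (h : R).
Local Notation tuple_fun := ('I_k.+1 -> pt -> R).
Implicit Types V W G : tuple_fun.

Definition Omega : set pt :=
  [set x | A < x 0 ord0 < B /\ forall j, j != ord0 -> `|x 0 j| < D].

Definition Gamma0 : set pt :=
  [set x | x 0 ord0 = B /\ forall j, j != ord0 -> `|x 0 j| < D].

Definition bdOmega : set pt := closure Omega `\` interior Omega.

Definition m_n : nat := (n.+1)./2 + 2.

Definition time (i : nat) : R := eps + i%:R * h.

Definition w (x : pt) : R :=
  - (\sum_i (x 0 i) ^+ 2) / (4 * eps)
  - ln ((2 * Num.sqrt (pi * eps)) ^+ n.+1).

Definition Lop V (i : nat) (x : pt) : R :=
  let v (j : nat) := V (inord j) in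
  let diffusion := wlaplacian Omega (v i) x
    + 2 * \sum_l wpartial Omega l (v i) x * partial l w x in
  let nonlinear := 2 * h *
    \sum_l wpartial Omega l (v i) x *
           \sum_(j < i.+1) wpartial Omega l (v j) x in
  if i == 0%N then diffusion + (v 0%N x - v 1%N x) / h
  else if (i < k)%N then diffusion + nonlinear + (v i x - v i.+1 x) / h
  else diffusion + nonlinear
    + (v (k - 1)%N x + v (k - 2)%N x + v (k - 3)%N x - 3 * v k x) / (6 * h).

(* The right-hand side of the i-th boundary condition for the data g = g_0
   or g = g_1. *)
Definition bc_data (g : pt -> R -> R) (i : nat) (x : pt) : R :=
  if (i < k)%N then (g x (time i.+1) - g x (time i)) / h
  else (3 * g x (time k) - g x (time (k - 1)) - g x (time (k - 2))
        - g x (time (k - 3))) / (6 * h).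

Definition BC (g0 g1 : pt -> R -> R) V : Prop :=
  forall i : 'I_k.+1,
    trace_eq Omega bdOmega (V i) (bc_data g0 i) /\
    trace_eq Omega Gamma0 (wpartial Omega ord0 (V i)) (bc_data g1 i).

Definition H0 V : Prop :=
  THm Omega m_n V /\
  forall i : 'I_k.+1,
    trace_eq Omega bdOmega (V i) (fun=> 0) /\
    trace_eq Omega Gamma0 (wpartial Omega ord0 (V i)) (fun=> 0).

Definition Ball (rho : R) (g0 g1 : pt -> R -> R) V : Prop :=
  [/\ THm Omega m_n V, forall i, Hnorm Omega m_n (V i) < rho & BC g0 g1 V].

Definition Ballbar (rho : R) (g0 g1 : pt -> R -> R) V : Prop :=
  THm Omega m_n V /\
  forall e, 0 < e ->
    exists2 W, Ball rho g0 g1 W & THnorm Omega m_n (tsub V W) < e.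

Definition phi_weight (lam : R) (x : pt) : R := expR (2 * lam * (x 0 ord0) ^+ 2).

Definition J (c lam alpha : R) V : R :=
  expR (- (2 * lam * c)) *
    (\sum_(i < k.+1) \int[lebesgue_rv R n.+1]_(x in Omega)
       ((Lop V i x) ^+ 2 * phi_weight lam x))
  + alpha * THnorm Omega m_n V ^+ 2.

Section convexity.
Variables (rho alpha c : R) (g0 g1 : pt -> R -> R).

(* G is the Frechet derivative at V of the functional J, whose domain is
   Ballbar: admissible increments stay in this set. *)
Definition is_frechet (lam : R) V G : Prop :=
  H0 G /\
  forall e, 0 < e -> exists2 r, 0 < r &
    forall W, Ballbar rho g0 g1 W -> THnorm Omega m_n (tsub W V) < r ->
      `|J c lam alpha W - J c lam alpha V - THdot Omega m_n G (tsub W V)|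
        <= e * THnorm Omega m_n (tsub W V).

Definition is_minimizer (lam : R) V : Prop :=
  Ballbar rho g0 g1 V /\
  forall W, Ballbar rho g0 g1 W -> J c lam alpha V <= J c lam alpha W.

Definition strong_convexity (lam C : R) (dJ : tuple_fun -> tuple_fun) : Prop :=
  forall V1 V2, Ballbar rho g0 g1 V1 -> Ballbar rho g0 g1 V2 ->
    let Q := tsub V2 V1 in
    C * (expR (2 * lam * (A ^+ 2 - c)) / lam) *
        (\sum_i \sum_j \sum_l L2norm Omega (wpartial2 Omega i j (Q l)) ^+ 2)
    + C * expR (2 * lam * (A ^+ 2 - c)) * THnorm Omega 1 Q ^+ 2
    + alpha * THnorm Omega m_n Q ^+ 2
    <= J c lam alpha V2 - J c lam alpha V1 - THdot Omega m_n (dJ V1) Q.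

Definition convexity_threshold (lam1 C : R) : Prop :=
  [/\ 1 <= lam1, 0 < C &
    forall lam, lam1 <= lam ->
      exists dJ : tuple_fun -> tuple_fun,
        [/\ forall V, Ballbar rho g0 g1 V -> is_frechet lam V (dJ V),
            strong_convexity lam C dJ &
            exists Vmin,
              [/\ is_minimizer lam Vmin,
                  forall W, is_minimizer lam W -> forall i,
                    {ae lebesgue_rv R n.+1,
                      forall x, Omega x -> W i x = Vmin i x} &
                  forall V, Ballbar rho g0 g1 V ->
                    THdot Omega m_n (dJ Vmin) (tsub Vmin V) <= 0]]].

End convexity.

Definition wV V (i : nat) (x : pt) : R :=
  h * \sum_(j < i.+1) V (inord j) x + w x.

Definition aV V (x : pt) : R :=
  (time k - eps)^-1 * (wV V k x - w x)
  - (time k - eps)^-1 *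
    \sum_(i < k.+1) (wlaplacian Omega (wV V i) x
                     + \sum_l (wpartial Omega l (wV V i) x) ^+ 2).

End problem.

(* Main.v *)
(* Strong convexity between V_min and V*, the variational inequality at V_min
   and J(V* ) = alpha ||V*||^2 give the H^2 bound at once.  In the difference of
   the coefficients the only nonlinear term is a difference of squared
   gradients, controlled by the H^1 norm because both gradients are bounded
   almost everywhere, by the Sobolev embedding of H^m, m > d/2 + 1, in W^(1,oo).

   The embedding is proved by duality.  A function whose integrals against
   tensor products of bumps on the dyadic cells of the box are at most K times
   the volume of the cell is bounded by K.  Two tensor products on a cell whose
   factors have the same integrals differ by a sum of partial derivatives of
   tensor products, so integrating by parts exchanges one derivative for the
   side of the cell.  Comparing a bump with a bump on the parent cell, and so on
   up to the whole box, bounds the pairing with a derivative of order r by a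
   geometric sum of pairings with derivatives of order r + 1; the highest order
   is handled by the Cauchy-Schwarz inequality.  The same duality, with K = 0,
   shows that weak derivatives are unique. *)
Require Import Defs.
From mathcomp Require Import all_boot all_order all_algebra.
From mathcomp Require Import all_classical all_reals all_analysis.
From mathcomp Require Import measurable_realfun ring lra.
Set Implicit Arguments. Unset Strict Implicit. Unset Printing Implicit Defensive.
Import Order.TTheory GRing.Theory Num.Theory numFieldNormedType.Exports.
Local Open Scope classical_set_scope.
Local Open Scope ring_scope.

(** * Lebesgue measure of boxes *)

Section box.
Context {R : realType}.

(** Weak derivatives are values of a choice operator, so linearity, or the vanishing of the
    derivatives of V - V, holds only almost everywhere: uniqueness is needed even for the algebra of
    norms. The duality uses only tensor products, whose calculus is that of one variable and whose
    mixed derivatives commute factor by factor; neither mollification nor extension across the faces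
    occurs. General test functions are met only for the explicit function w, by integration along
    lines. In dimension d the Cauchy-Schwarz inequality loses the square root of the volume of a
    cell, a factor 2^(dj/2) at level j, while one integration by parts gains 2^(-j). Hence [d/2] + 1
    of them suffice, and of the [d/2] + 2 derivatives at hand exactly one order, the gradient, is
    left bounded. Second derivatives are only square integrable, but they enter the coefficient
    linearly. The factor sqrt(lam) in the result comes from the division by lam in front of the
    second derivatives in the convexity estimate. *)

Definition box n (J : 'I_n -> set R) : set 'rV[R]_n :=
  [set x | forall i, J i (x 0 i)].

Lemma measurable_coord_preimage n (i : 'I_n) (Y : set R) :
  measurable Y -> measurable [set x : 'rV[R]_n | Y (x 0 i)].
Proof.
move=> mY; have := @measurable_rv_coord R n i measurableT Y mY.
by rewrite setTI.
Qed.

Lemma measurable_box n (J : 'I_n -> set R) :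
  (forall i, measurable (J i)) -> measurable (box J).
Proof.
move=> mJ; rewrite (_ : box J = \bigcap_(i in setT) [set x | J i (x 0 i)]).
  apply: fin_bigcap_measurable; first exact: finite_finset.
  by move=> i _; exact: measurable_coord_preimage.
by apply/seteqP; split => x /=; [move=> xJ i _|move=> xJ i]; exact: xJ.
Qed.

Lemma lebesgue_box n (J : 'I_n -> set R) (l : 'I_n -> R) :
  (forall i, measurable (J i)) ->
  (forall i, lebesgue_measure (J i) = (l i)%:E) ->
  lebesgue_rv R n (box J) = (\prod_i l i)%:E.
Proof.
elim: n J l => [|n IH] J l mJ lJ.
  rewrite /= big_ord0 /dirac /= indicE mem_set//.
  by move=> i; have := ltn_ord i; rewrite ltn0.
rewrite big_ord_recl EFinM -lJ -(IH (fun i => J (lift ord0 i)) (fun i => l (lift ord0 i)))//.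
rewrite -product_measure1E//; last exact: measurable_box.
rewrite /= /lebesgue_step /pushforward; congr (product_measure1 _ _ _).
have h0 : ord0 = @lshift 1 n ord0 by exact/val_inj.
have h1 (j : 'I_n) : lift ord0 j = @rshift 1 n j by exact/val_inj.
apply/seteqP; split => [[p1 p2]|[p1 p2]] /=.
  rewrite /rv_cons /= => pJ; split => /=.
    by have := pJ ord0; rewrite h0 (@row_mxEl R 1 1 n) mxE eqxx mulr1n.
  by move=> j; have := pJ (lift ord0 j); rewrite h1 (@row_mxEr R 1 1 n).
rewrite /rv_cons /= => -[/= J0 J1] i; case: (unliftP ord0 i) => [j ->|->].
  by rewrite h1 (@row_mxEr R 1 1 n) -h1; exact: J1.
by rewrite h0 (@row_mxEl R 1 1 n) mxE eqxx mulr1n -h0.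
exact: mJ.
Qed.

End box.

(** * The dyadic grid of a box, and signs tested on its cells *)

Section grid.
Context {R : realType} {n : nat} (a l : 'I_n -> R).
Hypothesis l_gt0 : forall i, 0 < l i.

(** Index of the half-open dyadic cell of level [j] that contains [x], once the box of corner [a]
    and sides [l] is rescaled to the unit cube; the grid covers the whole space. *)
Definition grid j (x : 'rV[R]_n) (i : 'I_n) : int :=
  Num.floor (2 ^+ j * ((x 0 i - a i) / l i)).

(** Arbitrary unions of cells of one level. Infinite unions are allowed, so the whole space is such
    a set. *)
Definition grid_set (E : set 'rV[R]_n) :=
  exists j (S : set ('I_n -> int)), E = [set x | S (grid j x)].

(** Halving the index of a cell and rounding down gives the index of its parent; this is why each
    level refines the previous one. *)
Lemma floor_half (y : R) : Num.floor ((Num.floor (2 * y))%:~R / 2 : R) = Num.floor y.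
Proof.
apply: floor_def; have h1 := floor_le y; have h2 := floorD1_gt y.
have h3 := floor_le (2 * y); apply/andP; split.
  rewrite ler_pdivlMr// mulrC.
  have : (2 * Num.floor y <= Num.floor (2 * y))%R.
    by rewrite floor_ge_int intrM; lra.
  by rewrite -(ler_int R) intrM.
rewrite ltr_pdivrMr//; lra.
Qed.

Lemma grid_refine j k (S : set ('I_n -> int)) : exists S' : set ('I_n -> int),
  [set x | S (grid j x)] = [set x | S' (grid (k + j) x)].
Proof.
elim: k => [|k [S' ->]]; first by exists S.
exists [set z | S' (fun i => Num.floor ((z i)%:~R / 2 : R))].
apply/seteqP; split => x /=; rewrite /grid.
  by under [X in _ -> S' X]funext => i do rewrite exprS -mulrA floor_half.
by under [X in S' X -> _]funext => i do rewrite exprS -mulrA floor_half.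
Qed.

Lemma grid_setring : setring grid_set.
Proof.
(* Both sets are rewritten at the common level [k + j], where union and difference act on the index
   sets. *)
have common A B : grid_set A -> grid_set B -> exists j (S S' : set ('I_n -> int)),
    A = [set x | S (grid j x)] /\ B = [set x | S' (grid j x)].
  move=> [j [S ->]] [k [T ->]].
  have [S' ->] := grid_refine j k S; have [T' ->] := grid_refine k j T.
  by exists (k + j)%N, S', T'; split => //; rewrite addnC.
split.
- by exists 0%N, set0; apply/seteqP; split.
- move=> A B gA gB; have [j [S [T [-> ->]]]] := common _ _ gA gB.
  by exists j, (S `|` T).
- move=> A B gA gB; have [j [S [T [-> ->]]]] := common _ _ gA gB.
  by exists j, (S `\` T).
Qed.

(** With [b = true] the cells are half-open and partition the space; with [b = false] they are open,
    the form in which they carry compactly supported bumps. *)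
Definition grid_cell j (z : 'I_n -> int) (b : bool) : set 'rV[R]_n :=
  box (fun i => [set` Interval (BSide b (a i + l i * (z i)%:~R / 2 ^+ j))
                       (BLeft (a i + l i * ((z i)%:~R + 1) / 2 ^+ j))]).

Lemma grid_cellE j (z : 'I_n -> int) :
  [set x | forall i, grid j x i = z i] = grid_cell j z true.
Proof.
have p0 : 0 < 2 ^+ j :> R by rewrite exprn_gt0.
have e1 i (t u : R) : (a i + l i * u / 2 ^+ j <= t) = (u <= 2 ^+ j * ((t - a i) / l i)).
  by rewrite -lerBrDl ler_pdivrMr// mulrC -ler_pdivlMr// mulrA (mulrC (t - a i)).
apply/seteqP; split => x /= h i; have := h i; rewrite /= in_itv/= /grid.
  move=> <-; apply/andP; split; first by rewrite e1 floor_le.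
  by rewrite ltNge -intrD1 e1 -ltNge floorD1_gt.
by move=> /andP[]; rewrite ltNge !e1 -ltNge => h1 h2; apply: floor_def; rewrite h1 intrD.
Qed.

Lemma measurable_grid_cell j z b : measurable (grid_cell j z b).
Proof. exact: measurable_box. Qed.

Lemma lebesgue_grid_cell j z b :
  lebesgue_rv R n (grid_cell j z b) = (\prod_i (l i / 2 ^+ j))%:E.
Proof.
apply: lebesgue_box => // i; rewrite lebesgue_measure_itv /= lte_fin.
have p0 : 0 < l i / 2 ^+ j :> R by rewrite divr_gt0// exprn_gt0.
rewrite ifT -?EFinD; first by congr _%:E; ring.
by rewrite -subr_gt0 (_ : _ - _ = l i / 2 ^+ j)//; ring.
Qed.

Lemma measurable_grid_set j (S : set ('I_n -> int)) :
  measurable [set x | S (grid j x)].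
Proof.
(* Indices are taken as finite functions because these form a countable type. *)
rewrite (_ : [set x | _] = \bigcup_(z : {ffun 'I_n -> int})
    (if `[< S z >] then [set x | forall i, grid j x i = z i] else set0)); last first.
  apply/seteqP; split => x /=.
    move=> Sx; exists [ffun i => grid j x i] => //=.
    have -> : ([ffun i => grid j x i] : 'I_n -> int) = grid j x.
      by apply/funext => i; rewrite ffunE.
    by rewrite asboolT// => i; rewrite ffunE.
  move=> [z _]; case: asboolP => // Sz /= /funext.
  by rewrite -[X in _ = X -> _]/(z : 'I_n -> int) => ->.
apply: countable_bigcupT_measurable; first exact: countableP.
by move=> z; case: ifP => // _; rewrite grid_cellE; exact: measurable_grid_cell.
Qed.

(** The half-space [x 0 i < t] is the union over [j] of the cells of level [j] whose right end in
    direction [i] is at most [t]; a sigma-ring that contains the whole space is a sigma-algebra. *)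
Lemma measurable_sub_grid : @measurable _ 'rV[R]_n `<=` <<sr grid_set >>.
Proof.
have [S0 SD SU] := smallest_sigma_ring grid_set.
have ST : <<sr grid_set >> setT.
  by apply: sub_g_sigma_ring; exists 0%N, setT; apply/seteqP; split.
apply: smallest_sub; first by split=> // A hA; exact: SD.
move=> B; rewrite -bigcup_seq => -[i _ [Y mY <-]]; rewrite setTI.
pose G := [set Y : set R | <<sr grid_set >> [set x : 'rV[R]_n | Y (x 0 i)]].
suff : @measurable _ (measurableTypeR R) `<=` G by apply.
rewrite measurable_realfun.RGenInftyO.measurableE; apply: smallest_sub.
  split => //.
  - by move=> A GA; rewrite /G /=; have := SD _ _ ST GA; congr (<<sr _ >>); apply/seteqP; split => x /= => [[]|] //; split.
  - move=> F GF; rewrite /G /=.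
    rewrite (_ : [set x | _] = \bigcup_k [set x : 'rV[R]_n | F k (x 0 i)]) //.
    exact: SU.
move=> _ [t ->]; rewrite /G /=.
have p0 j : 0 < 2 ^+ j :> R by rewrite exprn_gt0.
rewrite (_ : [set x | _] = \bigcup_j [set x : 'rV[R]_n |
    [set z : 'I_n -> int | (z i)%:~R + 1 <= 2 ^+ j * ((t - a i) / l i)] (grid j x)]).
  by apply: SU => j; apply: sub_g_sigma_ring; exists j, [set z : 'I_n -> int | (z i)%:~R + 1 <= 2 ^+ j * ((t - a i) / l i)].
apply/seteqP; split => x /=; rewrite in_itv/=.
  move=> xt; have d0 : 0 < (t - x 0 i) / l i by rewrite divr_gt0// subr_gt0.
  have [j hj] : exists j, 1 <= 2 ^+ j * ((t - x 0 i) / l i).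
    exists (Num.bound ((t - x 0 i) / l i)^-1).
    rewrite -ler_pdivrMr// div1r.
    apply: le_trans (ltW (archi_boundP _)) _; first by rewrite invr_ge0 ltW.
    by rewrite -natrX ler_nat ltnW// ltn_expl.
  exists j => //=; have := floor_le (2 ^+ j * ((x 0 i - a i) / l i)).
  rewrite -/(grid j x i) => h.
  have -> : 2 ^+ j * ((t - a i) / l i) =
    2 ^+ j * ((x 0 i - a i) / l i) + 2 ^+ j * ((t - x 0 i) / l i) by ring.
  exact: lerD.
move=> [j _ /=] h; have := floorD1_gt (2 ^+ j * ((x 0 i - a i) / l i)).
rewrite -/(grid j x i) intrD => /lt_le_trans/(_ h).
by rewrite ltr_pM2l// ltr_pM2r ?invr_gt0// ltrD2r.
Qed.

Local Notation mu := (lebesgue_rv R n).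

Definition grid_box := box (fun i => [set` Interval (BRight (a i)) (BLeft (a i + l i))]).

Lemma measurable_grid_box : measurable grid_box.
Proof. exact: measurable_box. Qed.

Lemma Rintegral_sum d (T : measurableType d) (nu : {measure set T -> \bar R})
    (D : set T) (I : finType) (f : I -> T -> R) :
  measurable D -> (forall i, nu.-integrable D (EFin \o f i)) ->
  \int[nu]_(x in D) (\sum_i f i x) = \sum_i \int[nu]_(x in D) f i x.
Proof.
move=> mD intf; apply: EFin_inj; rewrite -sumEFin.
have eqf : (\int[nu]_(x in D) (\sum_i f i x)%:E =
    \int[nu]_(x in D) \sum_i (f i x)%:E)%E.
  by apply: eq_integral => x _; rewrite sumEFin.
rewrite /Rintegral eqf fineK; last first.
  apply: integrable_fin_num => //.
  by apply: (@integrable_sum _ _ _ nu D mD I (index_enum I) predT (fun i => EFin \o f i)) => i _; exact: intf.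
rewrite integral_sum//.
by apply: eq_bigr => i _; rewrite fineK//; exact: (integrable_fin_num mD (intf i)).
Qed.

Lemma grid_cell_bounds j (z : {ffun 'I_n -> 'I_(2 ^ j)}) i :
  a i <= a i + l i * ((z i : nat)%:Z)%:~R / 2 ^+ j /\
  a i + l i * (((z i : nat)%:Z)%:~R + 1) / 2 ^+ j <= a i + l i.
Proof.
have p0 : 0 < 2 ^+ j :> R by rewrite exprn_gt0.
split; first by rewrite lerDl divr_ge0 ?mulr_ge0// ltW.
rewrite lerD2l ler_pdivrMr// ler_pM2l//.
rewrite -natrX -[X in X + 1 <= _]/((z i : nat)%:R) natr1 ler_nat.
exact: ltn_ord.
Qed.

Lemma grid_cell_sub_box j (z : {ffun 'I_n -> 'I_(2 ^ j)}) :
  grid_cell j (fun i => (z i : nat)%:Z) false `<=` grid_box.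
Proof.
move=> x h i; have := h i; rewrite /= !in_itv/= => /andP[h1 h2].
have [h3 h4] := grid_cell_bounds z i.
by rewrite (le_lt_trans h3 h1) (lt_le_trans h2 h4).
Qed.

(** The open and the half-open cell have the same finite measure, so their difference is negligible.
    The intersection with the open box removes the lower faces of the half-open cells that touch its
    boundary. *)
Lemma grid_cell_integral (u : 'rV[R]_n -> R) j (z : {ffun 'I_n -> 'I_(2 ^ j)}) :
  mu.-integrable grid_box (EFin \o u) ->
  \int[mu]_(x in grid_box `&` grid_cell j (fun i => (z i : nat)%:Z) true) u x =
  \int[mu]_(x in grid_cell j (fun i => (z i : nat)%:Z) false) u x.
Proof.
move=> intu; set z' := fun i => _.
have m1 := measurable_grid_cell j z' true; have m2 := measurable_grid_cell j z' false.
have s1 : grid_cell j z' false `<=` grid_cell j z' true.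
  by move=> x h i; have := h i; rewrite /= !in_itv/= => /andP[/ltW -> ->].
have s2 := @grid_cell_sub_box j z.
rewrite /Rintegral; congr fine.
rewrite (_ : grid_cell j z' false = (grid_box `&` grid_cell j z' true) `\`
   (grid_cell j z' true `\` grid_cell j z' false)); last first.
  apply/seteqP; split => x /=; first by move=> h; do !split; [exact: s2|exact: s1|case].
  by move=> [[_ h] h2]; apply: contrapT => h3; apply: h2.
apply: negligible_integral.
- exact: measurableD.
- by apply: measurableI => //; exact: measurable_grid_box.
- apply: integrableS intu => //; first exact: measurable_grid_box.
  by apply: measurableI => //; exact: measurable_grid_box.
- have fc : (mu (grid_cell j z' true) < +oo)%E by rewrite lebesgue_grid_cell ltry.
  rewrite measureD// setIidr//.
  by rewrite [X in (X - _)%E]lebesgue_grid_cell [X in (_ - X)%E]lebesgue_grid_cell -EFinD subrr.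
Qed.

(* The sets over which the integral of u is nonpositive form a monotone class,
   which contains the set-ring of the finite unions of cells. *)
Lemma le0_ae_of_grid_cells (u : 'rV[R]_n -> R) :
  mu.-integrable grid_box (EFin \o u) ->
  (forall j (z : {ffun 'I_n -> 'I_(2 ^ j)}),
    \int[mu]_(x in grid_cell j (fun i => (z i : nat)%:Z) false) u x <= 0) ->
  {ae mu, forall x, grid_box x -> u x <= 0}.
Proof.
move=> intu cells; have mO := measurable_grid_box.
have mu0 : measurable_fun grid_box u.
  by apply/measurable_EFinP; exact: measurable_int intu.
have intI E : measurable E -> mu.-integrable grid_box (fun x => (u x * \1_E x)%:E).
  move=> mE; apply: le_integrable intu => //.
    by apply/measurable_EFinP; apply: measurable_funM => //.
  move=> x _ /=; rewrite lee_fin normrM -[leRHS]mulr1 ler_wpM2l//.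
  by rewrite indicE; case: (_ \in _); rewrite ?normr1 ?normr0.
pose G := [set E | measurable E /\ \int[mu]_(x in grid_box) (u x * \1_E x) <= 0].
have Ggrid : grid_set `<=` G.
  move=> _ [j [S ->]]; split; first exact: measurable_grid_set.
  (* Each point of the box lies in exactly one of the finitely many cells with indices below
     [2 ^ j], so the integral splits over these cells. *)
  pose f (z : {ffun 'I_n -> 'I_(2 ^ j)}) x :=
     if `[< S (fun i => (z i : nat)%:Z) >]
     then u x * \1_(grid_cell j (fun i => (z i : nat)%:Z) true) x else 0.
  rewrite (@eq_Rintegral _ _ _ _ _ (fun x => \sum_z f z x)); last first.
    move=> x; rewrite inE => Ox; have p0 : 0 < 2 ^+ j :> R by rewrite exprn_gt0.
    have zP i : (`|grid j x i| < 2 ^ j)%N /\ grid j x i = `|grid j x i|%:Z.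
      have := Ox i; rewrite /= in_itv/= => /andP[h1 h2].
      have g0 : 0 <= grid j x i.
        by rewrite floor_ge0 mulr_ge0 ?(ltW p0)// divr_ge0 ?(ltW (l_gt0 i))// subr_ge0 ltW.
      split; last by rewrite gez0_abs.
      rewrite -ltz_nat gez0_abs// -(ltr_int R).
      apply: (le_lt_trans (floor_le _)).
      rewrite -[ltRHS]/((2 ^ j)%:R) natrX -[ltRHS]mulr1 ltr_pM2l// ltr_pdivrMr// mul1r.
      by rewrite ltrBlDl.
    pose z0 : {ffun 'I_n -> 'I_(2 ^ j)} := [ffun i => Ordinal (zP i).1].
    have z0E : (fun i => (z0 i : nat)%:Z) = grid j x.
      by apply/funext => i; rewrite ffunE /= -(zP i).2.
    rewrite (bigD1 z0)//= big1 ?addr0; last first.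
      move=> z zz0; rewrite /f; case: ifP => // _.
      rewrite indicE memNset ?mulr0// -grid_cellE /= => h.
      move/eqP : zz0; apply; apply/ffunP => i; apply/val_inj.
      by apply/eqP; rewrite -eqz_nat; apply/eqP; rewrite -(h i) -z0E.
    rewrite /f z0E; have -> : \1_(grid_cell j (grid j x) true) x = 1 :> R.
      by rewrite indicE mem_set// -grid_cellE.
    rewrite indicE; case: asboolP => h; first by rewrite mem_set.
    by rewrite memNset// mulr0.
  rewrite Rintegral_sum//; last first.
    move=> z; rewrite /f; case: asboolP => _; last exact: integrable0.
    by apply: intI; exact: measurable_grid_cell.
  apply: sumr_le0 => z _; rewrite /f; case: asboolP => _; last first.
    by rewrite Rintegral_cst// mul0r.
  apply: le_trans (cells j z); rewrite -grid_cell_integral//.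
  rewrite Rintegral_mkcondr le_eqVlt; apply/orP; left; apply/eqP.
  by apply: eq_Rintegral => x _; rewrite patchE indicE; case: (_ \in _); rewrite ?mulr1 ?mulr0.
have Gmono : monotone G.
  (* Increasing and decreasing limits are both instances of dominated convergence, with majorant
     |u|. *)
  have key (F : (set 'rV[R]_n)^nat) E : (forall i, G (F i)) -> measurable E ->
      (forall x, \1_(F i) x @[i --> \oo] --> (\1_E x : R)) -> G E.
    move=> GF mE cvF; split => //.
    have [|||||_ _] := @dominated_convergence _ _ _ mu _ mO
      (fun i x => (u x * \1_(F i) x)%:E) (fun x => (u x * \1_E x)%:E)
      (fun x => `|u x|%:E).
    - by move=> i; apply: measurable_int (intI _ (GF i).1).
    - exact: measurable_int (intI _ mE).
    - apply: aeW => x _; apply: cvg_EFin; first exact: nearW.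
      by apply: cvgM; [exact: cvg_cst|exact: cvF].
    - exact: integrable_norm.
    - apply: aeW => x i _; rewrite /= lee_fin normrM -[leRHS]mulr1 ler_wpM2l//.
      by rewrite indicE; case: (_ \in _); rewrite ?normr1 ?normr0.
    move=> cv; rewrite /Rintegral -lee_fin fineK; last exact: integrable_fin_num (intI _ mE).
    rewrite -(cvg_lim _ cv)//; apply: lime_le; first by apply: cvgP cv.
    apply: nearW => i; have := (GF i).2; rewrite /Rintegral -lee_fin fineK//.
    exact: integrable_fin_num (intI _ (GF i).1).
  split=> F mF GF.
    apply: (key F) => //; first by apply: bigcup_measurable => i _; exact: (GF i).1.
    move=> x; have [[i _ Fix]|h] := pselect ((\bigcup_i F i) x).
      apply: cvg_near_cst; exists i => //= k /= ik.
      have Fkx : F k x by have /subsetPset := mF _ _ ik; exact.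
      have FUx : (\bigcup_i F i) x by exists i.
      by rewrite !indicE (mem_set Fkx) (mem_set FUx).
    apply: cvg_near_cst; apply: nearW => k; rewrite !indicE !memNset// => Fk.
    by apply: h; exists k.
  apply: (key F) => //; first by apply: bigcap_measurableType => i _; exact: (GF i).1.
  move=> x; have [h|h] := pselect ((\bigcap_i F i) x).
    by apply: cvg_near_cst; apply: nearW => k; rewrite !indicE !mem_set//; exact: h.
  have [i hi] : exists i, ~ F i x by apply: contrapT => /forallNP h'; apply: h => i _; exact: contrapT.
  apply: cvg_near_cst; exists i => //= k /= ik.
  rewrite !indicE !memNset// => Fk; apply: hi.
  by have /subsetPset := mF _ _ ik; exact.
have Gall : @measurable _ 'rV[R]_n `<=` G.
  apply: subset_trans measurable_sub_grid _.
  exact: (monotone_setring_sub_g_sigma_ring Gmono grid_setring).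
(* Testing on the set where [u] is positive: the integral of the positive part is nonpositive, hence
   zero. *)
pose E := grid_box `&` u @^-1` `]0, +oo[.
have mE : measurable E by exact: mu0.
have [_ hE] := Gall _ mE.
have uE x : grid_box x -> u x * \1_E x = Num.max (u x) 0.
  move=> Ox; rewrite indicE; have [u0|u0] := ltP 0 (u x).
    by rewrite mem_set ?mulr1//; split => //=; rewrite in_itv/= u0.
  by rewrite memNset ?mulr0// => -[_]; rewrite /= in_itv/= andbT ltNge u0.
have : (\int[mu]_(x in grid_box) `|(u x * \1_E x)%:E| = 0)%E.
  apply/eqP; rewrite eq_le integral_ge0// ?andbT.
  rewrite (eq_integral (fun x => (u x * \1_E x)%:E)); last first.
    move=> x; rewrite inE => Ox; rewrite gee0_abs// lee_fin uE//.
    by rewrite le_max lexx orbT.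
  by move: hE; rewrite /Rintegral -lee_fin fineK//; exact: integrable_fin_num (intI _ mE).
move/(ae_eq_integral_abs mu mO (measurable_int _ (intI _ mE))).
apply: filterS => x h Ox; have := h Ox; rewrite /cst => -[].
by rewrite uE// => <-; rewrite le_max lexx.
Qed.
End grid.

(** The sigma-algebra is generated by the coordinates, whereas continuity refers to the norm
    topology. The two are linked by writing [f] as the pointwise limit of its values at the lower
    corners of the dyadic cells. *)
Lemma measurable_continuous_rv {R : realType} n (f : 'rV[R]_n -> R) :
  continuous f -> measurable_fun [set: 'rV[R]_n] f.
Proof.
move=> cf; pose a (i : 'I_n) : R := 0; pose l (i : 'I_n) : R := 1.
have l0 i : 0 < l i by [].
pose q j (z : 'I_n -> int) : 'rV[R]_n := \row_i ((z i)%:~R / 2 ^+ j).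
apply: (@measurable_fun_cvg _ _ _ _ (fun j x => f (q j (grid a l j x)))).
  move=> j _ Y mY; rewrite setTI.
  exact: (@measurable_grid_set R n a l l0 j [set z | Y (f (q j z))]).
move=> x _; apply: continuous_cvg; first exact: cf.
apply/cvgrPdist_le => /= e e0.
have [N hN] : exists N, e^-1 <= 2 ^+ N.
  exists (Num.bound e^-1); apply: le_trans (ltW (archi_boundP _)) _.
    by rewrite invr_ge0 ltW.
  by rewrite -natrX ler_nat ltnW// ltn_expl.
exists N => //= j /= Nj.
have p0 : 0 < 2 ^+ j :> R by rewrite exprn_gt0.
have hj : (2 ^+ j)^-1 <= e.
  rewrite -[leRHS]invrK lef_pV2 ?posrE ?invr_gt0//.
  by apply: (le_trans hN); rewrite ler_eXn2l// ?ltr1n.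
apply: le_trans hj; rewrite [leLHS]mx_normrE; apply/bigmax_leP; split => /=.
  by rewrite invr_ge0 ltW.
move=> [i0 i] _ /=; rewrite (ord1 i0) !mxE /grid /a /l subr0 divr1.
have h1 := floor_le (2 ^+ j * x 0 i); have h2 := floorD1_gt (2 ^+ j * x 0 i).
move: h1 h2; set F := Num.floor _; rewrite intrD => h1 h2.
have -> : x 0 i - F%:~R / 2 ^+ j = (2 ^+ j * x 0 i - F%:~R) / 2 ^+ j by field; rewrite gt_eqF.
rewrite normrM [X in _ * X]ger0_norm ?invr_ge0 ?(ltW p0)//.
by rewrite ler_piMl ?invr_ge0 ?(ltW p0)// ger0_norm; lra.
Qed.

(** * Smooth functions of one variable, bumps and their primitives *)

Section smooth1.
Context {R : realType}.
Implicit Types f g : R -> R.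

(** Each derivative is given as a witness, so that closure under sums, products and affine
    substitutions is an induction on [k] through [is_derive]. *)
Fixpoint Ck (k : nat) f : Prop :=
  if k is k'.+1 then exists2 f' : R -> R, forall x : R, is_derive x (1 : R) f (f' x) & Ck k' f'
  else True.

Definition smooth1 f := forall k, Ck k f.

Lemma CkW k f : Ck k.+1 f -> Ck k f.
Proof. by elim: k f => // k IH f [f' df /IH]; exists f'. Qed.

Lemma CkD k f g : Ck k f -> Ck k g -> Ck k (fun x => f x + g x).
Proof.
elim: k f g => // k IH f g [f' df cf] [g' dg cg].
exists (fun x => f' x + g' x); last exact: IH.
by move=> x; exact: is_deriveD.
Qed.

Lemma CkM k f g : Ck k f -> Ck k g -> Ck k (fun x => f x * g x).
Proof.
elim: k f g => // k IH f g [f' df cf] [g' dg cg].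
exists (fun x => f x * g' x + g x * f' x).
  by move=> x; exact: is_deriveM.
by apply: CkD; apply: IH => //; apply: CkW; [exists f'|exists g'].
Qed.

Lemma Ck_cst k (c : R) : Ck k (cst c).
Proof. by elim: k c => // k IH c; exists (cst 0) => // x; exact: is_derive_cst. Qed.

Lemma Ck_affine k f (c d : R) : Ck k f -> Ck k (fun x => f (c * x + d)).
Proof.
elim: k f => // k IH f [f' df cf]; exists (fun x => f' (c * x + d) * c).
  move=> x; apply: (@is_derive1_comp _ f (fun x => c * x + d) x).
  have h : is_derive x (1 : R) ((c *: (id : R -> R)) + cst d) c.
    by apply: is_derive_eq; rewrite addr0 /GRing.scale /= mulr1.
  exact: h.
by apply: CkM; [exact: IH|exact: Ck_cst].
Qed.

Lemma smooth1D f g : smooth1 f -> smooth1 g -> smooth1 (fun x => f x + g x).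
Proof. by move=> sf sg k; exact: CkD. Qed.

Lemma smooth1M f g : smooth1 f -> smooth1 g -> smooth1 (fun x => f x * g x).
Proof. by move=> sf sg k; exact: CkM. Qed.

Lemma smooth1_cst (c : R) : smooth1 (cst c).
Proof. by move=> k; exact: Ck_cst. Qed.

Lemma smooth1Z c f : smooth1 f -> smooth1 (fun x => c * f x).
Proof. by apply: smooth1M; exact: smooth1_cst. Qed.

Lemma smooth1B f g : smooth1 f -> smooth1 g -> smooth1 (fun x => f x - g x).
Proof.
move=> sf sg; under eq_fun do rewrite -mulN1r.
by apply: smooth1D => //; exact: smooth1Z.
Qed.

Lemma smooth1_is_derive f : smooth1 f -> forall x : R, is_derive x (1 : R) f ((derive1 f) x).
Proof.
by move=> /(_ 1%N)[f' df _] x; rewrite derive1E (@derive_val _ _ _ _ _ _ _ (df x)).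
Qed.

Lemma smooth1_derive1 f : smooth1 f -> smooth1 (derive1 f).
Proof.
move=> sf k; have [f' df] := sf k.+1.
suff -> : f' = (derive1 f) by [].
by apply/funext => x; rewrite derive1E (@derive_val _ _ _ _ _ _ _ (df x)).
Qed.

Lemma smooth1_primitive f g : smooth1 g -> (forall x : R, is_derive x (1 : R) f (g x)) -> smooth1 f.
Proof. by move=> sg df [//|k]; exists g. Qed.

Lemma smooth1_derivable f : smooth1 f -> forall x : R, derivable f x (1 : R).
Proof. by move=> sf x; case: (smooth1_is_derive sf x). Qed.

Lemma smooth1_continuous f : smooth1 f -> continuous f.
Proof.
by move=> sf x; apply: differentiable_continuous; apply/derivable1_diffP; exact: smooth1_derivable.
Qed.

(** The polynomial in 1/t makes the family stable under differentiation, which acts on it by P ->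
    X^2 (P - P'). Smoothness of exp (-1/t) is then an induction. *)
Definition flat (P : {poly R}) (t : R) : R :=
  if 0 < t then P.[t^-1] * expR (- t^-1) else 0.

(** Each monomial is controlled by y^i / i! <= exp y. Taken at y = 1/t, the bound gives the
    differentiability of [flat] at 0. *)
Lemma poly_le_expR (P : {poly R}) : exists2 C, 0 <= C &
  forall y, 0 <= y -> `|P.[y]| <= C * expR y.
Proof.
exists (\sum_(i < size P) `|P`_i| * i`!%:R).
  by apply: sumr_ge0 => i _; rewrite mulr_ge0.
move=> y y0; rewrite horner_coef mulr_suml.
apply: (le_trans (ler_norm_sum _ _ _)); apply: ler_sum => i _.
rewrite normrM -mulrA ler_wpM2l// ger0_norm ?exprn_ge0//.
case: (i : nat) => [|m]; first by rewrite expr0 mul1r -expR0 ler_expR.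
rewrite mulrC -ler_pdivrMr ?ltr0n ?fact_gt0//.
by apply: le_trans (expR_ge1Dxn m y0); rewrite lerDr.
Qed.

Lemma flat_is_derive P (t : R) : is_derive t (1 : R) (flat P) (flat ('X ^+ 2 * (P - P^`())) t).
Proof.
rewrite /flat; have [t0|t0] := ltP 0 t.
  have tn : t != 0 by rewrite gt_eqF.
  have d1 : is_derive t (1 : R) (fun s : R => s^-1) (- t ^- 2).
    have h := @is_deriveV _ id t (1 : R) (1 : R) tn (is_derive_id _ _).
    by apply: is_derive_eq h _; rewrite /GRing.scale /= mulr1.
  have d2 : is_derive t (1 : R) (fun s : R => P.[s^-1]) (P^`().[t^-1] * (- t ^- 2)).
    exact: (@is_derive1_comp _ (horner P) (fun s : R => s^-1)).
  have d3 : is_derive t (1 : R) (fun s : R => expR (- s^-1)) (expR (- t^-1) * t ^- 2).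
    apply: (@is_derive1_comp _ expR (fun s : R => - s^-1)).
    by rewrite -[t ^- 2]opprK; exact: is_deriveN.
  have d4 := @is_deriveM _ _ _ _ _ _ _ _ d2 d3.
  apply: near_eq_is_derive; last first.
    apply: is_derive_eq d4 _.
    rewrite /GRing.scale /= !hornerE /= exprVn; ring.
  near=> s; rewrite ifT//=.
  near: s; exact: lt_nbhsr.
have [tlt|tge] := ltP t 0.
  apply: (@near_eq_is_derive R R R (cst 0)).
  near=> s; rewrite ltNge (_ : s <= 0)//.
  by apply: ltW; near: s; exact: lt_nbhsl.
have -> : t = 0 by apply/eqP; rewrite eq_le t0.
(* The difference quotient at 0 is h (h^-2 P(1/h)) exp (-1/h): bounding X^2 P instead of P leaves a
   factor h, which tends to 0. *)
have [C C0 hC] := poly_le_expR ('X ^+ 2 * P).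
suff cv : (fun h : R => h^-1 *: (flat P (h *: 1 + 0) - flat P 0)) @ 0^' --> (0 : R).
  by split; [apply: cvgP cv|exact: cvg_lim cv].
apply: (@squeeze_cvgr _ _ _ _ (fun h : R => - (C * `|h|)) (fun h : R => C * `|h|)).
- near=> h; rewrite -ler_norml /flat ltxx subr0 addr0 /GRing.scale /= mulr1.
  case: ltP => h0; last by rewrite mulr0 normr0 mulr_ge0.
  have hn : h != 0 by rewrite gt_eqF.
  have := hC h^-1; rewrite !hornerE invr_ge0 => /(_ (ltW h0)).
  move=> hh; rewrite [X in `|X| <= _](_ : _ = h * ((h^-1 ^+ 2 * P.[h^-1]) * (expR h^-1)^-1)); last first.
    by rewrite /= expRN; field; rewrite hn expR_eq0.
  rewrite normrM mulrC (ger0_norm (ltW h0)) ler_wpM2r ?(ltW h0)//.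
  rewrite normrM [X in _ * X]ger0_norm ?invr_ge0 ?expR_ge0//.
  by rewrite ler_pdivrMr ?expR_gt0.
- rewrite -[X in _ --> X]oppr0; apply: cvgN; rewrite -[X in _ --> X](mulr0 C).
  apply: cvgMl_tmp; rewrite -[X in _ --> X](normr0 R).
  by apply: cvg_norm; exact: nbhs_dnbhs.
- rewrite -[X in _ --> X](mulr0 C).
  apply: cvgMl_tmp; rewrite -[X in _ --> X](normr0 R).
  by apply: cvg_norm; exact: nbhs_dnbhs.
Unshelve. all: by end_near. Qed.

Lemma smooth1_flat P : smooth1 (flat P).
Proof.
move=> k; elim: k P => // k IH P.
by eexists; [exact: flat_is_derive|exact: IH].
Qed.

(* exp (-1/t), continued by 0 for t <= 0 *)
Definition flat1 := flat 1.

Lemma flat1E t : flat1 t = if 0 < t then expR (- t^-1) else 0.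
Proof. by rewrite /flat1 /flat hornerE; case: ifP => // _; rewrite mul1r. Qed.

Lemma flat1_ge0 t : 0 <= flat1 t.
Proof. by rewrite flat1E; case: ifP => // _; exact: expR_ge0. Qed.

Lemma flat1_le1 t : flat1 t <= 1.
Proof. by rewrite flat1E; case: ltP => // t0; rewrite expR_le1 oppr_le0 invr_ge0 ltW. Qed.

Lemma flat1_ge t : 1 <= t -> expR (-1) <= flat1 t.
Proof.
move=> t1; have t0 : 0 < t by apply: lt_le_trans t1.
by rewrite flat1E t0 ler_expR lerN2 invf_le1.
Qed.

(** The arguments are N (t - p) - 1 and N (q - t) - 1. The shift by 1 makes the function vanish
    within 1/N of both ends, hence have compact support inside the open interval, whose indicator is
    the limit for large N. *)
Definition bump (N p q t : R) : R :=
  flat1 (N * t + (- N * p - 1)) * flat1 (- N * t + (N * q - 1)).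

Lemma smooth1_bump N p q : smooth1 (bump N p q).
Proof. by apply: smooth1M => k; apply: Ck_affine; exact: smooth1_flat. Qed.

Lemma bump_ge0 N p q t : 0 <= bump N p q t.
Proof. by rewrite mulr_ge0// flat1_ge0. Qed.

Lemma bump_le1 N p q t : bump N p q t <= 1.
Proof. by rewrite mulr_ile1 ?flat1_ge0 ?flat1_le1. Qed.

Lemma bump_eq0 N p q t : 0 < N -> ~~ (p + N^-1 <= t <= q - N^-1) -> bump N p q t = 0.
Proof.
move=> N0; have Nn : N != 0 by rewrite gt_eqF.
rewrite /bump !flat1E negb_and -!ltNge => /orP[h|h].
  rewrite [X in X * _]ifF ?mul0r//; apply/negbTE; rewrite -leNgt.
  rewrite (_ : _ + _ = N * (t - (p + N^-1))); last by field.
  by rewrite pmulr_rle0// subr_le0 ltW.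
rewrite [X in _ * X]ifF ?mulr0//; apply/negbTE; rewrite -leNgt.
rewrite (_ : _ + _ = N * ((q - N^-1) - t)); last by field.
by rewrite pmulr_rle0// subr_le0 ltW.
Qed.

Lemma bump_ge N p q t : 0 < N -> p + 2 / N <= t <= q - 2 / N -> expR (-2) <= bump N p q t.
Proof.
move=> N0; have Nn : N != 0 by rewrite gt_eqF.
move=> /andP[h1 h2]; rewrite (_ : -2 = -1 + -1); last by ring.
rewrite expRD; apply: ler_pM; rewrite ?expR_ge0//; apply: flat1_ge.
  rewrite (_ : N * t = N * (t - (p + 2 / N)) + (N * p + 2)); last by field.
  have : 0 <= N * (t - (p + 2 / N)) by rewrite mulr_ge0 ?subr_ge0// ltW.
  by lra.
rewrite (_ : - N * t = N * ((q - 2 / N) - t) - (N * q - 2)); last by field.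
have : 0 <= N * ((q - 2 / N) - t) by rewrite mulr_ge0 ?subr_ge0// ltW.
by lra.
Qed.

Lemma flat1_ge1B t : 0 < t -> 1 - t^-1 <= flat1 t.
Proof. by move=> t0; rewrite flat1E t0; exact: expR_ge1Dx. Qed.

(** Both arguments are at least N s - 1 >= N s / 2, and exp (-x) >= 1 - x, so each factor is at
    least 1 - 2 / (N s). *)
Lemma bump_ge1B N p q t s : 0 < s -> s <= t - p -> s <= q - t -> 2 <= N * s ->
  1 - 4 / (N * s) <= bump N p q t.
Proof.
move=> s0 sp sq Ns.
have N0 : 0 < N by rewrite -(pmulr_lgt0 _ s0); apply: lt_le_trans Ns.
have h y : N * s <= y + 1 -> 1 - 2 / (N * s) <= flat1 y.
  move=> ya; have y0 : 0 < y by lra.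
  apply: le_trans (flat1_ge1B y0); rewrite lerD2l lerN2.
  rewrite -[leRHS]invrK lef_pV2 ?posrE ?invr_gt0 ?divr_gt0//; last by lra.
  by rewrite invf_div; lra.
have h1 : 1 - 2 / (N * s) <= flat1 (N * t + (- N * p - 1)).
  apply: h; rewrite (_ : _ + 1 = N * (t - p)); last by ring.
  by rewrite ler_pM2l.
have h2 : 1 - 2 / (N * s) <= flat1 (- N * t + (N * q - 1)).
  apply: h; rewrite (_ : _ + 1 = N * (q - t)); last by ring.
  by rewrite ler_pM2l.
have e0 : 0 <= 1 - 2 / (N * s).
  by rewrite subr_ge0 ler_pdivrMr ?mul1r//; apply: lt_le_trans Ns.
apply: le_trans (ler_pM e0 e0 h1 h2).
set e := 2 / (N * s); rewrite (_ : 4 / (N * s) = 2 * e); last by rewrite /e; ring.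
have := sqr_ge0 e; rewrite expr2; lra.
Qed.

Lemma bump_cvg p q t : p < t < q -> bump n.+1%:R p q t @[n --> \oo] --> (1 : R).
Proof.
move=> /andP[pt tq]; set s := Num.min (t - p) (q - t).
have s0 : 0 < s by rewrite lt_min !subr_gt0 pt.
apply/cvgrPdist_le => /= e e0.
exists (Num.bound (2 / s + 4 / (e * s))) => //= n /= hn.
have : 2 / s + 4 / (e * s) <= n.+1%:R.
  apply: le_trans (ltW (archi_boundP _)) _.
    by rewrite addr_ge0// divr_ge0// ?mulr_ge0// ltW.
  by rewrite ler_nat ltnW// ltnS.
set N := n.+1%:R => hN.
have p1 : 0 < 2 / s by rewrite divr_gt0.
have p2 : 0 < 4 / (e * s) by rewrite divr_gt0// mulr_gt0.
have N2 : 2 <= N * s by rewrite -ler_pdivrMr//; lra.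
have Ne : 4 / (N * s) <= e.
  rewrite ler_pdivrMr; last by apply: lt_le_trans N2.
  rewrite (_ : e * (N * s) = N * (e * s)); last by ring.
  by rewrite -ler_pdivrMr ?mulr_gt0//; lra.
have sp : s <= t - p by rewrite ge_min lexx.
have sq : s <= q - t by rewrite ge_min lexx orbT.
have := bump_ge1B s0 sp sq N2; have := bump_le1 N p q t.
move=> h1 h2; rewrite ger0_norm ?subr_ge0// lerBlDl -lerBlDr.
by apply: le_trans h2; rewrite lerD2l lerN2.
Qed.

Lemma is_derive_MVT (F f : R -> R) (a b : R) :
  (forall x : R, is_derive x (1 : R) F (f x)) -> a <= b ->
  exists2 c, a <= c <= b & F b - F a = f c * (b - a).
Proof.
move=> dF ab; have [|c] := MVT_segment ab (fun x _ => dF x).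
  apply: continuous_subspaceT => x; apply: differentiable_continuous.
  by apply/derivable1_diffP; case: (dF x).
by rewrite in_itv /= => hc ->; exists c.
Qed.

Lemma compact_primitive (f : R -> R) (p q : R) : smooth1 f ->
  (forall t, t <= p -> f t = 0) -> (forall t, q <= t -> f t = 0) ->
  exists F, [/\ forall x : R, is_derive x (1 : R) F (f x),
     smooth1 F, forall t, t <= p -> F t = 0 & forall t, q <= t -> F t = F q].
Proof.
(* The base point is [p - 1], not [p], because the fundamental theorem is applied at every x >= p
   and needs x strictly to the right of it. To the left of [p] the primitive is locally 0. *)
move=> sf f0 f1; pose F x := \int[lebesgue_measure]_(t in `[p - 1, x]) f t.
have cf := smooth1_continuous sf.
have F0 t : t <= p -> F t = 0.
  move=> tp; rewrite /F /Rintegral (eq_integral (cst 0%E)) ?integral0//.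
  move=> x; rewrite inE /= in_itv/= => /andP[_ xt]; congr EFin.
  by apply: f0; exact: le_trans xt tp.
have dF x : is_derive (x : R) (1 : R) F (f x).
  have [xp|px] := ltP x p.
    rewrite f0 ?ltW//; apply: (@near_eq_is_derive R R R (cst 0)).
    near=> s; rewrite F0//; apply: ltW; near: s; exact: lt_nbhsl.
  have [||||dF eF] := @continuous_FTC1_closed _ f (p - 1) x (x + 1).
  - by lra.
  - apply: continuous_compact_integrable; first exact: segment_compact.
    exact: continuous_subspaceT.
  - by lra.
  - exact: cf.
  by apply: DeriveDef; [exact: dF|rewrite -eF derive1E].
exists F; split => //; first exact: smooth1_primitive dF.
move=> t qt; have [c /andP[qc _]] := is_derive_MVT dF qt.
by rewrite f1// mul0r => /eqP; rewrite subr_eq0 => /eqP.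
Unshelve. all: by end_near. Qed.

(* The constant is universal: at distance len/4 from both ends the factors
   of the bump are at least exp (-1). *)
Definition bump_bound : R := 2 * expR 2.

Lemma bump_bound_ge1 : 1 <= bump_bound.
Proof. by rewrite /bump_bound; have := expR_ge1Dx (2 : R); lra. Qed.

Lemma normalized_bump (p q : R) : p < q -> exists om : R -> R, exists Om : R -> R, exists p', exists q',
  [/\ smooth1 om /\ forall x : R, is_derive x (1 : R) Om (om x),
      [/\ p < p', p' <= q' & q' < q],
      (forall t, t <= p' -> om t = 0) /\ (forall t, q' <= t -> om t = 0),
      (forall t, t <= p' -> Om t = 0) /\ (forall t, q' <= t -> Om t = 1) &
      forall t, `|om t| <= bump_bound / (q - p) ].
Proof.
move=> pq; have L0 : 0 < q - p by rewrite subr_gt0.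
have Ln : q - p != 0 by rewrite gt_eqF.
(* With 1/N an eighth of the length, the bump is at least exp (-2) on the middle half, so its
   integral is at least exp (-2) (q - p) / 2, the inverse of [bump_bound / (q - p)]. The margins of
   a sixteenth lie strictly inside the region where it vanishes. *)
pose N := 8 / (q - p); have N0 : 0 < N by rewrite divr_gt0.
have iN : N^-1 = (q - p) / 8 by rewrite invf_div.
pose p' := p + (q - p) / 16; pose q' := q - (q - p) / 16.
have bp t : t <= p' -> bump N p q t = 0.
  move=> tp; apply: bump_eq0 => //; rewrite iN negb_and -!ltNge; apply/orP; left.
  by apply: (le_lt_trans tp); rewrite /p'; lra.
have bq t : q' <= t -> bump N p q t = 0.
  move=> tp; apply: bump_eq0 => //; rewrite iN negb_and -!ltNge; apply/orP; right.
  by apply: lt_le_trans tp; rewrite /q'; lra.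
have [F [dF sF Fp Fq]] := compact_primitive (smooth1_bump N p q) bp bq.
have mono a b : a <= b -> F a <= F b.
  move=> ab; have [c _ h] := is_derive_MVT dF ab.
  by rewrite -subr_ge0 h mulr_ge0 ?bump_ge0// subr_ge0.
have I0 : expR (-2) * ((q - p) / 2) <= F q'.
  have h : p + (q - p) / 4 <= q - (q - p) / 4 by lra.
  have [c hc e] := is_derive_MVT dF h.
  have h1 : F (q - (q - p) / 4) <= F q' by apply: mono; rewrite /q'; lra.
  have h2 : 0 <= F (p + (q - p) / 4).
    by rewrite -(Fp p') ?lexx//; apply: mono; rewrite /p'; lra.
  have h3 : expR (-2) <= bump N p q c.
    apply: bump_ge => //; move: hc; rewrite iN => /andP[? ?]; apply/andP; split; lra.
  have : expR (-2) * ((q - p) / 2) <= bump N p q c * ((q - p) / 2).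
    by rewrite ler_wpM2r// divr_ge0// ltW.
  have -> : bump N p q c * ((q - p) / 2) = F (q - (q - p) / 4) - F (p + (q - p) / 4).
    by rewrite e; congr (_ * _); field.
  by lra.
have I1 : 0 < F q' by apply: lt_le_trans I0; rewrite mulr_gt0 ?expR_gt0// divr_gt0.
have In : F q' != 0 by rewrite gt_eqF.
exists (fun t => (F q')^-1 * bump N p q t), (fun t => (F q')^-1 * F t), p', q'; split.
- split; first exact/smooth1Z/smooth1_bump.
  by move=> x; exact: is_deriveZ (dF x).
- by split; rewrite /p' /q'; lra.
- by split => t ht; [rewrite bp// mulr0|rewrite bq// mulr0].
- by split => t ht; [rewrite (Fp t)// mulr0|rewrite (Fq t)// mulVf].
- move=> t; rewrite ger0_norm ?mulr_ge0 ?bump_ge0 ?invr_ge0 ?(ltW I1) ?flat1_ge0//.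
  apply: le_trans (_ : (F q')^-1 * 1 <= _).
    by rewrite ler_wpM2l ?bump_le1// invr_ge0 ltW.
  rewrite mulr1 -[leRHS]invrK lef_pV2 ?posrE//; last first.
    by rewrite invr_gt0 divr_gt0// /bump_bound mulr_gt0 ?expR_gt0.
  apply: le_trans I0; rewrite /bump_bound invf_div invfM expRN.
  by rewrite le_eqVlt; apply/orP; left; apply/eqP; ring.
Qed.
End smooth1.

(** * Tensor products as test functions *)

Section tensor.
Context {R : realType} {d : nat}.
Implicit Types (f g : 'I_d -> R -> R) (Om : set 'rV[R]_d).

Definition tensor f (x : 'rV[R]_d) : R := \prod_i f i (x 0 i).

Definition upd f i (u : R -> R) : 'I_d -> R -> R := fun k => if k == i then u else f k.

Lemma tensor_upd f i u x : tensor (upd f i u) x = u (x 0 i) * \prod_(k | k != i) f k (x 0 k).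
Proof.
rewrite /tensor (bigD1 i)//= /upd eqxx; congr (_ * _).
by apply: eq_bigr => k /negbTE ->.
Qed.

Lemma upd_id f i : upd f i (f i) = f.
Proof. by apply/funext => k; rewrite /upd; case: eqP => [->|]. Qed.

Lemma upd_upd f i u v : upd (upd f i u) i v = upd f i v.
Proof. by apply/funext => k; rewrite /upd; case: eqP. Qed.

Lemma smooth1_upd f i u : (forall k, smooth1 (f k)) -> smooth1 u -> forall k, smooth1 (upd f i u k).
Proof. by move=> sf su k; rewrite /upd; case: eqP. Qed.

Lemma is_derive_tensor f i (x : 'rV[R]_d) : (forall k, smooth1 (f k)) ->
  is_derive x (delta_mx 0 i : 'rV[R]_d) (tensor f) (tensor (upd f i (derive1 (f i))) x).
Proof.
move=> sf; set c := \prod_(k | k != i) f k (x 0 k).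
have [df ef] := smooth1_is_derive (sf i) (x 0 i).
have cv : h^-1 *: (tensor f (h *: (delta_mx 0 i : 'rV[R]_d) + x) - tensor f x) @[h --> 0^']
    --> tensor (upd f i (derive1 (f i))) x.
  rewrite tensor_upd -/c mulrC -ef.
  rewrite (_ : (fun h => _) = (fun h : R => c * (h^-1 *: (f i (h *: 1 + x 0 i) - f i (x 0 i))))).
    by apply: cvgMl_tmp; exact: df.
  apply/funext => h; rewrite -{1 2}(upd_id f i) !tensor_upd -/c.
  rewrite !mxE !eqxx /= [X in _ * X - _](_ : _ = c).
    by rewrite /GRing.scale /=; ring.
  by apply: eq_bigr => k /negbTE ki; rewrite !mxE ki mulr0 add0r.
by split; [apply: cvgP cv|exact: cvg_lim cv].
Qed.

Lemma partial_tensor f i : (forall k, smooth1 (f k)) ->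
  partial i (tensor f) = tensor (upd f i (derive1 (f i))).
Proof.
by move=> sf; apply/funext => x; rewrite /partial (@derive_val _ _ _ _ _ _ _ (is_derive_tensor i x sf)).
Qed.

Lemma differentiable_tensor f (x : 'rV[R]_d) : (forall k, smooth1 (f k)) ->
  differentiable (tensor f) x.
Proof.
move=> sf; rewrite /tensor; elim: (index_enum _) => [|i s IH].
  by under eq_fun do rewrite big_nil; exact: differentiable_cst.
under eq_fun do rewrite big_cons.
apply: (differentiableM _ IH).
apply: (@differentiable_comp _ _ _ _ (fun y : 'rV[R]_d => y 0 i : R) (f i)).
  exact: differentiable_coord.
by apply/derivable1_diffP; exact: smooth1_derivable.
Qed.

Lemma smooth_tensor f : (forall k, smooth1 (f k)) -> smooth (tensor f).
Proof.
move=> sf s x; suff [g sg ->] : exists2 g, (forall k, smooth1 (g k)) &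
    foldr partial (tensor f) s = tensor g by exact: differentiable_tensor.
elim: s => [|i s [g sg /= ->]]; first by exists f.
exists (upd g i (derive1 (g i))); last exact: partial_tensor.
by apply: smooth1_upd => //; exact: smooth1_derive1.
Qed.

Lemma smooth1_iter m (u : R -> R) : smooth1 u -> smooth1 (iter m (@derive1 R R) u).
Proof. by move=> su; elim: m => //= m; exact: smooth1_derive1. Qed.

Lemma iter_partial_tensor m f i : (forall k, smooth1 (f k)) ->
  iter m (partial i) (tensor f) = tensor (upd f i (iter m (@derive1 R R) (f i))).
Proof.
move=> sf; elim: m => [|m IH] /=; first by rewrite upd_id.
rewrite IH partial_tensor; last by apply: smooth1_upd => //; exact: smooth1_iter.
by rewrite upd_upd /upd eqxx.
Qed.

Lemma mpartial_tensor (b : 'I_d -> nat) f : (forall k, smooth1 (f k)) ->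
  mpartial b (tensor f) = tensor (fun k => iter (b k) (@derive1 R R) (f k)).
Proof.
move=> sf; rewrite /mpartial.
have key s : uniq s -> foldr (fun i (g : 'rV[R]_d -> R) => iter (b i) (partial i) g) (tensor f) s =
   tensor (fun k => if k \in s then iter (b k) (@derive1 R R) (f k) else f k).
  elim: s => [_|i s IH /= /andP[ins us]] /=; first by congr tensor.
  rewrite IH// iter_partial_tensor; last first.
    by move=> k; case: ifP => // _; exact: smooth1_iter.
  congr tensor; apply/funext => k; rewrite /upd inE; case: eqP => [->|//].
  by rewrite (negbTE ins).
rewrite key ?enum_uniq//; congr tensor; apply/funext => k.
by rewrite mem_enum.
Qed.

(** The derivatives act on separate factors, so their order is immaterial and no theorem on the
    symmetry of mixed derivatives is invoked. *)
Lemma mpartial_partial_tensor (b : 'I_d -> nat) f i : (forall k, smooth1 (f k)) ->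
  mpartial b (partial i (tensor f)) = mpartial (fun k => (b k + (k == i))%N) (tensor f).
Proof.
move=> sf; rewrite partial_tensor// mpartial_tensor; last first.
  by apply: smooth1_upd => //; exact: smooth1_derive1.
rewrite mpartial_tensor//; congr tensor; apply/funext => k; rewrite /upd.
by case: eqP => [->|_]; rewrite ?addn1 ?addn0// iterSr.
Qed.

(** The margins [p] and [q] keep the support at a positive distance from the ends, as the compact
    support of a test function requires. *)
Definition supp1 (u : R -> R) (lo hi : R) := exists p q,
  [/\ lo < p, q < hi, forall t, t <= p -> u t = 0 & forall t, q <= t -> u t = 0].

Definition supp_in f (lo hi : 'I_d -> R) := forall k, supp1 (f k) (lo k) (hi k).

Lemma supp_in_upd f (lo hi : 'I_d -> R) i u : supp_in f lo hi -> supp1 u (lo i) (hi i) ->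
  supp_in (upd f i u) lo hi.
Proof. by move=> sf su k; rewrite /upd; case: eqP => [->|]. Qed.

Lemma test_tensor Om f (lo hi : 'I_d -> R) : (forall k, smooth1 (f k)) ->
  supp_in f lo hi ->
  box (fun i => [set` Interval (BRight (lo i)) (BLeft (hi i))]) `<=` Om ->
  test_function Om (tensor f).
Proof.
move=> sf suf bO; split; first exact: smooth_tensor.
have [p] := choice suf; move/choice => [q pq].
have lop i : lo i < p i by case: (pq i).
have qhi i : q i < hi i by case: (pq i).
have fp i t : t <= p i -> f i t = 0 by case: (pq i) => _ _ + _; exact.
have fq i t : q i <= t -> f i t = 0 by case: (pq i) => _ _ _; exact.
exists (box (fun i => [set` Interval (BLeft (p i)) (BRight (q i))])); split.
- by apply: rV_compact => i; exact: segment_compact.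
- apply: subset_trans bO => x h i; have := h i; rewrite /= !in_itv/= => /andP[h1 h2].
  by rewrite (lt_le_trans (lop i) h1) (le_lt_trans h2 (qhi i)).
- move=> x nx; have [i hi'] : exists i, ~ (p i <= x 0 i <= q i).
    by apply: contrapT => /forallNP h; apply: nx => i; rewrite /= in_itv/=; exact: contrapT (h i).
  rewrite /tensor (bigD1 i)//=; move/negP : hi'; rewrite negb_and -!ltNge => /orP[h|h].
    by rewrite fp ?mul0r// ltW.
  by rewrite fq ?mul0r// ltW.
Qed.

(** Both [v] and [v'] are derivatives of the same [u]: testing the first with the partial derivative
    of the tensor product and the second with the tensor product itself gives the same left-hand
    side, with signs that differ by one factor -1. *)
Lemma is_wderiv_tensor_step Om (b : 'I_d -> nat) (i : 'I_d) (u v v' : 'rV[R]_d -> R) f :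
  is_wderiv Om b u v -> is_wderiv Om (fun k => (b k + (k == i))%N) u v' ->
  (forall k, smooth1 (f k)) -> test_function Om (tensor f) ->
  test_function Om (partial i (tensor f)) ->
  \int[lebesgue_rv R d]_(x in Om) (v x * partial i (tensor f) x) =
  - \int[lebesgue_rv R d]_(x in Om) (v' x * tensor f x).
Proof.
move=> wg wg' sf tf tf'; have h1 := wg _ tf'; have h2 := wg' _ tf.
move: h1; rewrite mpartial_partial_tensor// h2 big_split /=.
have -> : (\sum_(k < d) (k == i) = 1)%N.
  by rewrite (bigD1 i)//= eqxx big1// => k /negbTE ->.
rewrite addn1 exprS mulN1r mulNr => /eqP; rewrite eq_sym -mulrN.
have : (-1) ^+ (\sum_k b k)%N != 0 :> R by rewrite expf_neq0// oppr_eq0 oner_eq0.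
by move=> /mulfI h /eqP /h.
Qed.
End tensor.

(** * Square integrable functions on a set of finite measure *)

Section L2.
Context {R : realType} {d : nat} (D : set 'rV[R]_d).
Hypothesis mD : measurable D.
Hypothesis finD : (lebesgue_rv R d D < +oo)%E.
Local Notation mu := (lebesgue_rv R d).
Implicit Types u v : 'rV[R]_d -> R.

Lemma L2_sqr_integrable u : L2 D u -> mu.-integrable D (fun x => (u x ^+ 2)%:E).
Proof.
move=> [mu_ fu]; apply/integrableP; split.
  by apply/measurable_EFinP; exact: measurable_funX.
by under eq_integral do rewrite gee0_abs ?lee_fin ?sqr_ge0//.
Qed.

Lemma L2P u : measurable_fun D u -> mu.-integrable D (fun x => (u x ^+ 2)%:E) -> L2 D u.
Proof.
move=> mu_ /integrableP[_ h]; split => //.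
by move: h; under eq_integral do rewrite gee0_abs ?lee_fin ?sqr_ge0//.
Qed.

Lemma L2_le u v (C : R) : measurable_fun D u -> L2 D v ->
  (forall x, D x -> u x ^+ 2 <= C * v x ^+ 2) -> L2 D u.
Proof.
move=> mu_ Lv uv; apply: L2P => //.
apply: (le_integrable mD _ _ (integrableZl mD C (L2_sqr_integrable Lv))) => //.
  by apply/measurable_EFinP; exact: measurable_funX.
move=> x Dx; rewrite -EFinM !gee0_abs ?lee_fin ?sqr_ge0 ?uv//.
by apply: le_trans (uv _ Dx); exact: sqr_ge0.
Qed.

Lemma L2_mul_integrable u v : L2 D u -> L2 D v -> mu.-integrable D (fun x => (u x * v x)%:E).
Proof.
move=> Lu Lv; apply: (le_integrable mD _ _
  (integrableD mD (L2_sqr_integrable Lu) (L2_sqr_integrable Lv))).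
  by apply/measurable_EFinP; apply: measurable_funM; [exact: Lu.1|exact: Lv.1].
move=> x Dx; rewrite -EFinD !abse_EFin lee_fin.
rewrite [leRHS]ger0_norm ?addr_ge0 ?sqr_ge0// ler_norml.
by have := sqr_ge0 (u x + v x); have := sqr_ge0 (u x - v x);
  have := sqr_ge0 (u x); have := sqr_ge0 (v x); rewrite !expr2; lra.
Qed.

Lemma L2_bounded u (C : R) : measurable_fun D u -> (forall x, D x -> `|u x| <= C) -> L2 D u.
Proof.
move=> mu_ uC; apply: L2P => //.
apply: measurable_bounded_integrable => //; first exact: measurable_funX.
exists (C ^+ 2); split; first exact: num_real.
move=> y Cy x Dx; apply: le_trans (ltW Cy).
by rewrite normrX lerXn2r ?nnegrE//; [exact: le_trans (uC _ Dx)|exact: uC].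
Qed.

Lemma L2_cst (c : R) : L2 D (cst c).
Proof. exact: (@L2_bounded _ `|c|). Qed.

Lemma L2D u v : L2 D u -> L2 D v -> L2 D (fun x => u x + v x).
Proof.
move=> Lu Lv; apply: L2P; first by apply: measurable_funD; [exact: Lu.1|exact: Lv.1].
rewrite (_ : (fun x => _) = (fun x => (u x ^+ 2)%:E + ((2 * (u x * v x))%:E + (v x ^+ 2)%:E))%E).
  apply: integrableD => //; first exact: L2_sqr_integrable.
  apply: integrableD => //; last exact: L2_sqr_integrable.
  by have := integrableZl mD 2 (L2_mul_integrable Lu Lv); under eq_fun do rewrite -EFinM.
by apply/funext => x; rewrite -!EFinD; congr EFin; ring.
Qed.

Lemma L2Z (c : R) u : L2 D u -> L2 D (fun x => c * u x).
Proof.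
move=> Lu; apply: (@L2_le _ u (c ^+ 2)) => //.
  by apply: measurable_funM => //; exact: Lu.1.
by move=> x _; rewrite exprMn.
Qed.

Lemma L2B u v : L2 D u -> L2 D v -> L2 D (fun x => u x - v x).
Proof.
move=> Lu Lv; under eq_fun do rewrite -mulN1r; exact: L2D (L2Z _ _).
Qed.

Lemma L2_mul_bounded u v (C : R) : L2 D u -> measurable_fun D v ->
  (forall x, D x -> `|v x| <= C) -> L2 D (fun x => u x * v x).
Proof.
move=> Lu mv vC; apply: (@L2_le _ u (C ^+ 2)) => //.
  by apply: measurable_funM => //; exact: Lu.1.
move=> x Dx; rewrite exprMn mulrC ler_wpM2r ?sqr_ge0//.
rewrite -[v x ^+ 2]ger0_norm ?sqr_ge0// normrX lerXn2r ?nnegrE//; last exact: vC.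
exact: le_trans (vC _ Dx).
Qed.

Lemma L2_integrable u : L2 D u -> mu.-integrable D (EFin \o u).
Proof.
move=> Lu; have := L2_mul_integrable Lu (L2_cst 1).
by under eq_fun do rewrite /cst mulr1.
Qed.

(* Young's inequality with the weight [K / (M sqrt (mu Q))] optimised. *)
Lemma L2_pairing_le u v (Q : set 'rV[R]_d) (K M q : R) : L2 D u ->
  measurable_fun D v -> measurable Q -> Q `<=` D -> mu Q = q%:E ->
  0 < K -> 0 < M -> 0 < q ->
  \int[mu]_(x in D) (u x ^+ 2) <= K ^+ 2 ->
  (forall x, `|v x| <= M) -> (forall x, ~ Q x -> v x = 0) ->
  `|\int[mu]_(x in D) (u x * v x)| <= K * M * Num.sqrt q.
Proof.
move=> Lu mv mQ QD qE K0 M0 q0 uK vM vQ.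
have Lv : L2 D v by exact: (L2_bounded mv).
have sq0 : 0 < Num.sqrt q by rewrite sqrtr_gt0.
pose t := M * Num.sqrt q / K.
have t0 : 0 < t by rewrite divr_gt0 ?mulr_gt0.
have iuv := L2_mul_integrable Lu Lv.
have iQ : mu.-integrable D (EFin \o (fun x => M ^+ 2 * \1_Q x)).
  have : L2 D (fun x => M ^+ 2 * \1_Q x).
    apply: L2Z; apply: (@L2_bounded _ 1); first exact: measurable_indic.
    by move=> x _; rewrite indicE; case: (_ \in _); rewrite ?normr1 ?normr0.
  exact: L2_integrable.
have iu := L2_sqr_integrable Lu.
apply: (le_trans (le_normr_Rintegral mD iuv)).
apply: (@le_trans _ _ (\int[mu]_(x in D) ((t / 2) * u x ^+ 2 + (2 * t)^-1 * (M ^+ 2 * \1_Q x)))).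
  apply: le_Rintegral => //.
  - exact: (integrable_abse iuv).
  - have h1 := integrableZl mD (t / 2) iu; have h2 := integrableZl mD (2 * t)^-1 iQ.
    exact: (integrableD mD h1 h2).
  - move=> x Dx; rewrite normrM indicE; case: (pselect (Q x)) => Qx; last first.
      rewrite (vQ _ Qx) memNset// normr0 !mulr0 addr0 mulr_ge0 ?sqr_ge0//.
      by rewrite divr_ge0// ltW.
    rewrite mem_set// mulr1.
    have h : `|u x| * `|v x| <= `|u x| * M by rewrite ler_wpM2l.
    apply: (le_trans h); rewrite -subr_ge0.
    rewrite (_ : _ - _ = (2 * t)^-1 * (t * `|u x| - M) ^+ 2).
      by rewrite mulr_ge0 ?sqr_ge0// invr_ge0 mulr_ge0// ltW.
    rewrite -[u x ^+ 2]ger0_norm ?sqr_ge0// normrX; field.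
    by rewrite gt_eqF.
rewrite RintegralD//; last 2 first.
- exact: (integrableZl mD (t / 2) iu).
- exact: (integrableZl mD (2 * t)^-1 iQ).
have iI : mu.-integrable D (EFin \o \1_Q).
  apply: L2_integrable; apply: (@L2_bounded _ 1); first exact: measurable_indic.
  by move=> x _; rewrite indicE; case: (_ \in _); rewrite ?normr1 ?normr0.
rewrite !RintegralZl//.
have -> : \int[mu]_(x in D) (\1_Q x) = q.
  by rewrite /Rintegral integral_indic// setIidl//; exact: (congr1 fine qE).
have qq : q = Num.sqrt q ^+ 2 by rewrite sqr_sqrtr// ltW.
have h : t / 2 * \int[mu]_(x in D) (u x ^+ 2) <= t / 2 * K ^+ 2.
  by rewrite ler_wpM2l// divr_ge0// ltW.
apply: le_trans (lerD h (lexx _)) _.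
have e s : s != 0 -> (M * s / K) / 2 * K ^+ 2 + (2 * (M * s / K))^-1 * (M ^+ 2 * s ^+ 2) = K * M * s.
  by move=> s0; field; rewrite s0 !gt_eqF.
by have := e _ (lt0r_neq0 sq0); rewrite -qq -/t => ->.
Qed.
End L2.

(** * Bounds deduced from pairings with bumps on cells *)

Section cells.
Context {R : realType} {d : nat} (a l : 'I_d -> R).
Hypothesis l_gt0 : forall i, 0 < l i.
Local Notation mu := (lebesgue_rv R d).
Local Notation Om := (grid_box a l).

Definition side j k : R := l k / 2 ^+ j.

Lemma side_gt0 j k : 0 < side j k.
Proof. by rewrite divr_gt0// exprn_gt0. Qed.

(** The corner is arbitrary: a cell of level [j] is any translate, inside the box, of a dyadic cell
    of that level. *)
Definition subcell j (c : 'I_d -> R) :=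
  forall k, a k <= c k /\ c k + side j k <= a k + l k.

Definition cell j (c : 'I_d -> R) : set 'rV[R]_d :=
  box (fun k => [set` Interval (BRight (c k)) (BLeft (c k + side j k))]).

Lemma measurable_cell j c : measurable (cell j c).
Proof. exact: measurable_box. Qed.

Lemma lebesgue_cell j c : mu (cell j c) = (\prod_k side j k)%:E.
Proof.
apply: lebesgue_box => // k; rewrite lebesgue_measure_itv /= lte_fin ltrDl side_gt0.
by rewrite -EFinD addrC addKr.
Qed.

Lemma cell_sub j c : subcell j c -> cell j c `<=` Om.
Proof.
move=> sc x h k; have := h k; rewrite /= !in_itv/= => /andP[h1 h2].
by have [h3 h4] := sc k; rewrite (le_lt_trans h3 h1) (lt_le_trans h2 h4).
Qed.

Lemma grid_box_lty : (mu Om < +oo)%E.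
Proof.
rewrite (@lebesgue_box _ _ _ l) ?ltry// => k.
by rewrite lebesgue_measure_itv /= lte_fin ltrDl l_gt0 -EFinD addrC addKr.
Qed.

Lemma tensor_measurable (f : 'I_d -> R -> R) : (forall k, smooth1 (f k)) ->
  measurable_fun [set: 'rV[R]_d] (tensor f).
Proof.
move=> sf; apply: measurable_continuous_rv => x.
exact/differentiable_continuous/differentiable_tensor.
Qed.

Lemma tensor_norm_le (f : 'I_d -> R -> R) (m : 'I_d -> R) x :
  (forall k t, `|f k t| <= m k) -> `|tensor f x| <= \prod_k m k.
Proof. by move=> fm; rewrite /tensor normr_prod; apply: ler_prod => k _; rewrite normr_ge0 fm. Qed.

Lemma tensor_out (f : 'I_d -> R -> R) (lo hi : 'I_d -> R) x : supp_in f lo hi ->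
  ~ box (fun i => [set` Interval (BRight (lo i)) (BLeft (hi i))]) x -> tensor f x = 0.
Proof.
move=> suf nx.
have [i hi'] : exists i, ~ (lo i < x 0 i < hi i).
  by apply: contrapT => /forallNP h; apply: nx => i; rewrite /= in_itv/=; exact: contrapT (h i).
have [p [q [lop qhi fp fq]]] := suf i.
rewrite /tensor (bigD1 i)//=; move/negP : hi'; rewrite negb_and -!leNgt => /orP[h|h].
  by rewrite fp ?mul0r// (le_trans h)// ltW.
by rewrite fq ?mul0r// (le_trans _ h)// ltW.
Qed.

Lemma cell_integral_le (u : 'rV[R]_d -> R) (K : R) j c : subcell j c -> L2 Om u ->
  (forall f, (forall k, smooth1 (f k)) -> supp_in f c (fun k => c k + side j k) ->
    (forall k t, 0 <= f k t <= 1) ->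
    `|\int[mu]_(x in Om) (u x * tensor f x)| <= K) ->
  `|\int[mu]_(x in cell j c) u x| <= K.
Proof.
move=> sc Lu H; have mO := measurable_grid_box a l.
pose f n (k : 'I_d) := bump n.+1%:R (c k) (c k + side j k).
have sf n k : smooth1 (f n k) by exact: smooth1_bump.
have suf n : supp_in (f n) c (fun k => c k + side j k).
  have : (0 : R) < n.+1%:R by []. 
  rewrite /f; move: (n.+1%:R : R) => N N0.
  have : 0 < N^-1 by rewrite invr_gt0.
  have bz k t := @bump_eq0 R N (c k) (c k + side j k) t N0.
  move: (N^-1) bz => r bz r0.
  move=> k; exists (c k + r / 2), (c k + side j k - r / 2).
  split; [lra|lra| |] => t ht; apply: bz;
    rewrite negb_and -!ltNge; apply/orP; [left|right]; lra.
have f01 n k t : 0 <= f n k t <= 1 by rewrite bump_ge0 bump_le1.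
have T1 n x : `|tensor (f n) x| <= 1.
  rewrite -[leRHS](_ : \prod_(k : 'I_d) (1 : R) = 1); last by rewrite big1.
  by apply: tensor_norm_le => k t; have /andP[h1 h2] := f01 n k t; rewrite ger0_norm.
have iu : mu.-integrable Om (EFin \o u).
  exact: (L2_integrable mO grid_box_lty).
have cvT x : tensor (f n) x @[n --> \oo] --> (\1_(cell j c) x : R).
  have [xc|xc] := pselect (cell j c x).
    rewrite indicE mem_set// -[X in _ --> X](_ : \prod_(k : 'I_d) (1 : R) = 1); last by rewrite big1.
    apply: cvg_big => [|k _]; first exact: mul_continuous.
    by apply: bump_cvg; have := xc k; rewrite /= in_itv.
  apply: cvg_near_cst; apply: nearW => n.
  by rewrite indicE memNset// (tensor_out (suf n)).
have iuc : mu.-integrable Om (EFin \o (fun x => u x * \1_(cell j c) x)).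
  apply: (L2_integrable mO grid_box_lty).
  apply: (@L2_mul_bounded _ _ _ mO _ _ 1) => //.
    by apply: measurable_indic; exact: measurable_cell.
  by move=> x _; rewrite indicE; case: (_ \in _); rewrite ?normr1 ?normr0.
have [|||||_ _] := @dominated_convergence _ _ _ mu _ mO
  (fun i x => (u x * tensor (f i) x)%:E) (fun x => (u x * \1_(cell j c) x)%:E)
  (fun x => `|u x|%:E).
- move=> n; apply/measurable_EFinP; apply: measurable_funM; first exact: Lu.1.
  exact: measurable_funS (tensor_measurable (sf n)).
- exact: measurable_int iuc.
- apply: aeW => x _; apply: cvg_EFin; first exact: nearW.
  by apply: cvgM; [exact: cvg_cst|exact: cvT].
- exact: integrable_abse iu.
- apply: aeW => x n _; rewrite /= lee_fin normrM -[leRHS]mulr1 ler_wpM2l//.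
move=> cv.
have -> : \int[mu]_(x in cell j c) u x = \int[mu]_(x in Om) (u x * \1_(cell j c) x).
  rewrite -[X in Rintegral _ X](setIidr (cell_sub sc)) Rintegral_mkcondr.
  by apply: eq_Rintegral => x _; rewrite patchE indicE; case: (_ \in _); rewrite ?mulr1 ?mulr0.
have {}cv : \int[mu]_(x in Om) (u x * tensor (f n) x) @[n --> \oo] -->
    \int[mu]_(x in Om) (u x * \1_(cell j c) x).
  by apply: fine_cvg; rewrite fineK//; exact: (integrable_fin_num mO iuc).
have cvn : `|\int[mu]_(x in Om) (u x * tensor (f n) x)| @[n --> \oo] -->
    `|\int[mu]_(x in Om) (u x * \1_(cell j c) x)| by exact: cvg_norm.
rewrite -(cvg_lim _ cvn)//.
apply: limr_le; first exact: cvgP cvn.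
by apply: nearW => n; exact: H.
Qed.

(** The integral of [u] over a cell is at most [K] times its volume in absolute value, so [u - K]
    and [- u - K] have nonpositive integrals on all dyadic cells and are nonpositive almost
    everywhere. *)
Lemma ae_bounded_of_tensors (u : 'rV[R]_d -> R) (K : R) : L2 Om u ->
  (forall j c f, subcell j c -> (forall k, smooth1 (f k)) ->
    supp_in f c (fun k => c k + side j k) -> (forall k t, 0 <= f k t <= 1) ->
    `|\int[mu]_(x in Om) (u x * tensor f x)| <= K * \prod_k side j k) ->
  {ae mu, forall x, Om x -> `|u x| <= K}.
Proof.
move=> Lu H; have mO := measurable_grid_box a l.
have key (v : 'rV[R]_d -> R) : L2 Om v ->
    (forall j c, subcell j c -> `|\int[mu]_(x in cell j c) v x| <= K * \prod_k side j k) ->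
    {ae mu, forall x, Om x -> v x <= K}.
  move=> Lv Hv.
  have LvK : L2 Om (fun x => v x - K) := L2B mO Lv (L2_cst mO grid_box_lty K).
  have ivK := L2_integrable mO grid_box_lty LvK.
  have := @le0_ae_of_grid_cells R d a l l_gt0 (fun x => v x - K) ivK.
  move=> h; have {}h := h _; apply: filterS (h _) => [x hx Ox|j z].
    by rewrite -subr_le0; exact: hx.
  pose c k := a k + l k * ((z k : nat)%:Z)%:~R / 2 ^+ j.
  have e k (y : R) : a k + l k * (y + 1) / 2 ^+ j = a k + l k * y / 2 ^+ j + l k / 2 ^+ j by ring.
  have cE : grid_cell a l j (fun k => (z k : nat)%:Z) false = cell j c.
    rewrite /grid_cell /cell /side /c; congr box; apply/funext => k.
    by rewrite e.
  have sc : subcell j c.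
    move=> k; have [h1 h2] := grid_cell_bounds a l_gt0 z k; split => //.
    by rewrite /side /c -e.
  have sO : cell j c `<=` Om := cell_sub sc.
  have mc := measurable_cell j c.
  rewrite cE RintegralB//; last 2 first.
  - exact: (integrableS mO mc sO (L2_integrable mO grid_box_lty Lv)).
  - exact: (integrableS mO mc sO (L2_integrable mO grid_box_lty (L2_cst mO grid_box_lty K))).
  rewrite Rintegral_cst//.
  have -> : fine (mu (cell j c)) = \prod_k side j k := congr1 fine (lebesgue_cell j c).
  rewrite subr_le0; apply: le_trans (Hv _ _ sc); exact: ler_norm.
have Hc j c : subcell j c -> `|\int[mu]_(x in cell j c) u x| <= K * \prod_k side j k.
  by move=> sc; apply: cell_integral_le => // f sf suf f01; exact: H.
have h1 := key u Lu Hc.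
have h2 : {ae mu, forall x, Om x -> - u x <= K}.
  apply: key.
    by under eq_fun do rewrite -mulN1r; exact: L2Z.
  move=> j c sc; under eq_Rintegral do rewrite -mulN1r.
  rewrite RintegralZl//; last 2 first.
  - exact: measurable_cell.
  - apply: (integrableS mO _ (cell_sub sc) (L2_integrable mO grid_box_lty Lu)).
    exact: measurable_cell.
  by rewrite mulN1r normrN; exact: Hc.
apply: filterS2 h1 h2 => x h1 h2 Ox.
by rewrite ler_norml lerNl h1// h2.
Qed.

Lemma ae_eq0_of_tensors (u : 'rV[R]_d -> R) : L2 Om u ->
  (forall f, test_function Om (tensor f) -> \int[mu]_(x in Om) (u x * tensor f x) = 0) ->
  {ae mu, forall x, Om x -> u x = 0}.
Proof.
move=> Lu H.
have : {ae mu, forall x, Om x -> `|u x| <= 0}.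
  apply: ae_bounded_of_tensors => // j c f sc sf suf _.
  by rewrite H ?normr0 ?mul0r//; apply: test_tensor (cell_sub sc).
by apply: filterS => x h Ox; apply/eqP; rewrite -normr_le0 h.
Qed.
End cells.

(** * Primitives that are constant near both ends of an interval *)

Section primitive.
Context {R : realType}.
Implicit Types f F : R -> R.

(** [I] is the integral of [f]. When it is 0, [F] itself has compact support in the interval and can
    be a factor of a test function. *)
Definition primitive_on f F (lo hi I : R) :=
  (forall x : R, is_derive x (1 : R) F (f x)) /\
  exists p q, [/\ lo < p, q < hi, forall t, t <= p -> F t = 0 & forall t, q <= t -> F t = I].

Lemma primitive_on_exists f lo hi p q : smooth1 f -> lo < p -> q < hi ->
  (forall t, t <= p -> f t = 0) -> (forall t, q <= t -> f t = 0) ->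
  exists F I, primitive_on f F lo hi I.
Proof.
move=> sf lop qhi fp fq; have [F [dF sF Fp Fq]] := compact_primitive sf fp fq.
by exists F, (F q); split => //; exists p, q.
Qed.

Lemma primitive_on_le f F lo hi I B : lo < hi -> primitive_on f F lo hi I ->
  (forall t, `|f t| <= B) -> (forall t, `|F t| <= B * (hi - lo)) /\ `|I| <= B * (hi - lo).
Proof.
move=> lohi [dF [p [q [lop qhi Fp Fq]]]] fB.
have B0 : 0 <= B by exact: le_trans (fB 0).
have H t : t <= hi -> `|F t| <= B * (hi - lo).
  move=> thi; have [tp|pt] := leP t p.
    by rewrite Fp// normr0 mulr_ge0// subr_ge0 ltW.
  have [c _ e] := is_derive_MVT dF (ltW pt).
  rewrite -[F t]subr0 -(Fp p)// e normrM; apply: ler_pM => //.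
  by rewrite ger0_norm ?subr_ge0; lra.
have HI : `|I| <= B * (hi - lo) by rewrite -(Fq hi) ?H// ltW.
by split => // t; have [/H//|ht] := leP t hi; rewrite Fq//; lra.
Qed.

(** Equal integrals cancel at the right end: this is what permits an integration by parts between
    two factors with the same integral. *)
Lemma primitive_onB f F g G lo hi I : primitive_on f F lo hi I -> primitive_on g G lo hi I ->
  primitive_on (fun t => f t - g t) (fun t => F t - G t) lo hi 0.
Proof.
move=> [dF [p [q [lop qhi Fp Fq]]]] [dG [p' [q' [lop' qhi' Gp Gq]]]]; split.
  by move=> x; exact: is_deriveB.
exists (Num.min p p'), (Num.max q q'); split.
- by rewrite lt_min lop.
- by rewrite gt_max qhi.
- by move=> t; rewrite le_min => /andP[h1 h2]; rewrite Fp// Gp// subrr.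
- by move=> t; rewrite ge_max => /andP[h1 h2]; rewrite Fq// Gq// subrr.
Qed.

Lemma primitive_onZ (c : R) f F lo hi I : primitive_on f F lo hi I ->
  primitive_on (fun t => c * f t) (fun t => c * F t) lo hi (c * I).
Proof.
move=> [dF [p [q [lop qhi Fp Fq]]]]; split; first by move=> x; exact: is_deriveZ.
by exists p, q; split => // t ht; [rewrite Fp ?mulr0|rewrite Fq].
Qed.
End primitive.

(** * Sobolev embedding on a box, by duality *)

Section sobolev.
Context {R : realType} {d : nat} (a l : 'I_d -> R).
Hypothesis l_gt0 : forall i, 0 < l i.
Local Notation mu := (lebesgue_rv R d).
Local Notation Om := (grid_box a l).
Variables (v : 'rV[R]_d -> R) (W : ('I_d -> nat) -> 'rV[R]_d -> R) (m : nat) (K : R).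
Hypothesis K_gt0 : 0 < K.
Hypothesis W_L2 : forall b, (\sum_i b i <= m)%N -> L2 Om (W b).
Hypothesis W_wderiv : forall b, (\sum_i b i <= m)%N -> is_wderiv Om b v (W b).
Hypothesis W_le : forall b, (\sum_i b i <= m)%N -> \int[mu]_(x in Om) (W b x ^+ 2) <= K ^+ 2.
Local Notation side := (side l).
Let side_gt0 := side_gt0 l_gt0.
Let mO := measurable_grid_box a l.
Let fO := grid_box_lty a l_gt0.

(* f is supported in the cell of level j and corner c, and its k-th factor has
   an L^1 norm at most M k. *)
Definition adm j c (f : 'I_d -> R -> R) (M : 'I_d -> R) :=
  [/\ forall k, smooth1 (f k), supp_in f c (fun k => c k + side j k),
      forall k t, `|f k t| <= M k / side j k & forall k, 0 < M k].

Definition pairing b (f : 'I_d -> R -> R) := \int[mu]_(x in Om) (W b x * tensor f x).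

Lemma tensor_L2 (f : 'I_d -> R -> R) (M : 'I_d -> R) : (forall k, smooth1 (f k)) ->
  (forall k t, `|f k t| <= M k) -> L2 Om (tensor f).
Proof.
move=> sf fM; apply: (L2_bounded mO fO (C := \prod_k M k)).
  exact: measurable_funS (tensor_measurable sf).
by move=> x _; exact: tensor_norm_le.
Qed.

(** The Cauchy-Schwarz inequality, with the sup bound \prod_k M k / q on a support of volume q,
    leaves q^(-1/2). It serves the highest order at every level, and every lower order at level
    0. *)
Lemma pairing_top b j c f M : (\sum_i b i <= m)%N -> subcell a l j c -> adm j c f M ->
  `|pairing b f| <= \prod_k M k * (K / Num.sqrt (\prod_k side j k)).
Proof.
move=> bm sc [sf suf fM M0].
have q0 : 0 < \prod_k side j k by apply: prodr_gt0.
have P0 : 0 < \prod_k (M k / side j k) by apply: prodr_gt0 => k _; rewrite divr_gt0.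
apply: le_trans (@L2_pairing_le _ _ _ mO fO (W b) (tensor f) (cell l j c) K
  (\prod_k (M k / side j k)) (\prod_k side j k) _ _ _ _ _ _ _ _ _ _ _) _ => //.
- exact: W_L2.
- exact: measurable_funS (tensor_measurable sf).
- exact: measurable_cell.
- exact: cell_sub.
- exact: lebesgue_cell.
- exact: W_le.
- by move=> x; exact: tensor_norm_le.
- by move=> x; exact: tensor_out suf.
rewrite prodf_div mulrA; set q := \prod_(k < d) side j k in q0 *.
have s0 : 0 < Num.sqrt q by rewrite sqrtr_gt0.
have e s : s != 0 -> K * (\prod_k M k / s ^+ 2) * s = \prod_k M k * (K / s).
  by move=> sn; field.
by have := e _ (lt0r_neq0 s0); rewrite sqr_sqrtr ?(ltW q0)// -mulrA => ->; rewrite mulrA.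
Qed.

Definition addv b (k : 'I_d) : 'I_d -> nat := fun i => (b i + (i == k))%N.

Lemma sum_addv b k : (\sum_i addv b k i = (\sum_i b i).+1)%N.
Proof.
rewrite /addv big_split /= -[RHS]addn1; congr addn.
by rewrite (bigD1 k)//= eqxx big1// => i /negbTE ->.
Qed.

(* The factors of f are exchanged for those of g one at a time. *)
Lemma pairing_compare b j c f g F F' I M G :
  ((\sum_i b i).+1 <= m)%N -> subcell a l j c ->
  (forall k f' M', adm j c f' M' -> `|pairing (addv b k) f'| <= \prod_i M' i * G) ->
  adm j c f M -> adm j c g M ->
  (forall k, primitive_on (f k) (F k) (c k) (c k + side j k) (I k)) ->
  (forall k, primitive_on (g k) (F' k) (c k) (c k + side j k) (I k)) ->
  `|pairing b f - pairing b g| <= 2 * (\sum_k side j k) * (\prod_k M k * G).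
Proof.
move=> bm sc HG [sf suf fM M0] [sg sug gM _] pf pg.
pose hyb (k : nat) (i : 'I_d) := if (i < k)%N then g i else f i.
have hyb0 : hyb 0%N = f by apply/funext => i.
have hybd : hyb d = g by apply/funext => i; rewrite /hyb ltn_ord.
have shyb k i : smooth1 (hyb k i) by rewrite /hyb; case: ifP.
have hM k i t : `|hyb k i t| <= M i / side j i by rewrite /hyb; case: ifP.
rewrite -hyb0 -hybd -opprB normrN -(telescope_sumr (fun k => pairing b (hyb k)))//.
rewrite big_mkord; apply: (le_trans (ler_norm_sum _ _ _)).
rewrite mulr_sumr mulr_suml; apply: ler_sum => k _.
(* The two factors at place [k] have the same integral, so the primitive [Psi] of their difference
   has compact support. *)
have pfg := primitive_onB (pf k) (pg k).
set Psi := fun t => F k t - F' k t in pfg.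
have [dPsi [p [q [lop qhi Pp Pq]]]] := pfg.
have sPsi : smooth1 Psi by apply: smooth1_primitive dPsi; exact: smooth1B.
have PsiE : derive1 Psi = (fun t => f k t - g k t).
  by apply/funext => t; rewrite derive1E (@derive_val _ _ _ _ _ _ _ (dPsi t)).
have [PM _] : (forall t, `|Psi t| <= 2 * M k / side j k * side j k) /\ `|0 : R| <= 2 * M k / side j k * side j k.
  have := @primitive_on_le _ _ _ _ _ _ (2 * M k / side j k) _ pfg _.
  rewrite addrAC subrr add0r; apply; first by rewrite ltrDl.
  move=> t; apply: (le_trans (ler_normB _ _)).
  by have := fM k t; have := gM k t; lra.
pose H i := upd (hyb k) k Psi i.
have sH : forall i, smooth1 (H i) by apply: smooth1_upd.
have suh n : supp_in (hyb n) c (fun k => c k + side j k).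
  by move=> i; rewrite /hyb; case: ifP.
have suH : supp_in H c (fun k => c k + side j k).
  by apply: supp_in_upd => //; exists p, q.
have suH' : supp_in (upd (hyb k) k (derive1 Psi)) c (fun k => c k + side j k).
  apply: supp_in_upd => //; rewrite PsiE.
  have [p1 [q1 [l1 h1 f1 f1']]] := suf k; have [p2 [q2 [l2 h2 g1 g1']]] := sug k.
  exists (Num.min p1 p2), (Num.max q1 q2); split.
  - by rewrite lt_min l1.
  - by rewrite gt_max h1.
  - by move=> t; rewrite le_min => /andP[? ?]; rewrite f1// g1// subrr.
  - by move=> t; rewrite ge_max => /andP[? ?]; rewrite f1'// g1'// subrr.
(* With [Psi] at place [k], the bound [M k] becomes [2 * M k * side j k]; the additional side is the
   gain of the integration by parts. *)
have aH : adm j c H (fun i => if i == k then 2 * M k * side j k else M i).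
  split => //.
  - move=> i t; rewrite /H /upd; case: eqP => [->|_//].
    by apply: le_trans (PM t) _; rewrite le_eqVlt; apply/orP; left; apply/eqP; ring.
  - by move=> i; case: ifP => // _; rewrite !mulr_gt0.
have := HG k _ _ aH.
rewrite (bigD1 k)//= eqxx (eq_bigr M); last by move=> i /negbTE ->.
suff -> : pairing b (hyb k.+1) - pairing b (hyb k) = pairing (addv b k) H.
  by move=> h; apply: (le_trans h); rewrite le_eqVlt; apply/orP; left; apply/eqP;
    rewrite [X in _ = _ * (X * _)](bigD1 k)//=; ring.
have tH : tensor H = tensor (upd (hyb k) k Psi) by [].
have pH : partial k (tensor H) = (fun x => tensor (hyb k) x - tensor (hyb k.+1) x).
  rewrite partial_tensor// upd_upd {1}/H /upd eqxx PsiE; apply/funext => x.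
  have e1 : hyb k = upd (hyb k) k (f k).
    by apply/funext => i; rewrite /upd /hyb; case: eqP => [->|//]; rewrite ltnn.
  have e2 : hyb k.+1 = upd (hyb k) k (g k).
    apply/funext => i; rewrite /upd /hyb; case: eqP => [->|/eqP ik]; first by rewrite ltnSn.
    by rewrite ltnS leq_eqVlt (_ : (i == k :> nat) = false)//; apply/negbTE.
  have e3 : tensor (hyb k) x = tensor (upd (hyb k) k (f k)) x by rewrite -e1.
  by rewrite e2 e3 !tensor_upd mulrBl.
have := @is_wderiv_tensor_step R d Om b k v (W b) (W (addv b k)) H.
rewrite pH => /(_ (W_wderiv (ltnW bm))) h.
rewrite /pairing -[RHS]opprK -h//; last 3 first.
- by apply: W_wderiv; rewrite sum_addv.
- exact: test_tensor (cell_sub sc).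
- rewrite -pH partial_tensor// /H upd_upd /upd eqxx.
  by apply: test_tensor (cell_sub sc) => //; apply: smooth1_upd => //; exact: smooth1_derive1.
under [in RHS]eq_Rintegral do rewrite mulrBr.
have tL n : L2 Om (tensor (hyb n)) := tensor_L2 (shyb n) (hM n).
rewrite RintegralB// ?opprB//.
  exact: (L2_mul_integrable mO (W_L2 (ltnW bm)) (tL k)).
exact: (L2_mul_integrable mO (W_L2 (ltnW bm)) (tL k.+1)).
Qed.

(** The reference function of a cell: each factor has integral 1 and a bound independent of the
    cell. Any admissible function is compared with a multiple of it. *)
Definition normal_bump j c om Om' :=
  adm j c om (fun=> (@bump_bound R)) /\
  forall k, primitive_on (om k) (Om' k) (c k) (c k + side j k) (1 : R).

Lemma bump_bound_gt0 : 0 < (@bump_bound R).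
Proof. exact: lt_le_trans (@bump_bound_ge1 R). Qed.

Lemma normal_bump_exists j c : exists om Om', normal_bump j c om Om'.
Proof.
have H k : exists p : (R -> R) * (R -> R), [/\ smooth1 p.1,
    supp1 p.1 (c k) (c k + side j k), forall t, `|p.1 t| <= (@bump_bound R) / side j k &
    primitive_on p.1 p.2 (c k) (c k + side j k) 1].
  have lt : c k < c k + side j k by rewrite ltrDl.
  have [om [F [p [q [[som dF] [h1 _ h2] [z1 z2] [F1 F2] ob]]]]] := normalized_bump lt.
  exists (om, F); split => //=.
  - by exists p, q.
  - by move=> t; have := ob t; rewrite addrAC subrr add0r.
  - by split => //; exists p, q.
have [p hp] := choice H.
exists (fun k => (p k).1), (fun k => (p k).2); split; last by move=> k; case: (hp k).
split => [k|k|k t|_]; last exact: bump_bound_gt0.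
- by case: (hp k).
- by case: (hp k).
- by case: (hp k) => _ _ + _; exact.
Qed.

Lemma adm_weaken j c f M M' : adm j c f M -> (forall k, M k <= M' k) -> adm j c f M'.
Proof.
move=> [sf suf fM M0] MM'; split => // [k t|k]; last exact: lt_le_trans (MM' k).
by apply: le_trans (fM k t) _; rewrite ler_pM2r// invr_gt0.
Qed.

Lemma sideS j k : side j k = 2 * side j.+1 k.
Proof.
have p0 : 2 ^+ j != 0 :> R by rewrite expf_neq0.
by rewrite /side exprS; field.
Qed.

(** The parent keeps the corner [c] if it fits in the box and is slid back otherwise, so it need not
    be a dyadic cell. *)
Lemma subcell_parent j c : subcell a l j.+1 c -> exists2 c', subcell a l j c' &
  forall k, c' k <= c k /\ c k + side j.+1 k <= c' k + side j k.
Proof.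
move=> sc; exists (fun k => Num.min (c k) (a k + l k - side j k)) => k.
  have [h1 h2] := sc k; have s0 := side_gt0 j k.
  have sl : side j k <= l k.
    by rewrite /side ler_pdivrMr ?exprn_gt0// ler_peMr ?exprn_ege1 ?ler1n// ltW.
  split; first by rewrite le_min h1 /=; lra.
  by have : Num.min (c k) (a k + l k - side j k) <= a k + l k - side j k;
    [rewrite ge_min lexx orbT|lra].
have [h1 h2] := sc k; have s0 := side_gt0 j.+1 k; have e := sideS j k.
by split; [rewrite ge_min lexx|rewrite /Num.min; case: ltP => _; lra].
Qed.

(** The sup bound [M k / side] is kept while the side doubles, hence the factor 2. *)
Lemma adm_parent j c c' f M : (forall k, c' k <= c k /\ c k + side j.+1 k <= c' k + side j k) ->
  adm j.+1 c f M -> adm j c' f (fun k => 2 * M k).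
Proof.
move=> cc' [sf suf fM M0]; split => // [k|k t|k]; last by rewrite mulr_gt0.
  have [p [q [h1 h2 h3 h4]]] := suf k; exists p, q; have [h5 h6] := cc' k.
  by split => //; lra.
apply: le_trans (fM k t) _; rewrite (sideS j) le_eqVlt; apply/orP; left; apply/eqP.
by field; rewrite gt_eqF.
Qed.

(* Growth in the level j of the pairing with a derivative, when its order is
   i above the bounded ones.  Each integration by parts halves the ratio, from
   the 2^(d/2) of the Cauchy-Schwarz inequality; the factor 3/4 keeps the ratios
   away from 1, where the geometric sums would grow linearly. *)
Definition tau i j : R := if i is 0%N then 1 else (3 / 4 * 2 ^+ i) ^+ j.

Lemma tau_ge1 i j : 1 <= tau i j.
Proof.
case: i => //= i; rewrite exprn_ege1// exprS.
have : (1 : R) <= 2 ^+ i by rewrite exprn_ege1// ler1n.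
lra.
Qed.

(** For [i = 0] the ratio is 3/4 and the whole series sums to 4. Otherwise the ratio q is at least
    3/2, and 4 q^j + q^(j+1) <= 4 q^(j+1) because 3 q >= 4. *)
Lemma geometric_tau i j : \sum_(k < j.+1) (3 / 4 * 2 ^+ i) ^+ k <= 4 * tau i j.
Proof.
case: i => [|i].
  rewrite expr0 mulr1 /=.
  suff -> : \sum_(k < j.+1) (3 / 4 : R) ^+ k = 4 - 4 * (3 / 4) ^+ j.+1.
    have : (0 : R) <= (3 / 4) ^+ j.+1 by rewrite exprn_ge0// divr_ge0.
    lra.
  elim: j => [|j IH]; first by rewrite big_ord_recl big_ord0 expr0 expr1; lra.
  by rewrite big_ord_recr /= IH (exprS _ j.+1); lra.
rewrite /tau; set q : R := 3 / 4 * 2 ^+ i.+1.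
have q32 : 3 / 2 <= q.
  have : (1 : R) <= 2 ^+ i by rewrite exprn_ege1// ler1n.
  by rewrite /q exprS; lra.
elim: j => [|j IH]; first by rewrite big_ord_recl big_ord0 expr0; lra.
rewrite big_ord_recr /=; apply: le_trans (lerD IH (lexx _)) _.
have qj : 0 <= q ^+ j by rewrite exprn_ge0//; lra.
rewrite exprS; have : 0 <= (3 * q - 4) * q ^+ j by rewrite mulr_ge0//; lra.
lra.
Qed.

Let P := \prod_k l k.
Let L := \sum_k l k.
Let ka := (@bump_bound R).
Let s := (d./2.+1)%N.

Lemma P_gt0 : 0 < P.
Proof. exact: prodr_gt0. Qed.

Lemma L_ge0 : 0 <= L.
Proof. by apply: sumr_ge0 => k _; exact: ltW. Qed.

Lemma prod_side j : \prod_k side j k = P / (2 ^+ d) ^+ j.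
Proof.
rewrite /side big_split /= -/P; congr (_ * _).
by rewrite prodr_const card_ord exprVn -!exprM mulnC.
Qed.

Lemma sum_side j : \sum_k side j k = L / 2 ^+ j.
Proof. by rewrite /side -mulr_suml. Qed.

(** The first summand is the Cauchy-Schwarz bound for a reference bump at level 0. In the second, 8
    is the 2 of [pairing_compare] times the 4 of [geometric_tau], and [(2 * ka) ^+ d] is the bound
    of a bump seen from its parent cell. *)
Fixpoint sobolev_cst r : R :=
  if r is r'.+1 then ka ^+ d / Num.sqrt P + 8 * L * (2 * ka) ^+ d * sobolev_cst r'
  else (Num.sqrt P)^-1.

Lemma sobolev_cst_ge0 r : 0 <= sobolev_cst r.
Proof.
have k0 : 0 <= ka by exact/ltW/bump_bound_gt0.
elim: r => /= [|r IH]; first by rewrite invr_ge0 sqrtr_ge0.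
by rewrite addr_ge0 ?divr_ge0 ?sqrtr_ge0 ?exprn_ge0// !mulr_ge0 ?L_ge0 ?exprn_ge0 ?mulr_ge0.
Qed.

(** Since 2 s >= d + 1, the square of 3/4 * 2^s is at least 9/8 * 2^d: the factor 3/4 still
    dominates the rate 2^(d/2). *)
Lemma top_rate j : (Num.sqrt (\prod_k side j k))^-1 <= (Num.sqrt P)^-1 * tau s j.
Proof.
set th : R := 3 / 4 * 2 ^+ s; have th0 : 0 <= th by rewrite mulr_ge0 ?exprn_ge0.
have P0 := P_gt0; have sP0 : 0 < Num.sqrt P by rewrite sqrtr_gt0.
have e0 : 0 < (2 ^+ d) ^+ j :> R by rewrite !exprn_gt0.
rewrite prod_side sqrtrM ?(ltW P0)// sqrtrV ?(ltW e0)// invfM invrK ler_pM2l ?invr_gt0//.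
rewrite -[tau s j]/(th ^+ j) -[leRHS]ger0_norm ?exprn_ge0// -sqrtr_sqr ler_wsqrtr//.
rewrite [leRHS]exprAC; apply: lerXn2r; rewrite ?nnegrE ?exprn_ge0 ?sqr_ge0//.
rewrite /th exprMn -exprM.
have : (2 ^+ d.+1 : R) <= 2 ^+ (s * 2).
  rewrite ler_eXn2l ?ltr1n// /s mulSn muln2.
  by rewrite -[X in (X < _)%N]odd_double_half; case: (odd d).
rewrite exprS; have : (0 : R) <= 2 ^+ (s * 2) by rewrite exprn_ge0.
lra.
Qed.

Lemma pairing_bound r : (r <= s)%N -> forall b, (\sum_i b i + r <= m)%N ->
  forall j c f M, subcell a l j c -> adm j c f M ->
  `|pairing b f| <= \prod_k M k * (sobolev_cst r * K * tau (s - r) j).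
Proof.
elim: r => [|r IH] rs b bm j c f M sc af.
  rewrite addn0 in bm; apply: le_trans (pairing_top bm sc af) _.
  have M0 : 0 <= \prod_k M k by apply: prodr_ge0 => k _; apply: ltW; case: af.
  rewrite ler_wpM2l// subn0 [leRHS]mulrAC [leRHS]mulrC ler_pM2l//; exact: top_rate.
have {}IH := IH (ltnW rs).
set i := (s - r.+1)%N; have si : (s - r)%N = i.+1 by rewrite /i subnSK.
rewrite si in IH; rewrite addnS in bm.
set G := sobolev_cst r; have G0 : 0 <= G := sobolev_cst_ge0 r.
pose Gj j := G * K * tau i.+1 j.
have k1 : 1 <= ka := @bump_bound_ge1 R.
have k0 : 0 < ka := bump_bound_gt0.
have bm1 : ((\sum_i b i).+1 <= m)%N by apply: leq_trans bm; rewrite ltnS leq_addr.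
have step j' c' f' g F F' I M' : subcell a l j' c' -> adm j' c' f' M' -> adm j' c' g M' ->
    (forall k, primitive_on (f' k) (F k) (c' k) (c' k + side j' k) (I k)) ->
    (forall k, primitive_on (g k) (F' k) (c' k) (c' k + side j' k) (I k)) ->
    `|pairing b f' - pairing b g| <= 2 * (L / 2 ^+ j') * (\prod_k M' k * Gj j').
  move=> sc' af' ag pf pg; rewrite -sum_side.
  apply: (pairing_compare bm1 sc' _ af' ag pf pg) => k f2 M2 a2.
  by apply: IH sc' a2; rewrite sum_addv addSn.
(* A comparison at level [j] multiplies the bound of the next order by [L / 2 ^+ j], which halves
   the ratio of its growth from 3/4 * 2^(i+1) to 3/4 * 2^i. *)
pose term j := L * (G * K * (3 / 4 * 2 ^+ i) ^+ j).
have termE j' : L / 2 ^+ j' * Gj j' = term j'.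
  rewrite /term /Gj /= -mulrA; congr (_ * _); rewrite exprS mulrCA; congr (_ * _).
  rewrite (_ : 3 / 4 * (2 * 2 ^+ i) = 2 * (3 / 4 * 2 ^+ i)); last by ring.
  by rewrite exprMn mulrA mulVf ?mul1r// expf_neq0.
have term0 j' : 0 <= term j'.
  by rewrite /term !mulr_ge0 ?L_ge0 ?exprn_ge0 ?mulr_ge0 ?(ltW K_gt0) ?exprn_ge0.
(* Reference bumps are followed from parent to parent. At level 0 Cauchy-Schwarz applies, and each
   generation adds one term of the geometric sum. *)
have Hnb j' : forall c' om Om', subcell a l j' c' -> normal_bump j' c' om Om' ->
    `|pairing b om| <= ka ^+ d * (K / Num.sqrt P) + 2 * (2 * ka) ^+ d * \sum_(k < j') term k.
  elim: j' => [|j' IHj] c' om Om' sc' [aom pom].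
    rewrite big_ord0 mulr0 addr0; have := pairing_top (ltnW bm1) sc' aom.
    by rewrite prod_side expr0 divr1 prodr_const card_ord.
  have [c2 sc2 cc2] := subcell_parent sc'.
  have [om2 [Om2 nb2]] := normal_bump_exists j' c2.
  have h1 := IHj _ _ _ sc2 nb2; have [aom2 pom2] := nb2.
  have h2 : `|pairing b om - pairing b om2| <= 2 * (L / 2 ^+ j') * (\prod_(k < d) (2 * ka) * Gj j').
    apply: (step _ c2 _ _ Om' Om2 (fun=> 1)) => //.
    - exact: adm_parent cc2 aom.
    - by apply: adm_weaken aom2 _ => _; rewrite ler_peMl ?ler1n// ltW.
    - move=> k; have [dO [p [q [lop qhi h3 h4]]]] := pom k; split => //.
      by have [h5 h6] := cc2 k; exists p, q; split => //; lra.
  rewrite prodr_const card_ord in h2.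
  rewrite big_ord_recr /= mulrDr addrA.
  rewrite -[pairing b om](subrK (pairing b om2)); apply: (le_trans (ler_normD _ _)).
  rewrite addrC; apply: lerD => //; apply: (le_trans h2); rewrite -termE.
  by rewrite le_eqVlt; apply/orP; left; apply/eqP; ring.
have [om [Om' nb]] := normal_bump_exists j c; have [aom pom] := nb.
have [sf suf fM M0] := af.
have /choice[FI hFI] : forall k, exists FI : (R -> R) * R,
    primitive_on (f k) FI.1 (c k) (c k + side j k) FI.2.
  move=> k; have [p [q [h1 h2 h3 h4]]] := suf k.
  by have [F [I h]] := primitive_on_exists (sf k) h1 h2 h3 h4; exists (F, I).
have IM k : `|(FI k).2| <= M k.
  have lt : c k < c k + side j k by rewrite ltrDl.
  have [_] := primitive_on_le lt (hFI k) (fM k).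
  by rewrite addrAC subrr add0r divfK// gt_eqF.
(* The reference bump is rescaled so that every factor has the integral of the corresponding factor
   of [f]; both then live on the same cell. *)
pose g k t := (FI k).2 * om k t.
have ag : adm j c g (fun k => ka * M k).
  have [som suom omb _] := aom; split => [k|k|k t|k]; last by rewrite mulr_gt0.
  - exact: smooth1Z.
  - have [p [q [h1 h2 h3 h4]]] := suom k; exists p, q.
    by split => // t ht; rewrite /g; [rewrite h3 ?mulr0|rewrite h4 ?mulr0].
  - rewrite /g normrM mulrAC (mulrC (_ / _)); apply: ler_pM => //.
have afk : adm j c f (fun k => ka * M k).
  by apply: adm_weaken af _ => k; rewrite ler_peMl// ltW.
have pg k : primitive_on (g k) (fun t => (FI k).2 * Om' k t) (c k) (c k + side j k) (FI k).2.
  by have := primitive_onZ (FI k).2 (pom k); rewrite mulr1.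
have h1 := step _ _ _ _ _ _ _ _ sc afk ag hFI pg.
have Mp : \prod_(k < d) (ka * M k) = ka ^+ d * \prod_k M k.
  by rewrite big_split /= prodr_const card_ord.
set PM := \prod_(k < d) M k in Mp *.
have PM0 : 0 <= PM by apply: prodr_ge0 => k _; apply: ltW.
have h2 : `|pairing b g| <= PM * (ka ^+ d * (K / Num.sqrt P) + 2 * (2 * ka) ^+ d * \sum_(k < j) term k).
  have -> : pairing b g = (\prod_(k < d) (FI k).2) * pairing b om.
    rewrite /pairing -RintegralZl//.
      by apply: eq_Rintegral => x _; rewrite /tensor /g big_split /=; ring.
    have [som _ omb _] := aom.
    exact: (L2_mul_integrable mO (W_L2 (ltnW bm1)) (tensor_L2 som omb)).
  rewrite normrM; apply: ler_pM => //; last exact: Hnb sc nb.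
  by rewrite normr_prod; apply: ler_prod => k _; rewrite normr_ge0 IM.
have h3 : 2 * (L / 2 ^+ j) * (\prod_(k < d) (ka * M k) * Gj j) <=
    PM * (2 * (2 * ka) ^+ d * term j).
  rewrite Mp -termE.
  rewrite [leLHS](_ : _ = ka ^+ d * (PM * (2 * (L / 2 ^+ j * Gj j)))); last by ring.
  rewrite [leRHS](_ : _ = (2 * ka) ^+ d * (PM * (2 * (L / 2 ^+ j * Gj j)))); last by ring.
  rewrite ler_wpM2r//; first by rewrite mulr_ge0// termE mulr_ge0.
  by apply: lerXn2r; rewrite ?nnegrE ?mulr_ge0 ?(ltW k0)// ler_peMl ?ler1n// ltW.
have h4 : \sum_(k < j) term k + term j <= L * (G * K * (4 * tau i j)).
  rewrite -(big_ord_recr j (fun k => term k)) /= /term -mulr_sumr ler_wpM2l ?L_ge0//.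
  by rewrite -mulr_sumr ler_wpM2l ?mulr_ge0 ?(ltW K_gt0)// geometric_tau.
rewrite -[pairing b f](subrK (pairing b g)); apply: (le_trans (ler_normD _ _)).
apply: (le_trans (lerD (le_trans h1 h3) h2)).
rewrite -mulrDr ler_wpM2l//.
have -> : sobolev_cst r.+1 = ka ^+ d / Num.sqrt P + 8 * L * (2 * ka) ^+ d * G by [].
have t1 := tau_ge1 i j.
have d0 : 0 <= 2 * (2 * ka) ^+ d by rewrite mulr_ge0// exprn_ge0// mulr_ge0// ltW.
have h5 : 2 * (2 * ka) ^+ d * (\sum_(k < j) term k + term j) <=
    2 * (2 * ka) ^+ d * (L * (G * K * (4 * tau i j))) by rewrite ler_wpM2l.
have h6 : ka ^+ d * (K / Num.sqrt P) <= ka ^+ d * (K / Num.sqrt P) * tau i j.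
  by rewrite ler_peMr// mulr_ge0 ?divr_ge0 ?sqrtr_ge0 ?exprn_ge0// ltW.
apply: (@le_trans _ _ (ka ^+ d * (K / Num.sqrt P) * tau i j +
  2 * (2 * ka) ^+ d * (L * (G * K * (4 * tau i j))))); first by lra.
by rewrite le_eqVlt; apply/orP; left; apply/eqP; ring.
Qed.

(** A factor with values in [0, 1] is admissible with [M k = side j k], so \prod_k M k is the volume
    of the cell. At [r = s] the growth [tau 0 j] is 1, which leaves a bound proportional to that
    volume. *)
Lemma sobolev_sup b : (\sum_i b i + s <= m)%N ->
  {ae mu, forall x, Om x -> `|W b x| <= sobolev_cst s * K}.
Proof.
move=> bm; apply: ae_bounded_of_tensors => //.
  by apply: W_L2; apply: leq_trans bm; rewrite leq_addr.
move=> j c f sc sf suf f01.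
have := pairing_bound (leqnn s) bm sc (M := fun k => side j k).
rewrite subnn /= mulr1 mulrC; apply; split => // k t.
by have /andP[h1 h2] := f01 k t; rewrite divff ?gt_eqF// ger0_norm.
Qed.
End sobolev.

(** * Partial derivatives of compactly supported functions integrate to zero *)

Section lines.
Context {R : realType}.

Definition cube d (M : R) : set 'rV[R]_d := box (fun=> [set` Interval (BLeft (- M)) (BRight M)]).
Arguments cube : clear implicits.

Lemma measurable_cube d M : measurable (cube d M).
Proof. exact: measurable_box. Qed.

Lemma lebesgue_cube_lty d M : (lebesgue_rv R d (cube d M) < +oo)%E.
Proof.
rewrite (@lebesgue_box _ _ _ (fun=> if - M < M then M + M else 0)) ?ltry// => i.
by rewrite lebesgue_measure_itv /= lte_fin; case: ifP => // _; rewrite -EFinD opprK.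
Qed.

Lemma rv_cons_coord d (t : R) (y : 'rV[R]_d) :
  (rv_cons (t, y) 0 ord0 = t) * (forall i, rv_cons (t, y) 0 (lift ord0 i) = y 0 i).
Proof.
have h0 : ord0 = @lshift 1 d ord0 by exact/val_inj.
split; first by rewrite /rv_cons h0 (@row_mxEl R 1 1 d) mxE eqxx mulr1n.
move=> i; have -> : lift ord0 i = @rshift 1 d i by exact/val_inj.
by rewrite /rv_cons (@row_mxEr R 1 1 d).
Qed.

Lemma rv_cons_shift0 d (t s : R) (y : 'rV[R]_d) :
  rv_cons (t, y) + s *: (delta_mx 0 ord0 : 'rV[R]_d.+1) = rv_cons (t + s, y).
Proof.
apply/rowP => i; rewrite [LHS]mxE [X in _ + X]mxE [X in _ * X]mxE /=.
case: (unliftP ord0 i) => [j ->|->]; rewrite !rv_cons_coord.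
  by rewrite (_ : (lift ord0 j == ord0) = false)// mulr0 addr0.
by rewrite eqxx mulr1.
Qed.

Lemma rv_cons_shiftS d (t s : R) (y : 'rV[R]_d) (l : 'I_d) :
  rv_cons (t, y) + s *: (delta_mx 0 (lift ord0 l) : 'rV[R]_d.+1) =
  rv_cons (t, y + s *: delta_mx 0 l).
Proof.
apply/rowP => i; rewrite [LHS]mxE [X in _ + X]mxE [X in _ * X]mxE /=.
case: (unliftP ord0 i) => [j ->|->]; rewrite !rv_cons_coord.
  by rewrite !mxE !eqxx (inj_eq lift_inj).
by rewrite (_ : (ord0 == lift ord0 l) = false)// mulr0 addr0.
Qed.

Lemma bounded_cube_integrable d0 (T : measurableType d0) (nu : {measure set T -> \bar R})
    (Q : set T) (f : T -> R) (C : R) :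
  measurable Q -> (nu Q < +oo)%E -> measurable_fun setT f -> (forall x, `|f x| <= C) ->
  (forall x, ~ Q x -> f x = 0) -> nu.-integrable setT (EFin \o f).
Proof.
move=> mQ fQ mf fC fQ0.
have iQ : nu.-integrable setT (fun x => (C%:E * (\1_Q x)%:E)%E).
  apply: integrableZl => //; apply/integrableP; split.
    by apply/measurable_EFinP; exact: measurable_indic.
  rewrite (eq_integral (fun x => (\1_Q x)%:E)); last first.
    by move=> x _; rewrite gee0_abs// lee_fin indicE.
  by rewrite integral_indic// setIT.
apply: (le_integrable measurableT _ _ iQ); first exact/measurable_EFinP.
move=> x _ /=; rewrite lee_fin; have C0 : 0 <= C by exact: le_trans (fC x).
rewrite normrM (ger0_norm C0) indicE; case: (pselect (Q x)) => Qx.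
  by rewrite mem_set// normr1 mulr1.
by rewrite memNset// normr0 mulr0 fQ0// normr0.
Qed.

(* Integrate first along the lines parallel to the l-th axis. *)
Lemma line_integral_eq0 d (f : 'rV[R]_d -> R) (l : 'I_d) (M C : R) :
  measurable_fun setT f -> (forall x, `|f x| <= C) -> (forall x, ~ cube d M x -> f x = 0) ->
  (forall x, \int[lebesgue_measure]_t f (x + t *: delta_mx 0 l) = 0) ->
  \int[lebesgue_rv R d]_x f x = 0.
Proof.
elim: d f l => [f [] //|d IH f l mf fC fM fl].
have mcons := @measurable_rv_cons R d.
have ic : (lebesgue_measure \x lebesgue_rv R d)%E.-integrable setT
    (EFin \o (f \o @rv_cons R d)).
  apply: (@bounded_cube_integrable _ _ _ (@rv_cons R d @^-1` cube d.+1 M) _ C).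
  - by rewrite -[X in measurable X]setTI; apply: mcons => //; exact: measurable_cube.
  - exact: (lebesgue_cube_lty d.+1 M).
  - exact: measurableT_comp.
  - by move=> x; exact: fC.
  - by move=> x Qx; exact: fM.
rewrite /Rintegral [X in fine X](_ : _ = (\int[(lebesgue_measure \x lebesgue_rv R d)%E]_z
    (EFin \o (f \o @rv_cons R d)) z)%E); last first.
  by rewrite [LHS](integral_pushforward (phi := @rv_cons R d)) ?preimage_setT//; exact/measurable_EFinP.
(* Along a later axis the induction applies to the slices at fixed first coordinate; along the first
   axis the other order of Fubini integrates the line first. *)
case: (unliftP ord0 l) fl => [l' ->|->] fl.
  rewrite -integral12_prod_meas1//.
  rewrite (eq_integral (cst 0%E)) ?integral0// => t _ /=.
  have mft : measurable_fun setT (fun y : 'rV[R]_d => f (rv_cons (t, y))).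
    apply: (measurableT_comp mf); apply: (measurableT_comp mcons).
    exact: pair1_measurable.
  have := IH (fun y => f (rv_cons (t, y))) l' mft (fun y => fC _).
  move=> h; have {}h := h _ _.
  have : \int[lebesgue_rv R d]_y f (rv_cons (t, y)) = 0.
    apply: h => [y ny|y].
      by apply: fM => h; apply: ny => i; have := h (lift ord0 i); rewrite rv_cons_coord.
    rewrite -[RHS](fl (rv_cons (t, y))); apply: eq_Rintegral => s _.
    by rewrite rv_cons_shiftS.
  rewrite /Rintegral => e; rewrite -[LHS]fineK ?e//.
  apply: integrable_fin_num => //.
  apply: (@bounded_cube_integrable _ _ _ (cube d M) _ C) => //.
  - exact: measurable_cube.
  - exact: lebesgue_cube_lty.
  - by move=> y; exact: fC.
  - by move=> y ny; apply: fM => h'; apply: ny => i; have := h' (lift ord0 i); rewrite rv_cons_coord.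
rewrite -integral21_prod_meas1//.
rewrite (eq_integral (cst 0%E)) ?integral0// => y _ /=.
have := fl (rv_cons (0, y)); rewrite /Rintegral.
under eq_integral do rewrite rv_cons_shift0 add0r.
move=> e; rewrite -[LHS]fineK ?e//.
apply: integrable_fin_num => //.
apply: (@bounded_cube_integrable _ _ _ (`[- M, M]%classic : set (measurableTypeR R)) _ C) => //.
- have fin : (@lebesgue_measure R ([set` Interval (BLeft (- M)%R) (BRight M)] : set R) < +oo)%E; last exact: fin.
  rewrite lebesgue_measure_itv /= lte_fin; case: ifP => _; last exact: ltry.
  by rewrite -EFinD ltry.
- apply: (measurableT_comp mf); apply: (measurableT_comp mcons).
  exact: pair2_measurable.
- by move=> t; exact: fC.
- by move=> t nt; apply: fM => h'; apply: nt; have := h' ord0; rewrite rv_cons_coord.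
Qed.

Lemma is_derive_line d (F : 'rV[R]_d -> R) (l : 'I_d) x (t : R) :
  (forall y, differentiable F y) ->
  is_derive t (1 : R) (fun s : R => F (x + s *: (delta_mx 0 l : 'rV[R]_d)))
    (partial l F (x + t *: delta_mx 0 l)).
Proof.
move=> dF; have dd : derivable F (x + t *: delta_mx 0 l) (delta_mx 0 l : 'rV[R]_d).
  exact: diff_derivable.
have cv : h^-1 *: (F (x + (h *: (1 : R) + t) *: (delta_mx 0 l : 'rV[R]_d)) - F (x + t *: delta_mx 0 l))
    @[h --> 0^'] --> partial l F (x + t *: delta_mx 0 l).
  rewrite (_ : (fun h => _) = (fun h : R => h^-1 *:
    (F (h *: (delta_mx 0 l : 'rV[R]_d) + (x + t *: delta_mx 0 l)) - F (x + t *: delta_mx 0 l)))).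
    exact: dd.
  apply/funext => h; congr (_ *: (F _ - _)).
  by rewrite /GRing.scale /= mulr1 -/(GRing.scale _ _) scalerDl addrCA.
by split; [apply: cvgP cv|exact: cvg_lim cv].
Qed.

Lemma Rintegral_partial_eq0 d (F : 'rV[R]_d -> R) (l : 'I_d) (M : R) :
  (forall x, differentiable F x) -> continuous (partial l F) ->
  (forall x, ~ cube d M x -> F x = 0 /\ partial l F x = 0) ->
  \int[lebesgue_rv R d]_x partial l F x = 0.
Proof.
move=> dF cF FM.
have [C hC] : exists C, forall x, `|partial l F x| <= C.
  have cK : compact (cube d M) by apply: rV_compact => i; exact: segment_compact.
  have := compact_bounded (continuous_compact (continuous_subspaceT cF) cK).
  move=> [C [_ /(_ (Num.max C 0 + 1))]] h.
  exists (Num.max C 0 + 1) => x.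
  have m0 : 0 <= Num.max C 0 by rewrite le_max lexx orbT.
  have [Kx|Kx] := pselect (cube d M x); last by rewrite (FM _ Kx).2 normr0 addr_ge0.
  apply: h; last by exists x.
  by rewrite (@le_lt_trans _ _ (Num.max C 0)) ?le_max ?lexx// ltrDl.
apply: (@line_integral_eq0 _ _ l M C) => //.
- exact: measurable_continuous_rv.
- by move=> x /FM[].
move=> x; set e : 'rV[R]_d := delta_mx 0 l.
pose g t := F (x + t *: e); pose g' t := partial l F (x + t *: e).
have dg t : is_derive t (1 : R) g (g' t) by exact: is_derive_line.
(* Beyond this distance the point has left the cube along the l-th axis, whatever [x] and the sign
   of [M], so [g] vanishes at both [N] and [- N]. *)
pose N := `|x 0 l| + `|M| + 1.
have out t : N <= `|t| -> ~ cube d M (x + t *: e).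
  move=> Nt h; have := h l; rewrite /= in_itv/= !mxE !eqxx mulr1 -ler_norml => h'.
  have : `|t| <= `|x 0 l| + `|M|.
    rewrite -[t](addKr (x 0 l)); apply: (le_trans (ler_normD _ _)).
    by rewrite normrN lerD2l (le_trans h')// ler_norm.
  by move: Nt; rewrite /N; lra.
have N0 : 0 < N by rewrite /N; have := normr_ge0 (x 0 l); have := normr_ge0 M; lra.
have cg' : continuous g'.
  move=> t; apply: (@continuous_comp _ _ _ (fun s : R => x + s *: e) (partial l F)); last exact: cF.
  by apply: cvgD; [exact: cvg_cst|apply: cvgZr_tmp; exact: cvg_id].
rewrite (_ : Rintegral _ _ _ = \int[lebesgue_measure]_(t in `[- N, N]) g' t); last first.
  rewrite [RHS]Rintegral_mkcond; apply: eq_Rintegral => t _; rewrite patchE.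
  case: ifPn => //; rewrite notin_setE /= in_itv/= => /negP; rewrite -ler_norml -ltNge => Nt.
  by have [] := FM _ (out t (ltW Nt)).
have gN t : N <= `|t| -> g t = 0 by move=> /out /FM[].
rewrite /Rintegral (@continuous_FTC2 _ g' g).
- have g1 : g N = 0 by apply: gN; rewrite gtr0_norm.
  have g2 : g (- N) = 0 by apply: gN; rewrite normrN gtr0_norm.
  by rewrite g1 g2 sube0.
- by lra.
- exact: continuous_subspaceT.
- split => [t _||]; first by case: (dg t).
    apply: cvg_at_right_filter; apply: differentiable_continuous.
    by apply/derivable1_diffP; case: (dg (- N)).
  apply: cvg_at_left_filter; apply: differentiable_continuous.
  by apply/derivable1_diffP; case: (dg N).
- by move=> t _; rewrite derive1E (@derive_val _ _ _ _ _ _ _ (dg t)).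
Qed.
End lines.

(** * General test functions and integration by parts *)

Section test_functions.
Context {R : realType} {d : nat}.
Implicit Types (Om : set 'rV[R]_d) (phi u v : 'rV[R]_d -> R).

Lemma smooth_partial phi i : smooth phi -> smooth (partial i phi).
Proof. by move=> sp s x; have := sp (rcons s i) x; rewrite foldr_rcons. Qed.

Lemma smooth_continuous phi : smooth phi -> continuous phi.
Proof. by move=> sp x; apply: differentiable_continuous; exact: (sp [::]). Qed.

Lemma partial_out (K : set 'rV[R]_d) phi i : closed K -> (forall x, ~ K x -> phi x = 0) ->
  forall x, ~ K x -> partial i phi x = 0.
Proof.
move=> cK K0 x nKx; rewrite /partial (@near_eq_derive _ _ _ _ (cst 0)).
  by rewrite derive_cst.
have oK : open (~` K) by rewrite openC.
by near=> y; apply: K0; near: y; exact: open_nbhs_nbhs.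
Unshelve. all: by end_near. Qed.

Lemma test_partial Om phi i : test_function Om phi -> test_function Om (partial i phi).
Proof.
move=> [sp [K [cK KO K0]]]; split; first exact: smooth_partial.
exists K; split => //; apply: partial_out K0.
exact: compact_closed cK.
Qed.

Lemma test_mpartial Om b phi : test_function Om phi -> test_function Om (mpartial b phi).
Proof.
move=> tp; rewrite /mpartial; elim: (enum _) => //= i s IH.
by elim: (b i) => //= m IHm; exact: test_partial.
Qed.

Lemma test_bounded Om phi : test_function Om phi -> exists C, forall x, `|phi x| <= C.
Proof.
move=> [sp [K [cK KO K0]]].
have := compact_bounded (continuous_compact (continuous_subspaceT (smooth_continuous sp)) cK).
move=> [C [_ /(_ (Num.max C 0 + 1))]] h; exists (Num.max C 0 + 1) => x.
have m0 : 0 <= Num.max C 0 by rewrite le_max lexx orbT.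
have [Kx|Kx] := pselect (K x); last by rewrite (K0 _ Kx) normr0 addr_ge0.
apply: h; last by exists x.
by rewrite (@le_lt_trans _ _ (Num.max C 0)) ?le_max ?lexx// ltrDl.
Qed.

Lemma test_L2 Om phi : measurable Om -> (lebesgue_rv R d Om < +oo)%E ->
  test_function Om phi -> L2 Om phi.
Proof.
move=> mO fO tp; have [C hC] := test_bounded tp.
apply: (L2_bounded mO fO (C := C)) => //.
by apply: measurable_funTS; apply: measurable_continuous_rv; exact: smooth_continuous tp.1.
Qed.

Lemma mpartial_iter (m : nat) (i : 'I_d) phi :
  mpartial (fun k => if k == i then m else 0%N) phi = iter m (partial i) phi.
Proof.
rewrite /mpartial; have key s : i \notin s ->
    foldr (fun k (g : 'rV[R]_d -> R) => iter (if k == i then m else 0%N) (partial k) g) phi s = phi.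
  by elim: s => //= k s IH; rewrite inE negb_or eq_sym => /andP[/negbTE -> /IH].
have : i \in enum 'I_d by rewrite mem_enum.
have := enum_uniq 'I_d; elim: (enum _) => //= k s IH /andP[ks us].
rewrite inE => /orP[/eqP ik|ins]; first by rewrite ik in key *; rewrite eqxx key.
by case: eqP => [ki|_] /=; [rewrite ki ins in ks|exact: IH].
Qed.

(* F phi vanishes outside a compact set, so its partial derivatives integrate to 0. *)
Lemma integration_by_parts_test Om u phi i : test_function Om phi -> 
  (forall x, differentiable u x) -> continuous (partial i u) ->
  measurable Om -> (lebesgue_rv R d Om < +oo)%E ->
  (exists C, forall x, Om x -> `|u x| <= C) -> (exists C, forall x, Om x -> `|partial i u x| <= C) ->
  \int[lebesgue_rv R d]_(x in Om) (u x * partial i phi x) =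
  - \int[lebesgue_rv R d]_(x in Om) (partial i u x * phi x).
Proof.
move=> tp du cu mO fO [C uC] [C' uC'].
have tp' := test_partial i tp.
have [sp [K [cK KO K0]]] := tp.
have cu' : continuous u by move=> x; exact: differentiable_continuous.
have dphi x : differentiable phi x by exact: (sp [::]).
have Lu : L2 Om u.
  by apply: (L2_bounded mO fO _ uC); apply: measurable_funTS; exact: measurable_continuous_rv.
have Lu' : L2 Om (partial i u).
  by apply: (L2_bounded mO fO _ uC'); apply: measurable_funTS; exact: measurable_continuous_rv.
have clK : closed K by exact: compact_closed cK.
have [M hM] : exists M, K `<=` @cube R d M.
  have [M [_ hM]] := compact_bounded cK.
  exists (M + 1) => x Kx k; rewrite /= in_itv/= -ler_norml.
  have := hM (M + 1) (ltac:(by rewrite ltrDl)) x Kx; apply: le_trans.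
  rewrite [leRHS]mx_normrE.
  exact: (@le_bigmax _ _ _ 0 (fun ij : 'I_1 * 'I_d => `|x ij.1 ij.2|) (0, k)).
pose F x := u x * phi x.
have dF x : differentiable F x by exact: differentiableM.
have pF x : partial i F x = u x * partial i phi x + partial i u x * phi x.
  rewrite /partial /F deriveM; [by rewrite /GRing.scale /= [phi x * _]mulrC|exact: diff_derivable..].
have FK x : ~ K x -> F x = 0 by move=> Kx; rewrite /F K0// mulr0.
have I0 : \int[lebesgue_rv R d]_x partial i F x = 0.
  apply: (@Rintegral_partial_eq0 _ _ _ _ M) => //.
    rewrite (_ : partial i F = (fun x => u x * partial i phi x + partial i u x * phi x)); last exact/funext.
    have c1 := smooth_continuous tp'.1; have c2 := smooth_continuous sp.
    by move=> x; exact: (cvgD (cvgM (cu' x) (c1 x)) (cvgM (cu x) (c2 x))).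
  move=> x nx; have nK : ~ K x by move=> /hM.
  by split; [exact: FK|exact: (partial_out i clK FK nK)].
have : \int[lebesgue_rv R d]_(x in Om) partial i F x = 0.
  rewrite -I0 Rintegral_mkcond; apply: eq_Rintegral => x _; rewrite patchE.
  case: ifPn => //; rewrite notin_setE => nO; apply/esym; apply: partial_out FK _ _ => //.
  by move=> /KO.
under eq_Rintegral do rewrite pF.
rewrite RintegralD//.
- by move/eqP; rewrite addr_eq0 => /eqP.
- exact: (L2_mul_integrable mO Lu (test_L2 mO fO tp')).
- exact: (L2_mul_integrable mO Lu' (test_L2 mO fO tp)).
Qed.
End test_functions.

(** * Weak derivatives: uniqueness and linearity *)

Section weak_derivatives.
Context {R : realType} {d : nat} (a l : 'I_d -> R).
Hypothesis l_gt0 : forall i, 0 < l i.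
Local Notation mu := (lebesgue_rv R d).
Local Notation Om := (grid_box a l).
Let mO := measurable_grid_box a l.
Let fO := grid_box_lty a l_gt0.
Implicit Types (u v g : 'rV[R]_d -> R) (b : 'I_d -> nat).

Lemma wderiv_L2 b u : L2 Om (wderiv Om b u).
Proof.
rewrite /wderiv; case: (xgetP _ _) => [g -> []//|_].
exact: (L2_cst mO fO 0).
Qed.

Lemma wderivP b u : (exists g, L2 Om g /\ is_wderiv Om b u g) -> is_wderiv Om b u (wderiv Om b u).
Proof.
move=> h; rewrite /wderiv.
by have [] := @xgetPex _ (fun=> 0) [set g | L2 Om g /\ is_wderiv Om b u g] h.
Qed.

Lemma Hm_wderiv m u b : Hm Om m u -> (\sum_i b i <= m)%N -> is_wderiv Om b u (wderiv Om b u).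
Proof. by move=> [_ H] bm; exact: wderivP (H b bm). Qed.

Lemma is_wderiv_unique b u g g' : L2 Om g -> L2 Om g' ->
  is_wderiv Om b u g -> is_wderiv Om b u g' -> {ae mu, forall x, Om x -> g x = g' x}.
Proof.
move=> Lg Lg' wg wg'.
have : {ae mu, forall x, Om x -> g x - g' x = 0}.
  apply: (ae_eq0_of_tensors l_gt0 (L2B mO Lg Lg')) => f tf.
  under eq_Rintegral do rewrite mulrBl.
  have Lf := test_L2 mO fO tf.
  rewrite RintegralB//; [|exact: (L2_mul_integrable mO Lg Lf)|exact: (L2_mul_integrable mO Lg' Lf)].
  have := wg _ tf; rewrite (wg' _ tf) => /mulfI e; apply/eqP; rewrite subr_eq0; apply/eqP/esym/e.
  by rewrite expf_neq0// oppr_eq0 oner_eq0.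
by apply: filterS => x h Ox; apply/eqP; rewrite -subr_eq0 h.
Qed.

Lemma is_wderiv_lin b (c : R) u v g g' : L2 Om u -> L2 Om v -> L2 Om g -> L2 Om g' ->
  is_wderiv Om b u g -> is_wderiv Om b v g' ->
  is_wderiv Om b (fun x => u x + c * v x) (fun x => g x + c * g' x).
Proof.
move=> Lu Lv Lg Lg' wg wg' phi tp.
have Lp := test_L2 mO fO tp; have Lq := test_L2 mO fO (test_mpartial b tp).
have split1 (U V P : 'rV[R]_d -> R) : L2 Om U -> L2 Om V -> L2 Om P ->
    \int[mu]_(x in Om) ((U x + c * V x) * P x) =
    \int[mu]_(x in Om) (U x * P x) + c * \int[mu]_(x in Om) (V x * P x).
  move=> LU LV LP; have iU := L2_mul_integrable mO LU LP.
  have iV := L2_mul_integrable mO LV LP.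
  rewrite -RintegralZl// -RintegralD//; last exact: (integrableZl mO c iV).
  by apply: eq_Rintegral => x _; rewrite mulrDl mulrA.
by rewrite !split1// (wg _ tp) (wg' _ tp); ring.
Qed.

Lemma Rintegral_ae_eq u v : measurable_fun Om u -> measurable_fun Om v ->
  {ae mu, forall x, Om x -> u x = v x} -> \int[mu]_(x in Om) u x = \int[mu]_(x in Om) v x.
Proof.
move=> mu_ mv uv; rewrite /Rintegral; congr fine; apply: ae_eq_integral => //.
- exact/measurable_EFinP.
- exact/measurable_EFinP.
- by apply: filterS uv => x h Ox; rewrite /= h.
Qed.

Lemma is_wderiv_ae b u v g : measurable_fun Om u -> measurable_fun Om v ->
  {ae mu, forall x, Om x -> u x = v x} -> is_wderiv Om b u g -> is_wderiv Om b v g.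
Proof.
move=> mu_ mv uv wg phi tp; rewrite -(wg _ tp).
have mq := (test_L2 mO fO (test_mpartial b tp)).1.
apply: Rintegral_ae_eq; [exact: measurable_funM|exact: measurable_funM|].
by apply: filterS uv => x h Ox; rewrite h.
Qed.

(** The two functions have the same set of weak derivatives, so the choice operator picks the same
    representative and the equality is literal. *)
Lemma wderiv_ae b u v : measurable_fun Om u -> measurable_fun Om v ->
  {ae mu, forall x, Om x -> u x = v x} -> wderiv Om b u = wderiv Om b v.
Proof.
move=> mu_ mv uv; rewrite /wderiv; congr (xget _ _); apply/seteqP.
have vu : {ae mu, forall x, Om x -> v x = u x} by apply: filterS uv => x h Ox; rewrite h.
by split => g [Lg wg]; split => //; [exact: (is_wderiv_ae mu_ mv uv)|exact: (is_wderiv_ae mv mu_ vu)].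
Qed.

Lemma is_wderiv_id b u : (forall i, b i = 0%N) -> is_wderiv Om b u u.
Proof.
move=> b0 phi tp; have -> : b = (fun=> 0%N) by apply/funext.
rewrite big1// expr0 mul1r; congr Rintegral; apply/funext => x; congr (_ * _).
by rewrite /mpartial; elim: (enum _).
Qed.

Lemma Hm_lin m (c : R) u v : Hm Om m u -> Hm Om m v -> Hm Om m (fun x => u x + c * v x).
Proof.
move=> [Lu Hu] [Lv Hv]; split; first exact: (L2D mO Lu (L2Z mO c Lv)).
move=> b bm; have [g [Lg wg]] := Hu b bm; have [g' [Lg' wg']] := Hv b bm.
exists (fun x => g x + c * g' x); split; first exact: (L2D mO Lg (L2Z mO c Lg')).
exact: is_wderiv_lin.
Qed.

(** The representative chosen for a combination is not the combination of those chosen; uniqueness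
    identifies them almost everywhere. *)
Lemma wderiv_lin m b (c : R) u v : (\sum_i b i <= m)%N -> Hm Om m u -> Hm Om m v ->
  {ae mu, forall x, Om x -> wderiv Om b (fun x => u x + c * v x) x =
     wderiv Om b u x + c * wderiv Om b v x}.
Proof.
move=> bm Hu Hv; apply: is_wderiv_unique.
- exact: wderiv_L2.
- exact: (L2D mO (wderiv_L2 b u) (L2Z mO c (wderiv_L2 b v))).
- exact: (Hm_wderiv (Hm_lin c Hu Hv) bm).
- apply: is_wderiv_lin; [exact: Hu.1|exact: Hv.1|exact: wderiv_L2|exact: wderiv_L2| |].
    exact: (Hm_wderiv Hu bm).
  exact: (Hm_wderiv Hv bm).
Qed.

Lemma wderiv0 b u : L2 Om u -> (forall i, b i = 0%N) ->
  {ae mu, forall x, Om x -> wderiv Om b u x = u x}.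
Proof.
move=> Lu b0; have w := is_wderiv_id u b0; apply: (is_wderiv_unique (wderiv_L2 b u) Lu _ w).
by apply: wderivP; exists u.
Qed.
End weak_derivatives.

(** * Classical derivatives of the quadratic function w *)

Section parabola.
Context {R : realType} {n : nat} (eps : R).
Hypothesis eps_gt0 : 0 < eps.
Local Notation w := (@w R n eps).

Lemma differentiable_w x : differentiable w x.
Proof.
rewrite /Defs.w; apply: (@differentiableB _ _ _ (fun x : 'rV[R]_n.+1 => - (\sum_i (x 0 i) ^+ 2) / (4 * eps))
  (cst (ln ((2 * Num.sqrt (pi * eps)) ^+ n.+1)))); last exact: differentiable_cst.
apply: (@differentiableM _ _ (fun x : 'rV[R]_n.+1 => - (\sum_i (x 0 i) ^+ 2)) (cst (4 * eps)^-1));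
  last exact: differentiable_cst.
apply: differentiableN; elim: (index_enum _) => [|i s IH].
  by under eq_fun do rewrite big_nil; exact: differentiable_cst.
under eq_fun do rewrite big_cons expr2.
have dc := @differentiable_coord R 1 n.+1 x 0 i.
by apply: (differentiableD _ IH); exact: (differentiableM dc dc).
Qed.

Lemma partial_w l x : partial l w x = - x 0 l / (2 * eps).
Proof.
set v := RHS; have en : eps != 0 by rewrite gt_eqF.
suff cv : h^-1 *: (w (h *: (delta_mx 0 l : 'rV[R]_n.+1) + x) - w x) @[h --> 0^'] --> v.
  exact: cvg_lim cv.
(* As w is quadratic, the error of the difference quotient is exactly linear in the increment. *)
have e1 (h : R) : h != 0 -> h^-1 *: (w (h *: (delta_mx 0 l : 'rV[R]_n.+1) + x) - w x) = v - h / (4 * eps).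
  move=> hn; rewrite /Defs.w (bigD1 l)//= [in X in _ - X](bigD1 l)//= !mxE !eqxx /= mulr1.
  rewrite (eq_bigr (fun i => x 0 i ^+ 2)); last first.
    by move=> i /negbTE il; rewrite !mxE il andbF mulr0 add0r.
  rewrite /v /GRing.scale /=; set S := \sum_(i | _) _; set L := ln _.
  by field; rewrite hn en.
have cv : v - h / (4 * eps) @[h --> (0 : R)^'] --> v.
  rewrite -[X in _ --> X]subr0; apply: cvgB; first exact: cvg_cst.
  rewrite -[X in _ --> X](mul0r (4 * eps)^-1); apply: cvgMr_tmp.
  exact: nbhs_dnbhs.
apply: cvg_trans cv; apply: near_eq_cvg; near=> h; rewrite e1//.
by near: h; exact: nbhs_dnbhs_neq.
Unshelve. all: by end_near. Qed.

Lemma partial_wE l : partial l w = (fun x => - x 0 l / (2 * eps)).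
Proof. by apply/funext => x; exact: partial_w. Qed.

Lemma differentiable_partial_w l x : differentiable (partial l w) x.
Proof.
rewrite partial_wE.
apply: (@differentiableM _ _ (fun x : 'rV[R]_n.+1 => - x 0 l) (cst (2 * eps)^-1)); last exact: differentiable_cst.
apply: differentiableN; exact: (@differentiable_coord R 1 n.+1 x 0 l).
Qed.

Lemma partial2_w l x : partial l (partial l w) x = - (2 * eps)^-1.
Proof.
suff cv : h^-1 *: (partial l w (h *: (delta_mx 0 l : 'rV[R]_n.+1) + x) - partial l w x) @[h --> 0^']
    --> - (2 * eps)^-1.
  exact: cvg_lim cv.
apply: cvg_near_cst; near=> h.
have hn : h != 0 by near: h; exact: nbhs_dnbhs_neq.
rewrite !partial_w !mxE !eqxx mulr1 /GRing.scale /=; field.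
by rewrite hn gt_eqF.
Unshelve. all: by end_near. Qed.
End parabola.

(** * Sobolev norms as sums over multi-indices *)

Section sobolev_norms.
Context {R : realType} {d : nat} (a l : 'I_d -> R).
Hypothesis l_gt0 : forall i, 0 < l i.
Local Notation mu := (lebesgue_rv R d).
Local Notation Om := (grid_box a l).
Let mO := measurable_grid_box a l.
Let fO := grid_box_lty a l_gt0.
Implicit Types (u v g : 'rV[R]_d -> R) (b : 'I_d -> nat).

Definition sqnorm b u := \int[mu]_(x in Om) (wderiv Om b u x) ^+ 2.

Lemma sqnorm_ge0 b u : 0 <= sqnorm b u.
Proof. by apply: Rintegral_ge0 => x _; exact: sqr_ge0. Qed.

Lemma Hdot_sqnorm m u : Hdot Om m u u =
  \sum_(b : {ffun 'I_d -> 'I_m.+1} | (\sum_i b i <= m)%N) sqnorm (fun i => b i) u.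
Proof. by apply: eq_bigr => b _; apply: eq_Rintegral => x _; rewrite expr2. Qed.

Lemma Hdot_ge0 m u : 0 <= Hdot Om m u u.
Proof. by rewrite Hdot_sqnorm; apply: sumr_ge0 => b _; exact: sqnorm_ge0. Qed.

Lemma Hnorm_sqr m u : Hnorm Om m u ^+ 2 = Hdot Om m u u.
Proof. by rewrite sqr_sqrtr// Hdot_ge0. Qed.

Lemma sqnorm_le_Hnorm m b u : (\sum_i b i <= m)%N -> sqnorm b u <= Hnorm Om m u ^+ 2.
Proof.
move=> bm; rewrite Hnorm_sqr Hdot_sqnorm.
pose b' : {ffun 'I_d -> 'I_m.+1} := [ffun i => inord (b i)].
have b'E : (fun i => b' i : nat) = b.
  apply/funext => i; rewrite ffunE inordK// ltnS; apply: leq_trans bm.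
  by rewrite (bigD1 i)//= leq_addr.
rewrite (bigD1 b')/= ?b'E//; last by rewrite (eq_bigr b)// => i _; rewrite -[in RHS]b'E.
by rewrite lerDl; apply: sumr_ge0 => b2 _; exact: sqnorm_ge0.
Qed.

Lemma sobolev_wderiv m b u rho : (\sum_i b i + d./2.+1 <= m)%N -> 0 < rho ->
  Hm Om m u -> Hnorm Om m u <= rho ->
  {ae mu, forall x, Om x -> `|wderiv Om b u x| <= sobolev_cst l d./2.+1 * rho}.
Proof.
move=> bm r0 Hu ur.
apply: (@sobolev_sup R d a l l_gt0 u (fun b => wderiv Om b u) m rho r0) => //.
- by move=> b' _; exact: wderiv_L2.
- by move=> b' b'm; exact: (Hm_wderiv Hu b'm).
- move=> b' b'm; apply: le_trans (sqnorm_le_Hnorm u b'm) _.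
  by rewrite lerXn2r ?nnegrE ?sqrtr_ge0// ltW.
Qed.

Lemma THnorm_sqr k m (V : 'I_k.+1 -> 'rV[R]_d -> R) :
  THnorm Om m V ^+ 2 = \sum_i Hnorm Om m (V i) ^+ 2.
Proof. by rewrite sqr_sqrtr//; apply: sumr_ge0 => i _; exact: sqr_ge0. Qed.

Lemma Hnorm_le_THnorm k m (V : 'I_k.+1 -> 'rV[R]_d -> R) i :
  Hnorm Om m (V i) <= THnorm Om m V.
Proof.
rewrite -[leLHS]ger0_norm ?sqrtr_ge0// -sqrtr_sqr ler_wsqrtr// (bigD1 i)//= lerDl.
by apply: sumr_ge0 => j _; exact: sqr_ge0.
Qed.

Lemma is_wderiv_cst0 b : is_wderiv Om b (cst 0) (cst 0).
Proof.
by move=> phi _; rewrite /cst; under eq_Rintegral do rewrite mul0r;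
  under [in RHS]eq_Rintegral do rewrite mul0r; rewrite Rintegral_cst// mul0r mulr0.
Qed.

Lemma is_wderiv_sum b (I : Type) (s : seq I) (u g : I -> 'rV[R]_d -> R) :
  (forall i, L2 Om (u i)) -> (forall i, L2 Om (g i)) ->
  (forall i, is_wderiv Om b (u i) (g i)) ->
  [/\ L2 Om (fun x => \sum_(i <- s) u i x), L2 Om (fun x => \sum_(i <- s) g i x) &
   is_wderiv Om b (fun x => \sum_(i <- s) u i x) (fun x => \sum_(i <- s) g i x)].
Proof.
move=> Lu Lg wg; elim: s => [|i s [L1 L2' w]].
  have e0 (f : I -> 'rV[R]_d -> R) : (fun x => \sum_(j <- [::]) f j x) = cst 0.
    by apply/funext => x; rewrite big_nil.
  by rewrite !e0; split; [exact: L2_cst|exact: L2_cst|exact: is_wderiv_cst0].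
have e (f : I -> 'rV[R]_d -> R) :
    (fun x => \sum_(j <- i :: s) f j x) = (fun x => \sum_(j <- s) f j x + 1 * f i x).
  by apply/funext => x; rewrite big_cons addrC mul1r.
rewrite !e; split.
- exact: (L2D mO L1 (L2Z mO 1 (Lu i))).
- exact: (L2D mO L2' (L2Z mO 1 (Lg i))).
- exact: (is_wderiv_lin l_gt0).
Qed.

Lemma wderivB m b u v : (\sum_i b i <= m)%N -> Hm Om m u -> Hm Om m v ->
  {ae mu, forall x, Om x -> wderiv Om b (fun x => u x - v x) x = wderiv Om b u x - wderiv Om b v x}.
Proof.
move=> bm Hu Hv; have -> : (fun x => u x - v x) = (fun x => u x + (-1) * v x).
  by apply/funext => x; rewrite mulN1r.
apply: filterS (wderiv_lin l_gt0 (-1) bm Hu Hv) => x h Ox.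
by rewrite h// mulN1r.
Qed.

Lemma HmB m u v : Hm Om m u -> Hm Om m v -> Hm Om m (fun x => u x - v x).
Proof.
move=> Hu Hv; have -> : (fun x => u x - v x) = (fun x => u x + (-1) * v x).
  by apply/funext => x; rewrite mulN1r.
exact: (Hm_lin l_gt0).
Qed.

(** Strong convexity pairs the derivative with the exact solution minus the minimizer, the
    variational inequality with the opposite difference; the sign passes through [wderiv] only
    almost everywhere. *)
Lemma Hdot_subC m G u v : Hm Om m u -> Hm Om m v ->
  Hdot Om m G (fun x => u x - v x) = - Hdot Om m G (fun x => v x - u x).
Proof.
move=> Hu Hv; rewrite /Hdot -sumrN; apply: eq_bigr => b bm.
have LG := wderiv_L2 a l_gt0 (fun i => b i) G.
have L1 := wderiv_L2 a l_gt0 (fun i => b i) (fun x => u x - v x).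
have L2' := wderiv_L2 a l_gt0 (fun i => b i) (fun x => v x - u x).
have iv := L2_mul_integrable mO LG L2'.
rewrite -mulN1r -RintegralZl//; apply: Rintegral_ae_eq.
- by apply: measurable_funM; [exact: LG.1|exact: L1.1].
- by apply: measurable_funM => //; apply: measurable_funM; [exact: LG.1|exact: L2'.1].
apply: filterS2 (wderivB bm Hu Hv) (wderivB bm Hv Hu) => x h1 h2 Ox.
by rewrite h1// h2//; ring.
Qed.

Lemma THdot_tsubC k m (G V V' : 'I_k.+1 -> 'rV[R]_d -> R) : THm Om m V -> THm Om m V' ->
  THdot Om m G (tsub V V') = - THdot Om m G (tsub V' V).
Proof.
by move=> HV HV'; rewrite /THdot -sumrN; apply: eq_bigr => i _; exact: Hdot_subC.
Qed.

Lemma sum_gt0_addv m b : (\sum_i b i = m.+1)%N -> exists i b', b = addv b' i /\ (\sum_i b' i = m)%N.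
Proof.
move=> bm; have [i bi] : exists i, (0 < b i)%N.
  apply: contrapT => /forallNP h; have : (\sum_i b i = 0)%N.
    by apply: big1 => i _; apply/eqP; rewrite -leqn0 leqNgt; apply/negP/h.
  by rewrite bm.
exists i, (fun k => (b k - (k == i))%N).
have e : b = addv (fun k => (b k - (k == i))%N) i.
  by apply/funext => k; rewrite /addv; case: eqP => [->|_]; rewrite ?subnK// subn0 addn0.
by split => //; have := sum_addv (fun k => (b k - (k == i))%N) i; rewrite -e bm => -[].
Qed.

(** The norm runs over multi-indices, the convexity estimate over pairs of axes; this identifies the
    second orders of the two. *)
Lemma sum2_wpartial2 b u : (\sum_i b i = 2)%N -> exists i j, wderiv Om b u = wpartial2 Om i j u.
Proof.
move=> /sum_gt0_addv[j [b1 [-> /sum_gt0_addv[i [b0 [-> h0]]]]]]; exists i, j.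
rewrite /wpartial2; congr wderiv; apply/funext => k; rewrite /addv.
have -> : b0 k = 0%N.
  by apply/eqP; rewrite -leqn0 -h0 (bigD1 k)//= leq_addr.
by rewrite add0n.
Qed.

End sobolev_norms.

(** * The domain Omega as a box, and the weak derivatives of w on it *)

Section omega.
Context {R : realType} {n : nat} (A B D : R).
Hypotheses (hA : 0 < A) (hAB : A < B) (hD : 0 < D).

Definition lower (i : 'I_n.+1) : R := if i == ord0 then A else - D.
Definition width (i : 'I_n.+1) : R := if i == ord0 then B - A else 2 * D.

Lemma width_gt0 i : 0 < width i.
Proof. by rewrite /width; case: ifP => _; [rewrite subr_gt0|rewrite mulr_gt0]. Qed.

Lemma OmegaE : Omega A B D = grid_box lower width :> set 'rV[R]_n.+1.
Proof.
apply/seteqP; split => x.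
  move=> [h0 h] i; rewrite /= in_itv/= /lower /width; case: eqP => [->|/eqP i0].
    by rewrite addrC subrK.
  by have := h i i0; rewrite ltr_norml (_ : - D + 2 * D = D)//; ring.
move=> h; split; first by have := h ord0; rewrite /= in_itv/= /lower /width eqxx addrC subrK.
move=> i i0; have := h i; rewrite /= in_itv/= /lower /width (negbTE i0) ltr_norml.
by rewrite (_ : - D + 2 * D = D)//; ring.
Qed.

Lemma Omega_coord_le (x : 'rV[R]_n.+1) i : Omega A B D x -> `|x 0 i| <= B + D.
Proof.
move=> [/andP[h1 h2] h]; have [->|i0] := eqVneq i ord0.
  rewrite gtr0_norm; last exact: lt_trans h1.
  by rewrite (le_trans (ltW h2))// lerDl ltW.
by rewrite (le_trans (ltW (h i i0)))// lerDr ltW// (lt_trans hA).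
Qed.

Lemma Omega_bounded (u : 'rV[R]_n.+1 -> R) : continuous u ->
  exists C, forall x, Omega A B D x -> `|u x| <= C.
Proof.
move=> cu; have cK : compact (@cube R n.+1 (B + D)) by apply: rV_compact => i; exact: segment_compact.
have := compact_bounded (continuous_compact (continuous_subspaceT cu) cK).
move=> [C [_ /(_ (Num.max C 0 + 1))]] h; exists (Num.max C 0 + 1) => x Ox.
have m0 : 0 <= Num.max C 0 by rewrite le_max lexx orbT.
apply: h; last first.
  by exists x => // i; rewrite /= in_itv/= -ler_norml; exact: Omega_coord_le.
by rewrite (@le_lt_trans _ _ (Num.max C 0)) ?le_max ?lexx// ltrDl.
Qed.

Section w_weak.
Variable eps : R.
Hypothesis eps_gt0 : 0 < eps.
Local Notation w := (@w R n eps).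
Local Notation Om := (Omega A B D : set 'rV[R]_n.+1).

Lemma measurable_Omega : measurable Om.
Proof. by rewrite OmegaE; exact: measurable_grid_box. Qed.

Lemma Omega_lty : (lebesgue_rv R n.+1 Om < +oo)%E.
Proof. by rewrite OmegaE; apply: grid_box_lty; exact: width_gt0. Qed.

Lemma continuous_w : continuous w.
Proof. by move=> x; exact/differentiable_continuous/differentiable_w. Qed.

Lemma continuous_partial_w i : continuous (partial i w).
Proof. by move=> x; exact/differentiable_continuous/differentiable_partial_w. Qed.

Lemma L2_w : L2 Om w.
Proof.
have [C hC] := Omega_bounded continuous_w.
apply: (L2_bounded measurable_Omega Omega_lty _ hC).
by apply: measurable_funTS; exact: measurable_continuous_rv continuous_w.
Qed.

Lemma L2_partial_w i : L2 Om (partial i w).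
Proof.
have [C hC] := Omega_bounded (@continuous_partial_w i).
apply: (L2_bounded measurable_Omega Omega_lty _ hC).
by apply: measurable_funTS; exact: measurable_continuous_rv (@continuous_partial_w i).
Qed.

Lemma sum_delta (i : 'I_n.+1) : (\sum_k (k == i) = 1)%N.
Proof. by rewrite (bigD1 i)//= eqxx big1// => k /negbTE ->. Qed.

Lemma wderiv1_w i : is_wderiv Om (fun k => (k == i) : nat) w (partial i w).
Proof.
move=> phi tp; rewrite sum_delta expr1 mulN1r.
have -> : mpartial (fun k => (k == i) : nat) phi = partial i phi.
  by rewrite -[RHS](mpartial_iter 1 i phi).
have mO := measurable_Omega; have fO := Omega_lty.
exact: (integration_by_parts_test tp (differentiable_w eps) (@continuous_partial_w i) mO fO
  (Omega_bounded continuous_w) (Omega_bounded (@continuous_partial_w i))).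
Qed.

Lemma wderiv2_w i : is_wderiv Om (fun k => ((k == i) + (k == i))%N) w (cst (- (2 * eps)^-1)).
Proof.
move=> phi tp; rewrite big_split /= sum_delta expr2 mulrNN mulr1 mul1r.
have -> : mpartial (fun k => ((k == i) + (k == i))%N) phi = partial i (partial i phi).
  rewrite -[RHS](mpartial_iter 2 i phi); congr mpartial; apply/funext => k.
  by case: (k == i).
have p2 : partial i (partial i w) = cst (- (2 * eps)^-1).
  by apply/funext => x; exact: partial2_w.
have c2 : continuous (partial i (partial i w)) by rewrite p2 => x; exact: cst_continuous.
have mO := measurable_Omega; have fO := Omega_lty.
rewrite (integration_by_parts_test (test_partial i tp) (differentiable_w eps)
  (@continuous_partial_w i) mO fO (Omega_bounded continuous_w)
  (Omega_bounded (@continuous_partial_w i))).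
rewrite (integration_by_parts_test tp (differentiable_partial_w eps_gt0 i) c2 mO fO
  (Omega_bounded (@continuous_partial_w i)) (Omega_bounded c2)) opprK.
by rewrite p2.
Qed.
End w_weak.
End omega.

(** * The energy estimate at the minimizer *)

Section stability.
Context {R : realType} {n : nat}.
Variables (A B D eps : R) (k : nat) (h : R).
Hypotheses (hA : 0 < A) (hAB : A < B) (hD : 0 < D) (heps : 0 < eps).
Local Notation Om := (Omega A B D : set 'rV[R]_n.+1).
Local Notation mu := (lebesgue_rv R n.+1).
Local Notation d := n.+1.
Local Notation tuple_fun := ('I_k.+1 -> 'rV[R]_n.+1 -> R).
Local Notation w := (@w R n eps).
Implicit Types (b : 'I_n.+1 -> nat) (u v : 'rV[R]_n.+1 -> R) (V W : tuple_fun).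

Let mO : measurable Om := @measurable_Omega R n A B D.
Let fO : (mu Om < +oo)%E := @Omega_lty R n A B D hAB hD.
Let width0 := @width_gt0 R n A B D hAB hD.

Lemma Omega_wderiv_L2 b u : L2 Om (wderiv Om b u).
Proof. by rewrite OmegaE; exact: wderiv_L2. Qed.

Lemma Omega_Hm_wderiv m b u : Hm Om m u -> (\sum_i b i <= m)%N ->
  is_wderiv Om b u (wderiv Om b u).
Proof. by rewrite OmegaE; exact: Hm_wderiv. Qed.

Lemma Omega_wderivB m b u v : (\sum_i b i <= m)%N -> Hm Om m u -> Hm Om m v ->
  {ae mu, forall x, Om x ->
    wderiv Om b (fun x => u x - v x) x = wderiv Om b u x - wderiv Om b v x}.
Proof. by rewrite OmegaE; exact: wderivB. Qed.

(** The order [m_n] is one derivative plus the d/2 + 1 consumed by the embedding, so the gradient is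
    exactly what can be bounded. *)
Lemma Omega_sobolev : exists2 K : R, 0 <= K &
  forall u b rho, (\sum_i b i = 1)%N -> 0 < rho ->
  Hm Om (@m_n n) u -> Hnorm Om (@m_n n) u <= rho ->
  {ae mu, forall x, Om x -> `|wderiv Om b u x| <= K * rho}.
Proof.
exists (sobolev_cst (@width R n A B D) d./2.+1); first exact: sobolev_cst_ge0.
move=> u b rho b1 r0; rewrite OmegaE => Hu ur.
by apply: (sobolev_wderiv width0 _ r0 Hu ur); rewrite b1 /m_n add1n addn2.
Qed.

Lemma measurable_Lop V (i : nat) : (forall j, measurable_fun Om (V j)) ->
  measurable_fun Om (Lop A B D eps h V i).
Proof.
move=> mV; have mW b u : measurable_fun Om (wderiv Om b u) := (Omega_wderiv_L2 b u).1.
have mp l : measurable_fun Om (partial l w) := (L2_partial_w hA hAB hD heps l).1.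
have mL u : measurable_fun Om (wlaplacian Om u).
  by apply: measurable_sum => j; exact: mW.
have mD (u : 'rV[R]_n.+1 -> R) : measurable_fun Om (fun x => wlaplacian Om u x
    + 2 * \sum_l wpartial Om l u x * partial l w x).
  apply: measurable_funD => //; apply: measurable_funM => //.
  by apply: measurable_sum => j; apply: measurable_funM => //; exact: mW.
have mN (u : 'rV[R]_n.+1 -> R) (s : nat -> 'rV[R]_n.+1 -> R) m : measurable_fun Om (fun x => 2 * h *
    \sum_l wpartial Om l u x * \sum_(j < m) wpartial Om l (s j) x).
  apply: measurable_funM => //; apply: measurable_sum => j; apply: measurable_funM; first exact: mW.
  by apply: measurable_sum => j'; exact: mW.
rewrite /Lop; case: (i == 0%N); last case: (i < k)%N.
- apply: measurable_funD; first exact: mD.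
  by apply: measurable_funM => //; exact: measurable_funB.
- apply: measurable_funD.
    by apply: measurable_funD; [exact: mD|exact: (mN _ (fun j => V (inord j)))].
  by apply: measurable_funM => //; exact: measurable_funB.
- apply: measurable_funD.
    by apply: measurable_funD; [exact: mD|exact: (mN _ (fun j => V (inord j)))].
  apply: measurable_funM => //; apply: measurable_funB; last exact: measurable_funM.
  by apply: measurable_funD => //; exact: measurable_funD.
Qed.

Lemma J_exact c lam alpha V : (forall j, measurable_fun Om (V j)) ->
  (forall i : 'I_k.+1, {ae mu, forall x, Om x -> Lop A B D eps h V i x = 0}) ->
  J A B D eps h c lam alpha V = alpha * THnorm Om (@m_n n) V ^+ 2.
Proof.
move=> mV L0; rewrite /J big1 ?mulr0 ?add0r// => i _.
rewrite -[RHS](_ : \int[mu]_(x in Om) (0 : R) = 0); last by rewrite Rintegral_cst// mul0r.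
have mphi : measurable_fun Om (phi_weight lam : 'rV[R]_n.+1 -> R).
  apply: measurable_funTS; apply: measurable_continuous_rv => x.
  have c0 : {for x, continuous (fun y : 'rV[R]_n.+1 => y 0 ord0 : R)} by exact: coord_continuous.
  apply: (@continuous_comp _ _ _ (fun y : 'rV[R]_n.+1 => 2 * lam * (y 0 ord0) ^+ 2) expR).
    exact: (cvgM (@cvg_cst _ (2 * lam) _ (nbhs x) _) (cvgM c0 c0)).
  exact: continuous_expR.
have mL := measurable_Lop i mV.
rewrite /Rintegral; congr fine; apply: ae_eq_integral => //.
  by apply/measurable_EFinP; apply: measurable_funM => //; exact: measurable_funX.
by apply: filterS (L0 i) => x hx Ox; rewrite hx// expr0n mul0r.
Qed.

Lemma J_ge0 c lam alpha V : 0 <= alpha -> 0 <= J A B D eps h c lam alpha V.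
Proof.
move=> a0; rewrite /J addr_ge0 ?mulr_ge0 ?expR_ge0 ?sqrtr_ge0//.
apply: sumr_ge0 => i _; apply: Rintegral_ge0 => x _.
by rewrite mulr_ge0 ?sqr_ge0 ?expR_ge0.
Qed.

(** Here [x] and [y] are the functional at the exact solution and at the minimizer, [z] the pairing
    of the variational inequality, and [b] the regularizing term that is dropped. *)
Lemma energy_arith (a b x y z t : R) :
  a + b <= x - y - - z -> z <= 0 -> 0 <= y -> 0 <= b -> x <= t -> a <= t.
Proof. by lra. Qed.

Lemma term_le_sum3 (I1 I2 I3 : finType) (i : I1) (j : I2) (l : I3) (f : I1 -> I2 -> I3 -> R) :
  (forall i j l, 0 <= f i j l) -> f i j l <= \sum_i \sum_j \sum_l f i j l.
Proof.
move=> f0; rewrite (bigD1 i)//= (bigD1 j)//= (bigD1 l)//= -!addrA lerDl.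
by rewrite !addr_ge0//; do ?[apply: sumr_ge0 => ? _].
Qed.

(* Strong convexity at the minimizer, tested at the exact solution: the
   left-hand side is at most J at the exact solution, which is pure
   regularization. *)
Lemma energy_bound (rho alpha c lam C0 : R) g0 g1 (Vs Vm : tuple_fun) (dJ : tuple_fun -> tuple_fun) :
  0 < alpha -> 0 < C0 -> 1 <= lam ->
  Ball A B D eps h rho g0 g1 Vs -> Ballbar A B D eps h rho g0 g1 Vm ->
  Ballbar A B D eps h rho g0 g1 Vs ->
  (forall i : 'I_k.+1, {ae mu, forall x, Om x -> Lop A B D eps h Vs i x = 0}) ->
  strong_convexity A B D eps h rho alpha c g0 g1 lam C0 dJ ->
  THdot Om (@m_n n) (dJ Vm) (tsub Vm Vs) <= 0 ->
  forall l b, (\sum_i b i <= 2)%N ->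
  \int[mu]_(x in Om) (wderiv Om b (tsub Vs Vm l) x) ^+ 2 <=
  lam * alpha * (expR (- lam * (A ^+ 2 - c))) ^+ 2 * (k.+1%:R * rho ^+ 2 / C0).
Proof.
move=> a0 C00 lam1 [Hs rs _] BVm BVs L0 sc var l b b2.
have Hm' : THm Om (@m_n n) Vm := BVm.1.
have := sc _ _ BVm BVs; cbv zeta.
have -> : THdot Om (@m_n n) (dJ Vm) (tsub Vs Vm) = - THdot Om (@m_n n) (dJ Vm) (tsub Vm Vs).
  by move: Hs Hm'; rewrite OmegaE; exact: THdot_tsubC.
rewrite (@J_exact _ _ _ Vs)//; last by move=> j; exact: (Hs j).1.1.
have J0 : 0 <= J A B D eps h c lam alpha Vm by exact: J_ge0 (ltW a0).
have N1 : THnorm Om (@m_n n) Vs ^+ 2 <= k.+1%:R * rho ^+ 2.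
  rewrite OmegaE THnorm_sqr -OmegaE.
  apply: (@le_trans _ _ (\sum_(i < k.+1) rho ^+ 2)).
    apply: ler_sum => i _; have := rs i => /ltW h1.
    by rewrite lerXn2r ?nnegrE ?sqrtr_ge0// (le_trans _ h1)// sqrtr_ge0.
  by rewrite sumr_const card_ord mulr_natl.
set Q := tsub Vs Vm; set S2 := \sum_i _; set N2 := THnorm Om 1 Q ^+ 2.
set E := expR _; set F := expR (- lam * _).
have FE : F ^+ 2 * E = 1.
  by rewrite /F /E -expRM_natl -expRD (_ : _ + _ = 0) ?expR0//; ring.
have E0 : 0 < E by exact: expR_gt0.
have F0 : 0 < F by exact: expR_gt0.
have lam0 : 0 < lam by exact: lt_le_trans lam1.
have S20 : 0 <= S2 by apply: sumr_ge0 => i _; apply: sumr_ge0 => j _; apply: sumr_ge0 => l' _; exact: sqr_ge0.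
have N20 : 0 <= N2 by exact: sqr_ge0.
have Nm0 : 0 <= alpha * THnorm Om (@m_n n) Q ^+ 2 by rewrite mulr_ge0 ?sqr_ge0// ltW.
set s := \int[mu]_(x in Om) _.
(* Orders 0 and 1 are covered by the H^1 norm, order 2 by the sum of second derivatives. *)
have sle : s <= S2 + N2.
  have [b1|b1] := leqP (\sum_i b i) 1.
    apply: (@le_trans _ _ N2); last by rewrite lerDr.
    apply: (@le_trans _ _ (Hnorm Om 1 (Q l) ^+ 2)).
      by rewrite /s OmegaE; exact: sqnorm_le_Hnorm.
    rewrite /N2 OmegaE.
    by rewrite lerXn2r ?nnegrE ?sqrtr_ge0//; exact: Hnorm_le_THnorm.
  have {}b2 : (\sum_i b i = 2)%N by apply/eqP; rewrite eqn_leq b2.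
  apply: (@le_trans _ _ S2); last by rewrite lerDl.
  rewrite /s; have [i [j e]] : exists i j, wderiv Om b (Q l) = wpartial2 Om i j (Q l).
    by rewrite OmegaE; exact: sum2_wpartial2.
  apply: (le_trans _ (term_le_sum3 i j l (fun i j l => sqr_ge0 (L2norm Om (wpartial2 Om i j (Q l)))))).
  by rewrite -e sqr_sqrtr//; apply: Rintegral_ge0 => x _; exact: sqr_ge0.
move=> main.
have h1 : C0 * (E / lam) * S2 + C0 * E * N2 <= alpha * (k.+1%:R * rho ^+ 2).
  have : alpha * THnorm Om (@m_n n) Vs ^+ 2 <= alpha * (k.+1%:R * rho ^+ 2) by rewrite ler_pM2l.
  exact: (energy_arith main var J0 Nm0).
(* As lam >= 1, both terms are bounded below with the smaller coefficient [E / lam]; its inverse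
   puts lam into the bound, and [E] is the inverse of [F ^+ 2]. *)
have h2 : C0 * (E / lam) * (S2 + N2) <= alpha * (k.+1%:R * rho ^+ 2).
  apply: le_trans h1; rewrite mulrDr lerD2l ler_wpM2r// ler_wpM2l ?(ltW C00)//.
  by rewrite ler_pdivrMr// ler_peMr// ltW.
apply: (le_trans sle).
have c0 : 0 < C0 * (E / lam) by rewrite mulr_gt0// divr_gt0.
rewrite -(ler_pM2l c0); apply: (le_trans h2); rewrite le_eqVlt; apply/orP; left; apply/eqP.
rewrite [RHS](_ : _ = (F ^+ 2 * E) * (alpha * (k.+1%:R * rho ^+ 2))).
  by rewrite FE mul1r.
by field; rewrite !gt_eqF.
Qed.
End stability.

(** * Pointwise Lipschitz bound for the reconstructed coefficient *)

Section reconstruction.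
Context {R : realType}.

Lemma norm_sum_le (m N : nat) (S : R) (f : 'I_m -> R) : (m <= N)%N -> 0 <= S ->
  (forall i, `|f i| <= S) -> `|\sum_i f i| <= N%:R * S.
Proof.
move=> mN S0 fS; apply: (le_trans (ler_norm_sum _ _ _)).
apply: (@le_trans _ _ (\sum_(i < m) S)); first exact: ler_sum.
by rewrite sumr_const card_ord -[S *+ m]mulr_natl ler_wpM2r// ler_nat.
Qed.

Variables (n : nat) (A B D eps : R) (k : nat) (h : R).
Hypotheses (hh : 0 < h) (hk : (0 < k)%N).
Local Notation d := n.+1.

(** [k%:R * h] is T - eps. The summands bound the differences of w_V at the last time, of the
    Laplacians and of the squared gradients, where [M] bounds the first derivatives of the
    components and [W] those of w. *)
Definition aV_lip (M W : R) : R := (k%:R * h)^-1 *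
  (h * k.+1%:R + k.+1%:R * (d%:R * (h * k.+1%:R) +
     d%:R * (h * k.+1%:R * (h * (k.+1%:R * (2 * M)) + 2 * W)))).

Lemma aV_lip_ge0 M W : 0 <= M -> 0 <= W -> 0 <= aV_lip M W.
Proof. by move=> M0 W0; rewrite /aV_lip !(mulr_ge0, addr_ge0, invr_ge0, ltW hh). Qed.

(** At a fixed point the derivatives are mere numbers, so everything that holds almost everywhere
    stays outside. The contributions of w cancel except in the squared gradients, where the
    difference a^2 - b^2 = (a - b) (a + b) keeps [2 * om l] in the second factor. *)
Lemma aV_diff_le (V V' : 'I_k.+1 -> 'rV[R]_d -> R) x (S M W : R) (om ka : 'I_d -> R)
  (p p' q q' : 'I_d -> 'I_k.+1 -> R) : 0 <= S -> 0 <= M -> 0 <= W ->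
  (forall j, `|V j x - V' j x| <= S) ->
  (forall l j, `|p l j - p' l j| <= S) -> (forall l j, `|q l j - q' l j| <= S) ->
  (forall l j, `|p l j| <= M) -> (forall l j, `|p' l j| <= M) -> (forall l, `|om l| <= W) ->
  (forall l (i : 'I_k.+1), wpartial (Omega A B D) l (wV eps h V i) x =
     h * \sum_(j < i.+1) p l (inord j) + om l) ->
  (forall l (i : 'I_k.+1), wpartial (Omega A B D) l (wV eps h V' i) x =
     h * \sum_(j < i.+1) p' l (inord j) + om l) ->
  (forall l (i : 'I_k.+1), wpartial2 (Omega A B D) l l (wV eps h V i) x =
     h * \sum_(j < i.+1) q l (inord j) + ka l) ->
  (forall l (i : 'I_k.+1), wpartial2 (Omega A B D) l l (wV eps h V' i) x =
     h * \sum_(j < i.+1) q' l (inord j) + ka l) ->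
  `|aV A B D eps h V x - aV A B D eps h V' x| <= aV_lip M W * S.
Proof.
move=> S0 M0 W0 vS pS qS pM p'M omW pE p'E qE q'E.
have sub m (f g : 'I_k.+1 -> R) : (m <= k.+1)%N -> (forall j, `|f j - g j| <= S) ->
    `|h * \sum_(j < m) f (inord j) - h * \sum_(j < m) g (inord j)| <= h * k.+1%:R * S.
  move=> mk fg; rewrite -mulrBr -sumrB normrM gtr0_norm// -mulrA ler_pM2l//.
  exact: norm_sum_le.
have T : time eps h k - eps = k%:R * h by rewrite /time addrC addKr.
have kh : 0 < k%:R * h by rewrite mulr_gt0// ltr0n.
rewrite /aV T.
set s := \sum_(i < k.+1) _; set s' := \sum_(i < k.+1) _.
rewrite (_ : _ - _ = (k%:R * h)^-1 * ((h * \sum_(j < k.+1) V (inord j) x -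
   h * \sum_(j < k.+1) V' (inord j) x) - (s - s'))); last by rewrite /wV; ring.
rewrite normrM (gtr0_norm (x := _^-1)) ?invr_gt0// /aV_lip -[leRHS]mulrA ler_pM2l ?invr_gt0//.
apply: (le_trans (ler_normB _ _)); rewrite mulrDl lerD//.
  exact: (sub _ (fun j => V j x) (fun j => V' j x)).
rewrite /s /s' -sumrB -mulrA; apply: norm_sum_le => //.
  by rewrite !(mulr_ge0, addr_ge0, ltW hh).
move=> i.
set L := wlaplacian _ _ _; set L' := wlaplacian _ _ _.
set G := \sum_l _; set G' := \sum_l _.
rewrite (_ : L + G - (L' + G') = (L - L') + (G - G')); last by ring.
apply: (le_trans (ler_normD _ _)); rewrite mulrDl lerD//.
  rewrite /L /L' /wlaplacian -sumrB -mulrA; apply: norm_sum_le => //.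
    by rewrite !(mulr_ge0, ltW hh).
  move=> l; rewrite qE q'E [X in `|X|](_ : _ = h * \sum_(j < i.+1) q l (inord j) -
    h * \sum_(j < i.+1) q' l (inord j)); last by ring.
  exact: sub.
rewrite /G /G' -sumrB -[leRHS]mulrA; apply: norm_sum_le => //.
  by rewrite !(mulr_ge0, addr_ge0, ltW hh).
move=> l; rewrite pE p'E.
rewrite [X in `|X|](_ : _ = (h * \sum_(j < i.+1) p l (inord j) -
    h * \sum_(j < i.+1) p' l (inord j)) *
  (h * \sum_(j < i.+1) (p l (inord j) + p' l (inord j)) + 2 * om l)); last by rewrite big_split/=; ring.
rewrite normrM mulrAC ler_pM//; first exact: sub.
apply: (le_trans (ler_normD _ _)); rewrite lerD// normrM gtr0_norm// ler_pM2l//.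
apply: norm_sum_le => //; first by rewrite mulr_ge0.
move=> j; apply: (le_trans (ler_normD _ _)); rewrite mulr_natl mulr2n lerD//.
Qed.
End reconstruction.

(** * From almost everywhere bounds to bounds in L2 *)

Section L2_ae.
Context {R : realType} {d : nat} (Om : set 'rV[R]_d).
Hypothesis mO : measurable Om.
Local Notation mu := (lebesgue_rv R d).
Implicit Types u v : 'rV[R]_d -> R.

Lemma L2_ae_le u v (C : R) : measurable_fun Om u -> L2 Om v -> 0 <= C ->
  {ae mu, forall x, Om x -> `|u x| <= C * v x} ->
  L2 Om u /\ \int[mu]_(x in Om) (u x) ^+ 2 <= C ^+ 2 * \int[mu]_(x in Om) (v x) ^+ 2.
Proof.
move=> mu_ Lv C0 uv.
have mX (f : 'rV[R]_d -> R) : measurable_fun Om f -> measurable_fun Om (fun x => ((f x) ^+ 2)%:E).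
  by move=> mf; apply/measurable_EFinP; exact: measurable_funX.
have LCv := L2Z mO C Lv.
have le : (\int[mu]_(x in Om) ((u x) ^+ 2)%:E <= \int[mu]_(x in Om) ((C * v x) ^+ 2)%:E)%E.
  apply: ae_ge0_le_integral => //.
  - by move=> x _; rewrite lee_fin sqr_ge0.
  - exact: mX.
  - by move=> x _; rewrite lee_fin sqr_ge0.
  - exact: mX LCv.1.
  apply: filterS uv => x h Ox; rewrite lee_fin -[u x ^+ 2]ger0_norm ?sqr_ge0// normrX.
  by rewrite lerXn2r ?nnegrE ?h// (le_trans _ (h Ox)).
have Lu : L2 Om u by split => //; exact: le_lt_trans LCv.2.
split => //; rewrite -RintegralZl//; last exact: L2_sqr_integrable.
under [leRHS]eq_Rintegral do rewrite -exprMn.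
rewrite /Rintegral fine_le// ?ge0_fin_numE ?Lu.2 ?LCv.2//;
  by apply: integral_ge0 => x _; rewrite lee_fin sqr_ge0.
Qed.

(** This gives one square integrable majorant for all derivatives of all components at once, the [S]
    of the pointwise Lipschitz bound. *)
Lemma L2_sqrt_sum (I : finType) (u : I -> 'rV[R]_d -> R) (X : R) :
  (forall i, L2 Om (u i)) -> (forall i, \int[mu]_(x in Om) (u i x) ^+ 2 <= X) ->
  [/\ L2 Om (fun x => Num.sqrt (\sum_i (u i x) ^+ 2)),
      \int[mu]_(x in Om) (Num.sqrt (\sum_i (u i x) ^+ 2)) ^+ 2 <= #|I|%:R * X &
      forall i x, `|u i x| <= Num.sqrt (\sum_i (u i x) ^+ 2)].
Proof.
move=> Lu uX.
have s0 x : 0 <= \sum_i (u i x) ^+ 2 by apply: sumr_ge0 => i _; exact: sqr_ge0.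
have E : (fun x => Num.sqrt (\sum_i (u i x) ^+ 2) ^+ 2) = (fun x => \sum_i (u i x) ^+ 2).
  by apply/funext => x; rewrite sqr_sqrtr.
have iu i := L2_sqr_integrable (Lu i).
split.
- apply: L2P.
    apply: measurableT_comp; first exact: (continuous_measurable_fun (@sqrt_continuous R)).
    by apply: measurable_sum => i; apply: measurable_funX; exact: (Lu i).1.
  rewrite (_ : (fun x => _) = EFin \o (fun x => Num.sqrt (\sum_i (u i x) ^+ 2) ^+ 2))// E.
  rewrite (_ : _ \o _ = fun x => (\sum_i ((u i x) ^+ 2)%:E)%E).
    exact: integrable_sum.
  by apply/funext => x; rewrite /= sumEFin.
- rewrite E Rintegral_sum//.
  apply: (@le_trans _ _ (\sum_(i : I) X)); first exact: ler_sum.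
  by rewrite sumr_const -[X *+ _]mulr_natl.
- move=> i x; rewrite -sqrtr_sqr ler_wsqrtr// (bigD1 i)//= lerDl.
  by apply: sumr_ge0 => j _; exact: sqr_ge0.
Qed.
End L2_ae.

(** * The Lipschitz bound almost everywhere *)

Section stability_ae.
Context {R : realType} {n : nat}.
Variables (A B D eps : R) (k : nat) (h : R).
Hypotheses (hA : 0 < A) (hAB : A < B) (hD : 0 < D) (heps : 0 < eps) (hk : (0 < k)%N) (hh : 0 < h).
Local Notation Om := (Omega A B D : set 'rV[R]_n.+1).
Local Notation mu := (lebesgue_rv R n.+1).
Local Notation d := n.+1.
Local Notation tuple_fun := ('I_k.+1 -> 'rV[R]_n.+1 -> R).
Local Notation w := (@w R n eps).
Implicit Types (b : 'I_n.+1 -> nat) (u v : 'rV[R]_n.+1 -> R) (V W : tuple_fun).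

Let mO : measurable Om := @measurable_Omega R n A B D.
Let fO : (mu Om < +oo)%E := @Omega_lty R n A B D hAB hD.
Let width0 := @width_gt0 R n A B D hAB hD.

(** The right-hand side is a weak derivative by linearity, hence agrees with the chosen one by
    uniqueness. *)
Lemma wderiv_wV b m g V (i : nat) : (\sum_i b i <= m)%N -> L2 Om g -> is_wderiv Om b w g ->
  THm Om m V -> {ae mu, forall x, Om x ->
    wderiv Om b (wV eps h V i) x = h * \sum_(j < i.+1) wderiv Om b (V (inord j)) x + g x}.
Proof.
move=> bm Lg wg HV.
have Lw : L2 Om w by exact: L2_w.
have LV (j : 'I_i.+1) : L2 Om (V (inord j)) := (HV _).1.
have Ld (j : 'I_i.+1) : L2 Om (wderiv Om b (V (inord j))) by exact: Omega_wderiv_L2.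
have wd (j : 'I_i.+1) : is_wderiv Om b (V (inord j)) (wderiv Om b (V (inord j))).
  exact: Omega_Hm_wderiv (HV _) bm.
move: Lw LV Ld wd Lg wg; rewrite OmegaE => Lw LV Ld wd Lg wg.
have [L1 L2' w3] := is_wderiv_sum width0 (index_enum 'I_i.+1) LV Ld wd.
have w4 := is_wderiv_lin width0 h Lw L1 Lg L2' wg w3.
have L5 := L2D (measurable_grid_box _ _) Lg (L2Z (measurable_grid_box _ _) h L2').
have eV : wV eps h V i = fun x => w x + h * \sum_(j < i.+1) V (inord j) x.
  by apply/funext => x; rewrite /wV addrC.
have w6 := wderivP (ex_intro _ _ (conj L5 w4)).
have e6 := is_wderiv_unique width0 (wderiv_L2 _ width0 b _) L5 w6 w4.
rewrite eV; apply: filterS e6 => x e Ox.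
by rewrite e// addrC.
Qed.

Lemma measurable_aV V : (forall j, measurable_fun Om (V j)) -> measurable_fun Om (aV A B D eps h V).
Proof.
move=> mV; have mW b u : measurable_fun Om (wderiv Om b u) := (Omega_wderiv_L2 hAB hD b u).1.
have mwV i : measurable_fun Om (wV eps h V i).
  apply: measurable_funD; last exact: (L2_w hA hAB hD eps).1.
  by apply: measurable_funM => //; exact: measurable_sum.
have mwd i l : measurable_fun Om (wpartial Om l (wV eps h V i)) by exact: mW.
apply: measurable_funB; apply: measurable_funM => //.
  by apply: measurable_funB => //; exact: (L2_w hA hAB hD eps).1.
apply: measurable_sum => i; apply: measurable_funD; apply: measurable_sum => l.
  exact: mW.
exact: measurable_funX.
Qed.

(* The bound on the gradients makes the quadratic term Lipschitz. *)
Lemma aV_diff_ae V V' m (S : 'rV[R]_n.+1 -> R) (M : R) : (2 <= m)%N -> THm Om m V -> THm Om m V' ->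
  0 <= M -> (forall x, 0 <= S x) ->
  (forall j b, (\sum_i b i <= 2)%N ->
    {ae mu, forall x, Om x -> `|wderiv Om b (V j) x - wderiv Om b (V' j) x| <= S x}) ->
  (forall j b, (\sum_i b i = 1)%N -> {ae mu, forall x, Om x -> `|wderiv Om b (V j) x| <= M}) ->
  (forall j b, (\sum_i b i = 1)%N -> {ae mu, forall x, Om x -> `|wderiv Om b (V' j) x| <= M}) ->
  {ae mu, forall x, Om x -> `|aV A B D eps h V x - aV A B D eps h V' x| <=
     aV_lip n k h M ((B + D) / (2 * eps)) * S x}.
Proof.
move=> m2 HV HV' M0 S0 dS dM dM'.
pose e1 l : 'I_d -> nat := fun j => (j == l) : nat.
pose e2 l : 'I_d -> nat := fun j => ((j == l) + (j == l))%N.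
have s1 l : (\sum_i e1 l i = 1)%N by exact: sum_delta.
have s2 l : (\sum_i e2 l i = 2)%N by rewrite big_split/= sum_delta.
have W0 : 0 <= (B + D) / (2 * eps).
  by rewrite divr_ge0 ?mulr_ge0 ?addr_ge0 ?(ltW hD) ?(ltW heps)// ltW// (lt_trans hA).
have v0 j : {ae mu, forall x, Om x -> `|V j x - V' j x| <= S x}.
  have z : (\sum_(i < d) 0 = 0)%N by rewrite big1.
  have := dS j (fun=> 0%N); rewrite z => /(_ isT).
  have LV := (HV j).1; have LV' := (HV' j).1.
  have a1 : {ae mu, forall x, Om x -> wderiv Om (fun=> 0%N) (V j) x = V j x}.
    by move: LV; rewrite OmegaE => LV; exact: wderiv0.
  have a2 : {ae mu, forall x, Om x -> wderiv Om (fun=> 0%N) (V' j) x = V' j x}.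
    by move: LV'; rewrite OmegaE => LV'; exact: wderiv0.
  move=> a3; near=> x => Ox.
  have <- : wderiv Om (fun=> 0%N) (V j) x = V j x by move: Ox; near: x.
  have <- : wderiv Om (fun=> 0%N) (V' j) x = V' j x by move: Ox; near: x.
  by move: Ox; near: x.
(* There are finitely many axes and components, so one exceptional null set serves them all. *)
have wE1 V0 : THm Om m V0 -> {ae mu, forall x, forall (l : 'I_d) (i : 'I_k.+1), Om x ->
    wpartial Om l (wV eps h V0 i) x = h * \sum_(j < i.+1) wderiv Om (e1 l) (V0 (inord j)) x + partial l w x}.
  move=> H0'; apply: filter_forall => l; apply: filter_forall => i.
  apply: (@wderiv_wV (e1 l) m) => //; first by rewrite s1 (leq_trans _ m2).
    exact: L2_partial_w.
  exact: wderiv1_w.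
have wE2 V0 : THm Om m V0 -> {ae mu, forall x, forall (l : 'I_d) (i : 'I_k.+1), Om x ->
    wpartial2 Om l l (wV eps h V0 i) x = h * \sum_(j < i.+1) wderiv Om (e2 l) (V0 (inord j)) x + (- (2 * eps)^-1)}.
  move=> H0'; apply: filter_forall => l; apply: filter_forall => i.
  apply: (@wderiv_wV (e2 l) m (cst (- (2 * eps)^-1))) => //; first by rewrite s2.
    exact: L2_cst.
  exact: wderiv2_w.
have {}v0 : {ae mu, forall x, forall j, Om x -> `|V j x - V' j x| <= S x} by exact: filter_forall.
have d1 : {ae mu, forall x, forall l j, Om x ->
    `|wderiv Om (e1 l) (V j) x - wderiv Om (e1 l) (V' j) x| <= S x}.
  by apply: filter_forall => l; apply: filter_forall => j; apply: dS; rewrite s1.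
have d2 : {ae mu, forall x, forall l j, Om x ->
    `|wderiv Om (e2 l) (V j) x - wderiv Om (e2 l) (V' j) x| <= S x}.
  by apply: filter_forall => l; apply: filter_forall => j; apply: dS; rewrite s2.
have b1 : {ae mu, forall x, forall l j, Om x -> `|wderiv Om (e1 l) (V j) x| <= M}.
  by apply: filter_forall => l; apply: filter_forall => j; apply: dM; rewrite s1.
have b2 : {ae mu, forall x, forall l j, Om x -> `|wderiv Om (e1 l) (V' j) x| <= M}.
  by apply: filter_forall => l; apply: filter_forall => j; apply: dM'; rewrite s1.
have w1 := wE1 V HV; have w1' := wE1 V' HV'; have w2 := wE2 V HV; have w2' := wE2 V' HV'.
near=> x => Ox.
apply: (aV_diff_le hh hk (om := fun l => partial l w x) (ka := fun=> - (2 * eps)^-1)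
  (p := fun l j => wderiv Om (e1 l) (V j) x) (p' := fun l j => wderiv Om (e1 l) (V' j) x)
  (q := fun l j => wderiv Om (e2 l) (V j) x) (q' := fun l j => wderiv Om (e2 l) (V' j) x)
  (S0 x) M0 W0).
- by move=> j; apply: (near v0 x _ j Ox).
- by move=> l j; apply: (near d1 x _ l j Ox).
- by move=> l j; apply: (near d2 x _ l j Ox).
- by move=> l j; apply: (near b1 x _ l j Ox).
- by move=> l j; apply: (near b2 x _ l j Ox).
- move=> l; rewrite partial_w// normrM normrN normfV (gtr0_norm (x := 2 * eps)) ?mulr_gt0//.
  by rewrite ler_pM2r ?invr_gt0 ?mulr_gt0//; exact: (Omega_coord_le hA hAB hD).
- by move=> l i; apply: (near w1 x _ l i Ox).
- by move=> l i; apply: (near w1' x _ l i Ox).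
- by move=> l i; apply: (near w2 x _ l i Ox).
- by move=> l i; apply: (near w2' x _ l i Ox).
Unshelve. all: by end_near.
Qed.
End stability_ae.

(** * Gradient bounds on the closed ball, and stability in norm *)

Section stability_bounds.
Context {R : realType} {n : nat}.
Variables (A B D eps : R) (k : nat) (h : R).
Hypotheses (hA : 0 < A) (hAB : A < B) (hD : 0 < D) (heps : 0 < eps) (hk : (0 < k)%N) (hh : 0 < h).
Local Notation Om := (Omega A B D : set 'rV[R]_n.+1).
Local Notation mu := (lebesgue_rv R n.+1).
Local Notation d := n.+1.
Local Notation tuple_fun := ('I_k.+1 -> 'rV[R]_n.+1 -> R).
Local Notation w := (@w R n eps).
Implicit Types (b : 'I_n.+1 -> nat) (u v : 'rV[R]_n.+1 -> R) (V W : tuple_fun).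

Let mO : measurable Om := @measurable_Omega R n A B D.
Let fO : (mu Om < +oo)%E := @Omega_lty R n A B D hAB hD.
Let width0 := @width_gt0 R n A B D hAB hD.

(** The derivative chosen for the zero function is only almost everywhere 0. This makes every
    element of the ball an approximation of itself in the closure. *)
Lemma THnorm_tsubxx m V : THnorm Om m (tsub V V) = 0.
Proof.
rewrite /THnorm big1 ?sqrtr0// => i _.
have z b : {ae mu, forall x, Om x -> wderiv Om b (tsub V V i) x = 0}.
  have -> : tsub V V i = cst 0 by apply/funext => x; rewrite /tsub subrr.
  have L0 : L2 Om (cst 0) by exact: L2_cst.
  move: L0; rewrite OmegaE => L0; have w0 := @is_wderiv_cst0 R _ (lower A D) (width A B D) b.
  exact: (is_wderiv_unique width0 (wderiv_L2 _ width0 b _) L0 (wderivP (ex_intro _ _ (conj L0 w0))) w0).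
rewrite /Hnorm /Hdot big1 ?sqrtr0 ?expr0n// => b _.
rewrite -[RHS](_ : \int[mu]_(x in Om) (0 : R) = 0); last by rewrite Rintegral_cst// mul0r.
have mW : measurable_fun Om (wderiv Om (fun i => b i) (tsub V V i)) by exact: (Omega_wderiv_L2 hAB hD _ _).1.
rewrite /Rintegral; congr fine; apply: ae_eq_integral => //.
  by apply/measurable_EFinP; exact: measurable_funM.
by apply: filterS (z (fun i => b i)) => x hx Ox; rewrite hx// mulr0.
Qed.

Lemma Ball_Ballbar rho g0 g1 V :
  Ball A B D eps h rho g0 g1 V -> Ballbar A B D eps h rho g0 g1 V.
Proof.
by move=> BV; split => [|e e0]; [case: BV|exists V => //; rewrite THnorm_tsubxx].
Qed.

(** The closure is defined by approximation: an element of the ball at distance less than [rho] is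
    chosen, and the embedding applied to it and to the difference gives the factor 2. *)
Lemma Ballbar_gradient_bound : exists2 K : R, 0 <= K &
  forall rho g0 g1 V, 0 < rho -> Ballbar A B D eps h rho g0 g1 V ->
  forall j b, (\sum_i b i = 1)%N ->
  {ae mu, forall x, Om x -> `|wderiv Om b (V j) x| <= K * rho}.
Proof.
have [K K0 KP] := @Omega_sobolev R n A B D hAB hD.
exists (2 * K) => [|rho g0 g1 V r0 [HV /(_ _ r0)[W [HW rW _] VW]] j b b1]; first by rewrite mulr_ge0.
have Hd : Hm Om (@m_n n) (fun x => V j x - W j x).
  by move: (HV j) (HW j); rewrite OmegaE => HVj HWj; exact: HmB.
have nd : Hnorm Om (@m_n n) (fun x => V j x - W j x) <= rho.
  apply: le_trans (ltW VW); rewrite OmegaE; exact: (Hnorm_le_THnorm _ _ _ (tsub V W)).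
have h1 := KP _ _ _ b1 r0 Hd nd.
have h2 := KP _ _ _ b1 r0 (HW j) (ltW (rW j)).
have h3 : {ae mu, forall x, Om x ->
    wderiv Om b (fun x => V j x - W j x) x = wderiv Om b (V j) x - wderiv Om b (W j) x}.
  by apply: (Omega_wderivB hAB hD (m := @m_n n)) => //; rewrite b1 /m_n addn2.
near=> x => Ox.
rewrite (_ : wderiv Om b (V j) x = wderiv Om b (fun x => V j x - W j x) x + wderiv Om b (W j) x); last first.
  by rewrite (near h3 x _ Ox)// subrK.
apply: (le_trans (ler_normD _ _)); rewrite -mulrA mulr_natl mulr2n; apply: lerD.
  exact: (near h1 x _ Ox).
exact: (near h2 x _ Ox).
Unshelve. all: by end_near.
Qed.

Lemma sqnorm_tsubC m V V' l b : (\sum_i b i <= m)%N -> THm Om m V -> THm Om m V' ->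
  \int[mu]_(x in Om) (wderiv Om b (tsub V V' l) x) ^+ 2 =
  \int[mu]_(x in Om) (wderiv Om b (tsub V' V l) x) ^+ 2.
Proof.
move=> bm HV HV'.
have mW u : measurable_fun Om (wderiv Om b u) := (Omega_wderiv_L2 hAB hD b u).1.
have h1 := Omega_wderivB hAB hD bm (HV l) (HV' l).
have h2 := Omega_wderivB hAB hD bm (HV' l) (HV l).
have h3 : {ae mu, forall x, Om x ->
    (wderiv Om b (tsub V V' l) x) ^+ 2 = (wderiv Om b (tsub V' V l) x) ^+ 2}.
  by apply: filterS2 h1 h2 => x h1 h2 Ox; rewrite /tsub h1// h2//; ring.
have m1 := measurable_funX 2 (mW (tsub V V' l)).
have m2 := measurable_funX 2 (mW (tsub V' V l)).
by move: h3 m1 m2; rewrite OmegaE => h3 m1 m2; exact: Rintegral_ae_eq m1 m2 h3.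
Qed.

Local Notation index := ('I_k.+1 * {ffun 'I_d -> 'I_3})%type.

Lemma stability_of_derivatives V V' m M X : (2 <= m)%N -> THm Om m V -> THm Om m V' -> 0 <= M -> 0 <= X ->
  (forall j b, (\sum_i b i = 1)%N -> {ae mu, forall x, Om x -> `|wderiv Om b (V j) x| <= M}) ->
  (forall j b, (\sum_i b i = 1)%N -> {ae mu, forall x, Om x -> `|wderiv Om b (V' j) x| <= M}) ->
  (forall l b, (\sum_i b i <= 2)%N -> \int[mu]_(x in Om) (wderiv Om b (tsub V V' l) x) ^+ 2 <= X) ->
  let da x := aV A B D eps h V x - aV A B D eps h V' x in
  [/\ THnorm Om 2 (tsub V V') <= Num.sqrt (#|{: index}|%:R * X), L2 Om da &
      L2norm Om da <= aV_lip n k h M ((B + D) / (2 * eps)) * Num.sqrt (#|{: index}|%:R * X)].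
Proof.
move=> m2 HV HV' M0 X0 dM dM' dX da.
have W0 : 0 <= (B + D) / (2 * eps).
  by rewrite divr_ge0 ?mulr_ge0 ?addr_ge0 ?(ltW hD) ?(ltW heps)// ltW// (lt_trans hA).
(* Entries at most 2 also allow multi-indices of order above 2; these contribute the zero function,
   so that the index type is a plain product. *)
pose u (p : index) : 'rV[R]_d -> R :=
  if (\sum_i p.2 i <= 2)%N then wderiv Om (fun i => p.2 i) (tsub V V' p.1) else cst 0.
have Lu p : L2 Om (u p).
  by rewrite /u; case: ifP => _; [exact: Omega_wderiv_L2|exact: L2_cst].
have uX p : \int[mu]_(x in Om) (u p x) ^+ 2 <= X.
  rewrite /u; case: ifP => [|_]; first exact: dX.
  by under eq_Rintegral do rewrite /cst expr0n; rewrite Rintegral_cst// mul0r.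
have [LS iS uS] := L2_sqrt_sum mO Lu uX.
set S := (fun x => Num.sqrt (\sum_i (u i x) ^+ 2)) in LS iS uS.
have S0 x : 0 <= S x by exact: sqrtr_ge0.
have dS j b : (\sum_i b i <= 2)%N ->
    {ae mu, forall x, Om x -> `|wderiv Om b (V j) x - wderiv Om b (V' j) x| <= S x}.
  move=> b2; pose b' : {ffun 'I_d -> 'I_3} := [ffun i => inord (b i)].
  have b'E : (fun i => b' i : nat) = b.
    apply/funext => i; rewrite ffunE inordK// ltnS; apply: leq_trans b2.
    by rewrite (bigD1 i)//= leq_addr.
  have := Omega_wderivB hAB hD (leq_trans b2 m2) (HV j) (HV' j).
  apply: filterS => x e Ox; rewrite -e//; have := uS (j, b') x.
  by rewrite /u/= b'E (eq_bigr b) ?b2// => i _; rewrite -[in RHS]b'E.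
have [Lda ida] : L2 Om da /\ \int[mu]_(x in Om) (da x) ^+ 2 <=
    aV_lip n k h M ((B + D) / (2 * eps)) ^+ 2 * \int[mu]_(x in Om) (S x) ^+ 2.
  apply: (L2_ae_le mO) => //.
  - apply: measurable_funB; apply: (measurable_aV eps h hA hAB hD) => j; first exact: (HV j).1.1.
    exact: (HV' j).1.1.
  - exact: aV_lip_ge0.
  - exact: (aV_diff_ae hA hAB hD heps hk hh m2).
split=> //.
- rewrite -[leLHS]ger0_norm ?sqrtr_ge0// -sqrtr_sqr ler_wsqrtr//.
  rewrite OmegaE THnorm_sqr -OmegaE card_prod natrM -mulrA mulr_natl.
  rewrite -[X in _ <= _ *+ X]/(#|{: 'I_k.+1}|) -sumr_const; apply: ler_sum => l _.
  rewrite OmegaE Hnorm_sqr Hdot_sqnorm mulr_natl -sumr_const big_mkcond/=.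
  apply: ler_sum => b _; case: ifP => // bb.
  by rewrite /sqnorm -OmegaE; exact: dX.
- have a0 : 0 <= aV_lip n k h M ((B + D) / (2 * eps)) by exact: aV_lip_ge0.
  rewrite -(ger0_norm a0) -sqrtr_sqr -sqrtrM ?sqr_ge0// ler_wsqrtr//.
  by apply: (le_trans ida); rewrite ler_wpM2l ?sqr_ge0.
Qed.
End stability_bounds.

Theorem theorem5p3 (R : realType) (n : nat) (A B D eps h0 : R) (k : nat)
    (h rho alpha C0 : R)
    (hA : 0 < A) (hAB : A < B) (hD : 0 < D) (heps : 0 < eps)
    (hh0 : 0 < h0 < 1) (hk : (3 <= k)%N) (hh : h0 <= h)
    (hrho : 0 < rho) (halpha : 0 < alpha < 1) (hC0 : 0 < C0) :
  exists2 C1 : R, 0 < C1 &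
    forall (c lam1 : R) (g0 g1 : 'rV[R]_n.+1 -> R -> R)
      (Vstar : 'I_k.+1 -> 'rV[R]_n.+1 -> R),
    0 < c ->
    convexity_threshold A B D eps k h rho alpha c g0 g1 lam1 C0 ->
    Ball A B D eps h rho g0 g1 Vstar ->
    (forall i : 'I_k.+1, {ae lebesgue_rv R n.+1, forall x,
       Omega A B D x -> Lop A B D eps h Vstar i x = 0}) ->
    forall (lam : R) (Vmin : 'I_k.+1 -> 'rV[R]_n.+1 -> R),
    lam1 <= lam ->
    is_minimizer A B D eps h rho alpha c g0 g1 lam Vmin ->
    let bound := C1 * Num.sqrt (lam * alpha) * expR (- lam * (A ^+ 2 - c)) in
    let da x := aV A B D eps h Vmin x - aV A B D eps h Vstar x in
    [/\ THnorm (Omega A B D) 2 (tsub Vmin Vstar) <= bound,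
        L2 (Omega A B D) da &
        L2norm (Omega A B D) da <= bound].

Proof.
have k0 : (0 < k)%N by exact: leq_trans hk.
have h_gt0 : 0 < h by case/andP: hh0 => h00 _; exact: lt_le_trans hh.
have a0 : 0 < alpha by case/andP: halpha.
have [K K0 KP] := @Ballbar_gradient_bound R n A B D eps k h hAB hD.
set index := ('I_k.+1 * {ffun 'I_n.+1 -> 'I_3})%type.
(* The k + 1 components of norm below [rho], divided by the convexity constant: the factor left by
   the energy bound. *)
pose Y : R := k.+1%:R * rho ^+ 2 / C0.
have Y0 : 0 < Y by rewrite divr_gt0// mulr_gt0// exprn_gt0.
pose Z : R := Num.sqrt (#|{: index}|%:R * Y).
have Z0 : 0 < Z.
  by rewrite sqrtr_gt0 mulr_gt0// ltr0n; apply/card_gt0P; exists (ord0, [ffun=> ord0]).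
pose L := aV_lip n k h (K * rho) ((B + D) / (2 * eps)).
have L0 : 0 <= L.
  apply: aV_lip_ge0 => //; first by rewrite mulr_ge0// ltW.
  by rewrite divr_ge0 ?mulr_ge0 ?addr_ge0 ?(ltW hD) ?(ltW heps)// ltW// (lt_trans hA).
(* [Z] serves the H^2 bound and [L * Z] the coefficient. The constant is fixed before [c], the data,
   the exact solution and lam are introduced. *)
exists ((1 + L) * Z) => [|c lam1 g0 g1 Vs _ [lam1_ge1 _ thr] BVs exact_ lam Vm lam1_le minVm bound da].
  by rewrite mulr_gt0// ltr_wpDr.
have lam_ge1 : 1 <= lam by exact: le_trans lam1_le.
have lam0 : 0 < lam by exact: lt_le_trans lam_ge1.
have [dJ [_ sc [V0 [minV0 uniq var]]]] := thr lam lam1_le.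
have BbVs := Ball_Ballbar hAB hD BVs.
have BbVm := minVm.1; have BbV0 := minV0.1.
have HVs := BbVs.1; have HVm := BbVm.1; have HV0 := BbV0.1.
pose X := lam * alpha * (expR (- lam * (A ^+ 2 - c))) ^+ 2 * Y.
have X0 : 0 <= X by exact: mulr_ge0 (mulr_ge0 (mulr_ge0 (ltW lam0) (ltW a0)) (sqr_ge0 _)) (ltW Y0).
have m2 : (2 <= @m_n n)%N by rewrite /m_n addn2.
have M0 : 0 <= K * rho by rewrite mulr_ge0// ltW.
have dX l b : (\sum_i b i <= 2)%N ->
    \int[lebesgue_rv R n.+1]_(x in Omega A B D) (wderiv (Omega A B D) b (tsub Vm Vs l) x) ^+ 2 <= X.
  move=> b2.
  have m1 : measurable_fun (Omega A B D : set 'rV[R]_n.+1) (tsub Vm Vs l).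
    by apply: measurable_funB; [exact: (HVm l).1.1|exact: (HVs l).1.1].
  have m3 : measurable_fun (Omega A B D : set 'rV[R]_n.+1) (tsub V0 Vs l).
    by apply: measurable_funB; [exact: (HV0 l).1.1|exact: (HVs l).1.1].
  (* The variational inequality is known for the minimizer [V0] of the threshold property, whereas
     [Vm] is an arbitrary one. They agree almost everywhere, so their differences with the exact
     solution have literally the same [wderiv]. *)
  have e : {ae lebesgue_rv R n.+1, forall x, Omega A B D x -> tsub Vm Vs l x = tsub V0 Vs l x}.
    by apply: filterS (uniq Vm minVm l) => x e Ox; rewrite /tsub e.
  have -> : wderiv (Omega A B D) b (tsub Vm Vs l) = wderiv (Omega A B D) b (tsub V0 Vs l).
    by move: m1 m3 e; rewrite OmegaE => m1 m3 e; exact: (wderiv_ae (width_gt0 hAB hD) _ m1 m3 e).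
  rewrite (sqnorm_tsubC hAB hD l (leq_trans b2 m2) HV0 HVs).
  exact: (energy_bound hA hAB hD heps a0 hC0 lam_ge1 BVs BbV0 BbVs exact_ sc (var Vs BbVs)).
have [h1 h2 h3] := stability_of_derivatives hA hAB hD heps k0 h_gt0 m2 HVm HVs M0 X0
  (KP _ _ _ _ hrho BbVm) (KP _ _ _ _ hrho BbVs) dX.
have sX : Num.sqrt (#|{: index}|%:R * X) =
    Z * Num.sqrt (lam * alpha) * expR (- lam * (A ^+ 2 - c)).
  have IY : 0 <= #|{: index}|%:R * Y by rewrite mulr_ge0// ltW.
  have la : 0 <= lam * alpha by rewrite mulr_ge0// ltW.
  rewrite /X /Z; set F := expR _; have F0 : 0 <= F by exact: expR_ge0.
  rewrite -[F in RHS](ger0_norm F0) -sqrtr_sqr -!sqrtrM ?(mulr_ge0 IY)//.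
  by congr Num.sqrt; ring.
have s0 : 0 <= Num.sqrt (#|{: index}|%:R * X) by exact: sqrtr_ge0.
have bE : bound = (1 + L) * Num.sqrt (#|{: index}|%:R * X) by rewrite /bound sX; ring.
split; last 1 first.
- by rewrite bE (le_trans h3)// ler_wpM2r// lerDr.
- by rewrite bE (le_trans h1)// mulrDl mul1r lerDl mulr_ge0.
- exact: h2.
Qed.
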